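(* Let $X\subset\mathbb{P}^r$ be a $d$-dimensional normal projective toric variety, embedded by the complete linear system of a very ample line bundle, and let $P$ be the lattice polytope corresponding to the embedding of $X$. Then \[\operatorname{reg}(X)=\max\{k_P,\deg(P)\}+1.\]
   Context: $X$ is embedded in $\mathbb{P}^r\cong\mathbb{P}(H^0(X,L))$ by a very ample line bundle $L=\mathcal{O}_X(D)$, $D$ a torus-invariant divisor, and $P=P_D\subset M_{\mathbb{R}}$ is the associated $d$-dimensional lattice polytope ($M$ the character lattice, of rank $d$). A coherent sheaf $\mathcal{F}$ is $k$-regular if $H^i(\mathcal{F}(k-i))=0$ for all $i>0$; $\operatorname{reg}(\mathcal{F})$ is the minimum $k$ such that $\mathcal{F}$ is $k$-regular. $\operatorname{reg}(X)$ is the regularity of the ideal sheaf $\mathcal{I}_X$ of $X$ in $\mathbb{P}^r$. $P$ is $k$-normal if every point of $kP\cap M$ is a sum of $k$ points of $P\cap M$; $k_P$ is the smallest positive integer such that $P$ is $k$-normal for all $k\ge k_P$. $\deg(P)$: if $P$ has an interior lattice point then $\deg(P)=d$; otherwise $\deg(P)$ is the smallest non-negative integer $i$ such that $kP$ contains no interior lattice points for $1\le k\le d-i$.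
   Formalization: It is assumed in addition that X is not all of P^r; for X = P^r the ideal sheaf is zero, hence k-regular for every k, so reg(X) is undefined. *)

(* Defs.v *)
From HB Require Import structures.
From mathcomp Require Import all_boot all_order all_algebra.
From mathcomp Require Import reals.
From mathcomp Require Import mpoly.

Set Implicit Arguments.
Unset Strict Implicit.
Unset Printing Implicit Defensive.

Import Order.TTheory GRing.Theory Num.Theory.
Local Open Scope ring_scope.

(** * Lattice polytopes

    M = N = Z^d is ['rV[int]_d] and M_R = N_R = R^d is ['rV[R]_d]; the pairing
    between M_R and N_R is the standard dot product. *)

Section Polytopes.
Variables (R : realType) (d : nat).
Implicit Types (P : 'rV[R]_d -> Prop) (x y : 'rV[R]_d) (u v : 'rV[int]_d).

Definition lat u : 'rV[R]_d := map_mx intr u.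

Definition pairing x y : R := \sum_(i < d) x 0 i * y 0 i.

Definition dilate (k : nat) P x : Prop := exists2 y, P y & x = k%:R *: y.

Definition interior P x : Prop :=
  exists2 e : R, 0 < e & forall y, (forall i, `|y 0 i - x 0 i| < e) -> P y.

Definition has_interior_lattice_point P : Prop :=
  exists u, interior P (lat u).

Definition k_normal P (k : nat) : Prop :=
  forall u, dilate k P (lat u) ->
  exists2 s : k.-tuple 'rV[int]_d,
    (forall v, v \in s -> P (lat v)) & u = \sum_(v <- s) v.

(* [is_kP P k]: k = k_P *)
Definition is_kP P (k : nat) : Prop :=
  let good j := (0 < j)%N /\ forall l, (j <= l)%N -> k_normal P l in
  good k /\ forall j, good j -> (k <= j)%N.

(* [is_deg P e]: e = deg(P), for P of dimension d *)
Definition is_deg P (e : nat) : Prop :=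
  let good i := forall k, (1 <= k <= d - i)%N ->
                  ~ has_interior_lattice_point (dilate k P) in
  (has_interior_lattice_point P -> e = d) /\
  (~ has_interior_lattice_point P ->
     good e /\ forall i, good i -> (e <= i)%N).

End Polytopes.

(** * Normal toric varieties *)

Section Toric.
Variables (R : realType) (d : nat).

Definition cone_of (I : finType) (u : I -> 'rV[int]_d) (s : {set I})
    (x : 'rV[R]_d) : Prop :=
  exists2 c : I -> R, (forall i, 0 <= c i)
                    & x = \sum_(i in s) c i *: lat R (u i).

(* A complete fan in N_R, presented by the primitive generators of its rays and
   by its maximal cones, each given by its set of rays; the remaining cones of
   the fan are the faces of these. *)
Record complete_fan := CompleteFan {
  nrays : nat;
  ray : 'I_nrays -> 'rV[int]_d;
  maxcones : {set {set 'I_nrays}};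
  ray_inj : injective ray;
  ray_primitive : forall i (k : int) v, ray i = k *: v -> `|k| = 1;
  ray_used : forall i, exists2 s, s \in maxcones & i \in s;
  ray_extremal : forall s i, s \in maxcones -> i \in s ->
    exists2 m : 'rV[R]_d, pairing m (lat R (ray i)) = 0
      & forall j, j \in s -> j != i -> 0 < pairing m (lat R (ray j));
  maxcone_pointed : forall s x, s \in maxcones ->
    cone_of ray s x -> cone_of ray s (- x) -> x = 0;
  maxcone_full : forall s (m : 'rV[R]_d), s \in maxcones ->
    (forall i, i \in s -> pairing m (lat R (ray i)) = 0) -> m = 0;
  maxcone_inter : forall s t, s \in maxcones -> t \in maxcones ->
    exists2 m : 'rV[R]_d, forall x, cone_of ray s x -> 0 <= pairing m x
      & forall x, cone_of ray s x -> (cone_of ray t x <-> pairing m x = 0);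
  fan_complete : forall x, exists2 s, s \in maxcones & cone_of ray s x
}.

Variable Sigma : complete_fan.

Definition cone (s : {set 'I_(nrays Sigma)}) : 'rV[R]_d -> Prop :=
  cone_of (@ray Sigma) s.

(* A torus-invariant Cartier divisor D = \sum_i a_i D_i: on the chart U_s it is
   the divisor of the character chi^{- m_s}, i.e. <m_s, u_i> = - a_i for every
   ray u_i of s. The value of [local_data] off [maxcones] is irrelevant. *)
Record cartier_divisor := CartierDivisor {
  coeff : 'I_(nrays Sigma) -> int;
  local_data : {set 'I_(nrays Sigma)} -> 'rV[int]_d;
  local_dataP : forall s i, s \in maxcones Sigma -> i \in s ->
    pairing (lat R (local_data s)) (lat R (ray i)) = - (coeff i)%:~R
}.

Definition polytope_of (D : cartier_divisor) (x : 'rV[R]_d) : Prop :=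
  forall i, - (coeff D i)%:~R <= pairing x (lat R (ray i)).

(* [m] enumerates P_D \cap M, i.e. the basis of characters of H^0(X, O(D)). *)
Definition section_basis (D : cartier_divisor) (r : nat)
    (m : r.+1.-tuple 'rV[int]_d) : Prop :=
  uniq m /\ forall u, u \in m <-> polytope_of D (lat R u).

Variable K : closedFieldType.

Definition in_dual (C : 'rV[R]_d -> Prop) (u : 'rV[int]_d) : Prop :=
  forall x, C x -> 0 <= pairing (lat R u) x.

(* The closed points of the affine toric variety U_C = Spec K[C^\vee \cap M]
   are the morphisms from C^\vee \cap M to the multiplicative monoid of K. Such
   a morphism is coded by a function on all of M, whose values off
   C^\vee \cap M are irrelevant. *)
Definition chart_point (C : 'rV[R]_d -> Prop) (g : 'rV[int]_d -> K) : Prop :=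
  g 0 = 1 /\
  forall u v, in_dual C u -> in_dual C v -> g (u + v) = g u * g v.

Definition torus_point : ('rV[int]_d -> K) -> Prop :=
  chart_point (fun x => x = 0).

(* The point g of U_s and the point h of U_t are the same point of X, i.e. both
   come from one point of U_s \cap U_t = U_{s \cap t}. *)
Definition same_point (s t : {set 'I_(nrays Sigma)})
    (g h : 'rV[int]_d -> K) : Prop :=
  exists2 f, chart_point (fun x => cone s x /\ cone t x) f
    & (forall u, in_dual (cone s) u -> f u = g u) /\
      (forall u, in_dual (cone t) u -> f u = h u).

Section Embedding.
Variables (D : cartier_divisor) (r : nat) (m : r.+1.-tuple 'rV[int]_d).

(* The homogeneous coordinates of the image of a point of U_s under the rational
   map X --> P^r of the sections chi^{m_0}, ..., chi^{m_r} of O(D), which is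
   trivialised on U_s by chi^{m_s}. *)
Definition phi (s : {set 'I_(nrays Sigma)}) (g : 'rV[int]_d -> K) :
    'I_r.+1 -> K :=
  fun j => g (tnth m j - local_data D s).

Definition base_point_free : Prop :=
  forall s g, s \in maxcones Sigma -> chart_point (cone s) g ->
  exists j, phi s g j != 0.

Definition phi_injective : Prop :=
  forall s t g h, s \in maxcones Sigma -> t \in maxcones Sigma ->
  chart_point (cone s) g -> chart_point (cone t) h ->
  (exists2 c : K, c != 0 & forall j, phi s g j = c * phi t h j) ->
  same_point s t g h.

(* Surjectivity of O_{P^r, phi p} -> O_{X, p} at every p = g in U_s. The local
   ring O_{X, p} is a localisation of K[s^\vee \cap M], so it is enough that
   each chi^u is the pullback of a fraction F / G regular at phi p; the equality
   chi^u = F / G of rational functions is tested on the dense torus. *)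
Definition phi_stalk_surjective : Prop :=
  forall s g u, s \in maxcones Sigma -> chart_point (cone s) g ->
  in_dual (cone s) u ->
  exists (e : nat) (F G : {mpoly K[r.+1]}),
    [/\ F \is e.-homog, G \is e.-homog, G.@[phi s g] != 0
      & forall t, torus_point t ->
        t u * G.@[fun j => t (tnth m j)] = F.@[fun j => t (tnth m j)]].

(* The complete linear system |D| defines a closed immersion X -> P^r; the
   image is closed because the fan is complete. *)
Definition very_ample : Prop :=
  [/\ base_point_free, phi_injective & phi_stalk_surjective].

(* The image of X in P^r, as a set of homogeneous coordinate vectors *)
Definition embedded_variety (x : 'I_r.+1 -> K) : Prop :=
  exists s g (c : K), [/\ s \in maxcones Sigma, chart_point (cone s) g,
    c != 0 & forall j, x j = c * phi s g j].

End Embedding.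
End Toric.

(** * Castelnuovo-Mumford regularity of ideal sheaves on P^r *)

Section Regularity.
Variables (K : closedFieldType) (r : nat).
Implicit Types (X : ('I_r.+1 -> K) -> Prop) (S T : {set 'I_r.+1}).

Local Notation frac := {fraction {mpoly K[r.+1]}}.

Definition vanishes_on X (f : {mpoly K[r.+1]}) : Prop :=
  forall x, X x -> f.@[x] = 0.

Definition proper_subvariety X : Prop :=
  exists2 x, (exists j, x j != 0) & ~ X x.

(* Sections of I_X(n) over the standard open set U_S where x_i != 0 for all i
   in S: the elements of degree n of the localisation of the homogeneous ideal
   I(X) at \prod_(i in S) x_i, inside the field of fractions of K[x_0..x_r]. *)
Definition ideal_section X (n : int) S (a : frac) : Prop :=
  exists (N e : nat) (f : {mpoly K[r.+1]}),
    [/\ vanishes_on X f, f \is e.-homog, e%:Z = n + (N * #|S|)%:Z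
      & a = tofrac f / tofrac (\prod_(i in S) 'X_i ^+ N)].

(* Alternating Cech p-cochains of I_X(n) for the standard affine cover of P^r:
   only the values at the S of cardinality p + 1 matter. *)
Definition cochain X (n : int) (p : nat) (c : {set 'I_r.+1} -> frac) : Prop :=
  forall S, #|S| = p.+1 -> ideal_section X n S (c S).

Definition cech_d (c : {set 'I_r.+1} -> frac) T : frac :=
  \sum_(i in T) (-1) ^+ #|[set j in T | (j < i)%N]| * c (T :\ i).

(* H^i(P^r, I_X(n)) = 0 for i > 0, cohomology being computed by the Cech complex
   of the standard affine cover *)
Definition ideal_H_vanishes X (n : int) (i : nat) : Prop :=
  forall c, cochain X n i c -> (forall T, #|T| = i.+2 -> cech_d c T = 0) ->
  exists2 b, cochain X n i.-1 b
    & forall S, #|S| = i.+1 -> c S = cech_d b S.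

Definition regular X (k : int) : Prop :=
  forall i : nat, (0 < i)%N -> ideal_H_vanishes X (k - i%:Z) i.

(* [is_reg X k]: k = reg(X). There is no such k for X = P^r, whose ideal sheaf
   is 0 and hence k-regular for every k. *)
Definition is_reg X (k : int) : Prop :=
  regular X k /\ forall l, regular X l -> k <= l.

End Regularity.

(* Main.v *)
Require Import Defs.
From HB Require Import structures.
From mathcomp Require Import all_boot all_order all_algebra.
From mathcomp Require Import reals.
From mathcomp Require Import mpoly.
From mathcomp Require Import boolp ssrcomplements.
From mathcomp Require Import ring lra zify.

(* Let A = {(m_j, 1)} be the homogenised lattice points of P. Both the polynomial
   ring and the coordinate ring of X are graded by Z^(d+1), and in degree w = (u, n)
   the Cech complex of O_X(n) is spanned by the sets S of coordinates for which w lies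
   in cone(A) + span(S): here very ampleness makes the semigroup of every vertex
   saturated. A line shelling (Bruggesser and Mani), done by induction over the facets
   of cone(A), shows that this complex is acyclic, except that for - w in the interior
   of cone(A) it has cohomology in the one degree d + 1. As the Cech complex of O(n) on
   P^r has cohomology only in the extreme degrees, the ideal sheaf satisfies
   H^i(I(n)) = 0 for 2 <= i <= d or i > d + 1 in the relevant range, H^(d+1)(I(n)) = 0
   iff (- n) P has no interior lattice point, and H^1(I(n)) = 0 iff P is n-normal.
   Hence I is (j+1)-regular iff P is j-normal and deg P <= j. Finally, for deg P <= j
   every lattice point of (j+1) P is a lattice point of j P plus a vertex, so that
   j-normality propagates upwards, and deg P >= 1 because X is not P^r. *)

Set Implicit Arguments.
Unset Strict Implicit.
Unset Printing Implicit Defensive.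

Import Order.TTheory GRing.Theory Num.Theory.
Local Open Scope ring_scope.

(** * Alternating cochains on families of sets *)

(** No exact sequence of sheaves is used. A cocycle of I(n) bounds in the complex of O(n) on P^r;
    adding up the coefficients of that primitive within each weight u gives a scalar cocycle on the
    local family of (u, n), and the cocycle bounds in I(n) once the scalar one bounds by a cochain
    that lifts to monomials. A Cech i-cochain lives on sets of cardinality i + 1 and its primitive
    on cardinality i, so H^i(I(n)) is governed by exactness at cardinality i, and the exceptional
    cardinality d + 1 concerns H^(d+1). The empty set belongs to the families, i.e. the complexes
    are augmented. It is the only S where cone and semigroup may disagree: a point of cone(A) +
    span(S) gives a monomial when S is nonempty, while for S empty this is n-normality. Hence only
    H^1 sees normality. Laurent polynomials are stored after multiplication by (x_0 ... x_r)^N, and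
    N has to grow with the cochains; this is why lifts are asked for all large N. *)

Section Cochains.
Variables (n : nat) (A : nzRingType).
Implicit Types (S T U : {set 'I_n}) (c q b : {set 'I_n} -> A)
  (Phi : pred {set 'I_n}).

Definition pos_in T (i : 'I_n) := #|[set j in T | (j < i)%N]|.

(** Same body as [cech_d], over any ring, so the two are convertible. The empty set counts as a
    cell: this is the augmented cochain complex of a simplex. *)
Definition codiff c T : A := \sum_(i in T) (-1) ^+ pos_in T i * c (T :\ i).

Lemma codiffD c b T : codiff (fun S => c S + b S) T = codiff c T + codiff b T.
Proof. by rewrite -big_split; apply: eq_bigr => i _; rewrite mulrDr. Qed.

Lemma codiffN c T : codiff (fun S => - c S) T = - codiff c T.
Proof. by rewrite /codiff -sumrN; apply: eq_bigr => i _; rewrite mulrN. Qed.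

Lemma codiffB c b T : codiff (fun S => c S - b S) T = codiff c T - codiff b T.
Proof. by rewrite codiffD codiffN. Qed.

Lemma eq_codiff c b T :
  (forall i, i \in T -> c (T :\ i) = b (T :\ i)) -> codiff c T = codiff b T.
Proof. by move=> E; apply: eq_bigr => i iT; rewrite E. Qed.

Lemma codiff_eq0 c T : (forall i, i \in T -> c (T :\ i) = 0) -> codiff c T = 0.
Proof. by move=> E; apply: big1 => i iT; rewrite E // mulr0. Qed.

Lemma codiff_neq0 c T : codiff c T != 0 -> exists2 i, i \in T & c (T :\ i) != 0.
Proof.
move=> nz; case: (pickP (fun i => (i \in T) && (c (T :\ i) != 0))).
  by move=> i /andP[]; exists i.
move=> E; case/eqP: nz; apply: codiff_eq0 => i iT.
by have := E i; rewrite iT /= => /negbFE/eqP.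
Qed.

Lemma pos_inD1 T i j : i \in T -> pos_in T j = ((i < j) + pos_in (T :\ i) j)%N.
Proof.
move=> iT; rewrite /pos_in (cardsD1 i) inE iT; congr (_ + _)%N.
by apply: eq_card => k; rewrite !inE andbA.
Qed.

Lemma setD1C T i j : T :\ i :\ j = T :\ j :\ i.
Proof. by apply/setP => k; rewrite !inE; case: (k == i); case: (k == j). Qed.

Lemma codiffK c T : codiff (codiff c) T = 0.
Proof.
pose F i j := (-1) ^+ pos_in T i * ((-1) ^+ pos_in (T :\ i) j * c (T :\ i :\ j)).
have FC i j : i \in T -> j \in T -> (i < j)%N -> F i j = - F j i.
  move=> iT jT ij; rewrite /F (setD1C T j i) !mulrA -!exprD -mulNr.
  congr (_ * _); rewrite (@pos_inD1 T j i) // (@pos_inD1 T i j) // ij.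
  rewrite ltnNge (ltnW ij) /= add0n add1n addSn exprS mulN1r opprK.
  by rewrite addnC.
rewrite /codiff.
transitivity (\sum_(i in T) \sum_(j in T) (if (i < j)%N then F i j else 0) +
              \sum_(i in T) \sum_(j in T) (if (j < i)%N then F i j else 0)).
  rewrite -big_split; apply: eq_bigr => i iT; rewrite /= -big_split big_distrr /=.
  rewrite [RHS](bigD1 i) //= !ltnn addr0 add0r.
  apply: eq_big => [j|j]; first by rewrite !inE andbC.
  rewrite !inE => /andP[ji jT]; rewrite -/(F i j).
  have := ji; rewrite -val_eqE /= neq_ltn => /orP[] L.
    by rewrite L ltnNge (ltnW L) /= add0r.
  by rewrite L ltnNge (ltnW L) /= addr0.
rewrite [X in _ + X]exchange_big -big_split big1 //= => i iT.
rewrite -big_split big1 //= => j jT; case: ifP => // [|_]; last by rewrite addr0.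
by move=> ij; rewrite FC // addNr.
Qed.

Definition cone_op (e : 'I_n) c S : A :=
  if e \in S then 0 else (-1) ^+ pos_in (e |: S) e * c (e |: S).

Lemma cone_opK e c T : codiff (cone_op e c) T + cone_op e (codiff c) T = c T.
Proof.
have sq k : (-1) ^+ k * (-1) ^+ k = 1 :> A by rewrite -signr_odd -expr2 sqrr_sign.
case: (boolP (e \in T)) => eT.
  rewrite {2}/cone_op eT addr0 /codiff (bigD1 e) //= big1 => [|i /andP[iT ie]].
    by rewrite /cone_op !inE eqxx /= setD1K // addr0 mulrA sq mul1r.
  by rewrite /cone_op !inE eq_sym ie eT mulr0.
rewrite {2}/cone_op (negbTE eT) {2}/codiff (bigD1 e) ?setU11 //= mulrDr mulrA.
rewrite sq mul1r setU1K // addrCA -[RHS]addr0; congr (_ + _).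
rewrite big_distrr /= /codiff.
rewrite [X in _ + X](eq_bigl (fun x => x \in T)); last first.
  by move=> i; rewrite !inE; case: (boolP (i == e)) => [/eqP->|] //=;
    rewrite ?(negbTE eT) ?andbT ?andbF.
rewrite -big_split big1 //= => i iT.
have ie : i != e by apply: contraNneq eT => <-.
have E : e |: T :\ i = (e |: T) :\ i.
  by apply/setP => k; rewrite !inE; case: eqVneq => // ->; rewrite eq_sym ie.
rewrite /cone_op !inE (negbTE eT) andbF E !mulrA -mulrDl.
rewrite -[RHS](mul0r (c ((e |: T) :\ i))); congr (_ * _).
rewrite (@pos_inD1 (e |: T) i e) ?(setU1r _ iT) //.
have -> : pos_in (e |: T) i = ((e < i) + pos_in T i)%N.
  by rewrite (@pos_inD1 _ e) ?setU11 // setU1K.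
rewrite -!exprD; have := ie; rewrite -val_eqE /= neq_ltn => /orP[] L.
  rewrite L ltnNge (ltnW L) /= add0n add1n addSn exprS mulN1r addnC.
  by rewrite addrN.
rewrite L ltnNge (ltnW L) /= add0n add1n addnS exprS mulN1r addnC.
by rewrite addrN.
Qed.

(* Exactness at the sets of cardinality k of the complex of functions supported
   on Phi, with the differential restricted to Phi. *)
Definition acyclic Phi k : Prop :=
  forall q, (forall S, q S != 0 -> Phi S /\ #|S| = k) ->
    (forall T, Phi T -> codiff q T = 0) ->
  exists2 b, (forall S, b S != 0 -> Phi S /\ #|S|.+1 = k)
    & forall S, Phi S -> codiff b S = q S.

(** Convexity makes the differential restricted to [Phi] square to zero: no set between two members
    drops out of the double sum. *)
Definition convex_family Phi := forall S T U,
  Phi S -> Phi U -> S \subset T -> T \subset U -> Phi T.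

Definition restrict Phi c S : A := if Phi S then c S else 0.

Lemma acyclic_empty Phi k : (forall S, ~~ Phi S) -> acyclic Phi k.
Proof.
move=> E q _ _; exists (fun=> 0) => [S|S PS]; first by rewrite eqxx.
by have := E S; rewrite PS.
Qed.

(** A family insensitive to adding or removing [e] is preserved by [cone_op e], which contracts
    it. *)
Lemma acyclic_cone Phi e k :
  (forall S, Phi (e |: S) = Phi (S :\ e)) -> acyclic Phi k.
Proof.
move=> E q qP dq.
have Ed S : e \notin S -> Phi (e |: S) = Phi S.
  by move=> eS; rewrite E; congr (Phi _); apply/setDidPl; rewrite disjoint_sym disjoints1.
exists (cone_op e q) => [S|S PS].
  rewrite /cone_op; case: ifPn => [|eS]; first by rewrite eqxx.
  case: (eqVneq (q (e |: S)) 0) => [->|/qP]; first by rewrite mulr0 eqxx.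
  by rewrite Ed // cardsU1 eS add1n.
rewrite -[RHS](cone_opK e) -[LHS]addr0; congr (_ + _).
rewrite /cone_op; case: ifPn => // eS.
by rewrite dq ?mulr0 // Ed.
Qed.

Lemma codiff_card q k T :
  (forall S, q S != 0 -> #|S| = k) -> codiff q T != 0 -> #|T| = k.+1.
Proof. by move=> qk /codiff_neq0[i iT] /qk <-; rewrite (cardsD1 i) iT. Qed.

Lemma codiff_restrict Phi b T : convex_family Phi ->
  (forall S, b S != 0 -> Phi S) -> Phi T ->
  codiff (restrict Phi (codiff b)) T = 0.
Proof.
move=> cP bP PT; rewrite -[RHS](codiffK b T); apply: eq_codiff => i iT.
rewrite /restrict; case: ifPn => // nP; apply/esym/eqP; apply: contraNT nP.
case/codiff_neq0 => j jT /bP Pj; apply: cP Pj PT _ _; exact: subsetDl.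
Qed.

(** * Exact sequences for a family cut in two *)

Section Filtration.
Variables (Phi Phi1 Phi2 : pred {set 'I_n}).
Hypotheses (Pcvx : convex_family Phi)
  (PU : forall S, Phi S = Phi1 S || Phi2 S)
  (PI : forall S, Phi1 S -> ~~ Phi2 S)
  (P2up : forall S T, Phi2 S -> Phi T -> S \subset T -> Phi2 T).

Let P1 S : Phi1 S -> Phi S. Proof. by rewrite PU => ->. Qed.
Let P2 S : Phi2 S -> Phi S. Proof. by rewrite PU orbC => ->. Qed.

Let codiff2 b T : (forall S, b S != 0 -> Phi2 S) -> Phi1 T -> codiff b T = 0.
Proof.
move=> bP T1; apply: codiff_eq0 => i iT; apply/eqP; apply: contraLR (PI T1) => /bP.
by rewrite negbK => /P2up; apply; rewrite ?P1 ?subsetDl.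
Qed.

Let restrict_sup b c k : (forall S, b S != 0 -> #|S|.+1 = k) ->
    (forall S, c S != 0 -> Phi S /\ #|S| = k) ->
  (forall S, Phi1 S -> codiff b S = c S) ->
  forall S, c S - restrict Phi (codiff b) S != 0 -> Phi2 S /\ #|S| = k.
Proof.
move=> bP cP E S; rewrite /restrict; case: (boolP (Phi S)) => [PS|nP]; last first.
  by rewrite subr0 => /cP[]; rewrite (negbTE nP).
case/boolP: (Phi1 S) => [/E->|S1]; first by rewrite subrr eqxx.
move: PS; rewrite PU (negbTE S1) /= => S2 nz; split=> //.
case: (eqVneq (c S) 0) nz => [->|/cP[]//]; rewrite sub0r oppr_eq0.
by case/codiff_neq0 => i iS /bP <-; rewrite (cardsD1 i S) iS.
Qed.

Let restrict1 b T : Phi1 T -> (forall S, b S != 0 -> Phi S) ->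
  codiff (restrict Phi1 b) T = codiff b T.
Proof.
move=> T1 bP; apply: eq_codiff => i iT; rewrite /restrict.
case: ifPn => // n1; apply/esym/eqP; apply: contraNT n1 => /bP.
rewrite PU => /orP[//|/P2up/(_ (P1 T1) (subsetDl _ _))].
by rewrite (negbTE (PI T1)).
Qed.

(** [Phi2] is closed upwards in [Phi], so its cochains form a subcomplex and those of [Phi1] the
    quotient. This lemma and the next two are the consequences of the long exact sequence for the
    middle, sub- and quotient complex. *)
Lemma acyclic_extension k : acyclic Phi1 k -> acyclic Phi2 k -> acyclic Phi k.
Proof.
move=> H1 H2 q qP dq.
have [S|T T1|b1 b1P db1] := H1 (restrict Phi1 q).
- by rewrite /restrict; case: ifP => [? /qP[]|]; rewrite ?eqxx.
- by rewrite restrict1 ?dq ?P1 // => S /qP[].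
have {}db1 S : Phi1 S -> codiff b1 S = q S by move=> S1; rewrite db1 // /restrict S1.
(* A primitive on the quotient leaves an error supported on [Phi2]. *)
have [|T T2|b2 b2P db2] := H2 (fun S => q S - restrict Phi (codiff b1) S).
- by apply: restrict_sup => // S /b1P[].
- rewrite codiffB dq ?P2 // codiff_restrict ?P2 ?subr0 // => S /b1P[/P1].
  by [].
exists (fun S => b1 S + b2 S) => [S|S].
  case: (eqVneq (b1 S) 0) => [->|/b1P[/P1]//]; rewrite add0r.
  by case/b2P => /P2.
rewrite PU codiffD => /orP[S1|S2].
  by rewrite db1 // codiff2 ?addr0 // => U /b2P[].
by rewrite db2 // /restrict P2 // addrC subrK.
Qed.

Lemma acyclic_sub k :
    acyclic Phi k -> (forall l, l.+1 = k -> acyclic Phi1 l) -> acyclic Phi2 k.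
Proof.
move=> H H1 q qP dq.
have [S /qP[/P2]//|T|b bP db] := H q.
  by rewrite PU => /orP[T1|/dq//]; apply: codiff2 => // S /qP[].
case: k => [|k] in H H1 qP bP *.
  by exists b => [S /bP[]//|S /P2/db].
(* The primitive [b] in [Phi] may be nonzero on [Phi1]; it is a cocycle there, so a coboundary
   removes that part. *)
have [S|T T1|b1 b1P db1] := H1 k erefl (restrict Phi1 b).
- by rewrite /restrict; case: ifP => [? /bP[_ []]|]; rewrite ?eqxx.
- rewrite restrict1 => // [|S /bP[]//]; rewrite db ?P1 //.
  by apply/eqP; apply: contraLR (PI T1) => /qP[]; rewrite negbK.
exists (fun S => b S - restrict Phi (codiff b1) S) => [S nz|S S2].
  have h1 U : b1 U != 0 -> #|U|.+1 = k by case/b1P.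
  have h2 U : b U != 0 -> Phi U /\ #|U| = k by case/bP=> ? [].
  have h3 U : Phi1 U -> codiff b1 U = b U by move=> U1; rewrite db1 // /restrict U1.
  by have [? <-] := restrict_sup h1 h2 h3 nz.
rewrite codiffB codiff_restrict ?P2 ?subr0 ?db ?P2 // => U /b1P[/P1].
by [].
Qed.

Lemma acyclic_quotient k :
  acyclic Phi k -> acyclic Phi2 k.+1 -> acyclic Phi1 k.
Proof.
move=> H H2 q qP dq.
have dqk S : codiff q S != 0 -> #|S| = k.+1.
  by apply: codiff_card => U /qP[].
have qPhi S : q S != 0 -> Phi S by case/qP => /P1.
have E S : restrict Phi2 (codiff q) S = restrict Phi (codiff q) S.
  rewrite /restrict; case: (boolP (Phi2 S)) => [/P2->//|n2].
  by rewrite PU (negbTE n2) orbF; case: ifP => // /dq.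
(* This argument is the image of [q] under the connecting map. *)
have [S|T T2|b2 b2P db2] := H2 (restrict Phi2 (codiff q)).
- by rewrite /restrict; case: ifP => [? /dqk|]; rewrite ?eqxx.
- by rewrite (eq_codiff (fun i _ => E (T :\ i))) codiff_restrict ?P2.
have [S|T|b bP db] := H (fun S => q S - b2 S).
- case: (eqVneq (q S) 0) => [->|/qP[/P1]//]; rewrite sub0r oppr_eq0.
  by case/b2P => /P2 ? [].
- rewrite PU codiffB => /orP[T1|T2].
    by rewrite dq // codiff2 ?subrr // => S /b2P[].
  by rewrite db2 // /restrict T2 subrr.
exists (restrict Phi1 b) => [S|S S1].
  by rewrite /restrict; case: ifP => [? /bP[]|]; rewrite ?eqxx.
rewrite restrict1 ?db ?P1 // => [|U /bP[]//].
case: (eqVneq (b2 S) 0) => [->|/b2P[S2]]; first by rewrite subr0.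
by have := PI S1; rewrite S2.
Qed.

End Filtration.
End Cochains.

(** * Convex cones *)

Section Dot.
Variables (F : comNzRingType) (n : nat).
Implicit Types x y z : 'rV[F]_n.

Definition dot x y : F := \sum_(i < n) x 0 i * y 0 i.

Lemma dotC x y : dot x y = dot y x.
Proof. by apply: eq_bigr => i _; rewrite mulrC. Qed.

Lemma dotDr x y z : dot x (y + z) = dot x y + dot x z.
Proof. by rewrite -big_split; apply: eq_bigr => i _; rewrite mxE mulrDr. Qed.

Lemma dotZr x k y : dot x (k *: y) = k * dot x y.
Proof. by rewrite /dot big_distrr; apply: eq_bigr => i _; rewrite mxE mulrCA. Qed.

Lemma dotDl x y z : dot (x + y) z = dot x z + dot y z.
Proof. by rewrite ![dot _ z]dotC dotDr. Qed.

Lemma dotZl x k y : dot (k *: x) y = k * dot x y.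
Proof. by rewrite ![dot _ y]dotC dotZr. Qed.

Lemma dotNr x y : dot x (- y) = - dot x y.
Proof. by rewrite -scaleN1r dotZr mulN1r. Qed.

Lemma dotNl x y : dot (- x) y = - dot x y.
Proof. by rewrite ![dot _ y]dotC dotNr. Qed.

Lemma dotBr x y z : dot x (y - z) = dot x y - dot x z.
Proof. by rewrite dotDr dotNr. Qed.

Lemma dotBl x y z : dot (x - y) z = dot x z - dot y z.
Proof. by rewrite dotDl dotNl. Qed.

Lemma dot0r x : dot x 0 = 0.
Proof. by rewrite /dot big1 // => i _; rewrite mxE mulr0. Qed.

Lemma dot0l x : dot 0 x = 0.
Proof. by rewrite dotC dot0r. Qed.

Lemma dot_sumr x (I : Type) (s : seq I) (P : pred I) (f : I -> 'rV[F]_n) :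
  dot x (\sum_(i <- s | P i) f i) = \sum_(i <- s | P i) dot x (f i).
Proof. exact: (big_morph _ (dotDr x) (dot0r x)). Qed.

Lemma dotMnr x y k : dot x (y *+ k) = dot x y *+ k.
Proof. by elim: k => [|k IH]; rewrite ?mulr0n ?dot0r // !mulrS dotDr IH. Qed.

Lemma dot_delta x i : dot x (delta_mx 0 i) = x 0 i.
Proof.
rewrite /dot (bigD1 i) //= big1 => [|j ji]; rewrite mxE ?eqxx ?mulr1 ?addr0 //.
by rewrite (negbTE ji) mulr0.
Qed.

End Dot.

Lemma dot_row_mx (F : comNzRingType) n1 n2 (x y : 'rV[F]_n1) (x' y' : 'rV[F]_n2) :
  dot (row_mx x x') (row_mx y y') = dot x y + dot x' y'.
Proof.
rewrite /dot big_split_ord; congr (_ + _); apply: eq_bigr => i _.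
  by rewrite !row_mxEl.
by rewrite !row_mxEr.
Qed.

Lemma dot_map (F F' : comNzRingType) (f : {rmorphism F -> F'}) n (x y : 'rV[F]_n) :
  dot (map_mx f x) (map_mx f y) = f (dot x y).
Proof. by rewrite /dot rmorph_sum; apply: eq_bigr => i _; rewrite !mxE rmorphM. Qed.

Section Cones.
Variables (F : realFieldType) (n : nat).
Implicit Types (x w l : 'rV[F]_n).

Lemma dot_gt0 x : x != 0 -> 0 < dot x x.
Proof.
move=> nz; rewrite lt_def sumr_ge0 ?andbT => [|i _]; last by rewrite -expr2 sqr_ge0.
apply: contraNneq nz => /eqP; rewrite psumr_eq0 => [/allP E|i _]; last first.
  by rewrite -expr2 sqr_ge0.
apply/eqP/rowP => i; rewrite mxE; apply/eqP.
by have := E i (mem_index_enum _); rewrite /= mulf_eq0 orbb.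
Qed.

(* Induction on the number of generators: if a functional l separates w from all
   generators but the new one, project everything along the latter to ker l. *)
Lemma farkas_seq (I : eqType) (s : seq I) (a : I -> 'rV[F]_n) w : uniq s ->
  (exists2 c : I -> F, forall i, 0 <= c i & w = \sum_(i <- s) c i *: a i) \/
  (exists2 l, forall i, i \in s -> 0 <= dot l (a i) & dot l w < 0).
Proof.
elim: s a w => [|k s IH] a w /=.
  case: (eqVneq w 0) => [-> _|w0 _]; first by left; exists (fun=> 0); rewrite ?big_nil.
  by right; exists (- w); rewrite // dotNl oppr_lt0 dot_gt0.
case/andP=> ks us.
have ext (c : I -> F) t : \sum_(i <- s) (if i == k then t else c i) *: a i =
    \sum_(i <- s) c i *: a i.
  by apply: eq_big_seq => i iS; case: eqP => // E; rewrite -E iS in ks.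
have [[c c0 ->]|[l l0 lw]] := IH a w us.
  left; exists (fun i => if i == k then 0 else c i) => [i|]; first by case: ifP.
  by rewrite big_cons eqxx scale0r add0r ext.
have [lk|lk] := lerP 0 (dot l (a k)).
  by right; exists l => // i; rewrite inE => /orP[/eqP->//|/l0].
pose pr x := x - (dot l x / dot l (a k)) *: a k.
have [[c c0 E]|[l' l'0 l'w]] := IH (pr \o a) (pr w) us.
  left; exists (fun i => if i == k then
      dot l w / dot l (a k) - \sum_(i <- s) c i * (dot l (a i) / dot l (a k))
    else c i) => [i|].
    case: ifP => // _; rewrite subr_ge0.
    apply: (@le_trans _ _ 0); last by rewrite ltW // nmulr_lgt0 ?invr_lt0.
    rewrite big_seq; apply: sumr_le0 => j js.
    by rewrite mulr_ge0_le0 // mulr_ge0_le0 ?l0 // invr_le0 ltW.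
  rewrite big_cons eqxx ext scalerBl scaler_suml.
  rewrite -[LHS](subrK ((dot l w / dot l (a k)) *: a k)) -/(pr w) E.
  have -> : \sum_(i <- s) c i *: (pr \o a) i = \sum_(i <- s) c i *: a i -
      \sum_(i <- s) (c i * (dot l (a i) / dot l (a k))) *: a k.
    by rewrite -sumrB; apply: eq_bigr => i _; rewrite scalerBr scalerA.
  by rewrite -addrA [RHS]addrC; congr (_ + _); apply: addrC.
have swap (u v t : F) : u / v * t = t / v * u by ring.
right; exists (l' - (dot l' (a k) / dot l (a k)) *: l) => [i|].
  rewrite inE dotBl dotZl => /orP[/eqP->|iS].
    by rewrite divfK ?subrr // ltr0_neq0.
  by have := l'0 i iS; rewrite /pr /= dotBr dotZr swap.
by move: l'w; rewrite /pr dotBr dotZr dotBl dotZl swap.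
Qed.

(** The cone of the localisation at S: inverting the generators in S frees the signs of their
    coefficients. *)
Definition local_cone (I : finType) (a : I -> 'rV[F]_n) (V S : {set I}) w :=
  exists2 c : I -> F, forall i, i \in V -> i \notin S -> 0 <= c i
                    & w = \sum_(i in V) c i *: a i.

Lemma farkas_local (I : finType) (a : I -> 'rV[F]_n) (V S : {set I}) w :
  S \subset V ->
  local_cone a V S w \/
  exists l, [/\ forall i, i \in V -> 0 <= dot l (a i),
                forall i, i \in S -> dot l (a i) = 0 & dot l w < 0].
Proof.
move=> SV.
(* One extra generator, minus the sum over S, yields every [- a i] with i in S, so ordinary Farkas
   applies. *)
pose b := oapp a (- \sum_(i in S) a i).
have u : uniq (None :: [seq Some i | i <- enum V]).
  rewrite /= map_inj_uniq ?enum_uniq ?andbT; last by move=> ? ? [].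
  by apply/mapP => -[].
have [[c c0 E]|[l l0 lw]] := farkas_seq b w u.
  left; exists (fun i => c (Some i) - if i \in S then c None else 0) => [i _ iS|].
    by rewrite (negbTE iS) subr0.
  rewrite E big_cons big_map big_enum addrC /=.
  under [RHS]eq_bigr do rewrite scalerBl.
  rewrite sumrB scalerN scaler_sumr; congr (_ - _).
  rewrite [RHS](big_setID S) /= (setIidPr SV) [X in _ = _ + X]big1 ?addr0.
    by apply: eq_bigr => i ->.
  by move=> i /setDP[_ /negbTE->]; rewrite scale0r.
have lV i : i \in V -> 0 <= dot l (a i).
  move=> iV; apply: (l0 (Some i)); rewrite inE /=; apply: map_f.
  by rewrite mem_enum.
right; exists l; split => // i iS.
have := l0 None (mem_head _ _); rewrite /= dotNr dot_sumr oppr_ge0 => le0.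
have : \sum_(j in S) dot l (a j) == 0.
  by rewrite eq_le le0 sumr_ge0 // => j /(subsetP SV)/lV.
rewrite psumr_eq0 => [/allP/(_ i (mem_index_enum _))|j /(subsetP SV)/lV //].
by rewrite iS => /eqP.
Qed.

Section Independence.
Variables (I : finType) (a : I -> 'rV[F]_n).
Implicit Types (B V : {set I}).

Definition indep B := forall e : I -> F, \sum_(i in B) e i *: a i = 0 ->
  forall i, i \in B -> e i = 0.

Lemma indep_card B : indep B -> (#|B| <= n)%N.
Proof.
move=> ind.
pose M : 'M[F]_(#|B|, n) := \matrix_k a (enum_val k).
suff : row_free M by rewrite /row_free => /eqP <-; apply: rank_leq_col.
apply: inj_row_free => v vM.
have E i : i \in B -> exists k, i = enum_val (k : 'I_#|B|).
  by move=> iB; exists (enum_rank_in iB i); rewrite enum_rankK_in.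
pose e i := if pickP (fun k => i == enum_val (k : 'I_#|B|)) is Pick k _ then v 0 k else 0.
have ee k : e (enum_val k) = v 0 k.
  by rewrite /e; case: pickP => [j /eqP/enum_val_inj->|/(_ k)]; rewrite ?eqxx.
have e0 : \sum_(i in B) e i *: a i = 0.
  rewrite -[RHS]vM mulmx_sum_row big_enum_val.
  by apply: eq_bigr => k _; rewrite ee rowK.
by apply/rowP => k; rewrite mxE -ee (ind e e0) ?enum_valP.
Qed.

Lemma indep_extend B V : indep B -> B \subset V ->
  exists C : {set I}, [/\ B \subset C, C \subset V, indep C &
    forall i, i \in V -> exists e : I -> F, a i = \sum_(j in C) e j *: a j].
Proof.
move=> iB BV.
pose P (C : {set I}) := (B \subset C) && (C \subset V) && `[< indep C >].
have PB : P B by rewrite /P subxx BV; apply/asboolP.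
have [C /andP[/andP[BC CV] /asboolP iC] Cmax] := @arg_maxnP _ B P (fun C : {set I} => #|C|) PB.
exists C; split => // i iV.
case: (boolP (i \in C)) => [iC'|niC].
  exists (fun j => (j == i)%:R); rewrite (bigD1 i) //= eqxx scale1r big1 ?addr0 //.
  by move=> j /andP[_ /negbTE->]; rewrite scale0r.
case: (EM (exists e : I -> F, a i = \sum_(j in C) e j *: a j)) => // nspan.
have : P (i |: C).
  rewrite /P (subset_trans BC (subsetUr _ _)) subUset sub1set iV CV /=.
  apply/asboolP => e; rewrite big_setU1 //= => E.
  have ei : e i = 0.
    apply/eqP/negPn/negP => nz; apply: nspan.
    exists (fun j => - (e i)^-1 * e j).
    under eq_bigr do rewrite -scalerA.
    rewrite -scaler_sumr -[LHS]scale1r -(mulVf nz) -scalerA scaleNr -scalerN.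
    by congr (_ *: _); apply/eqP; rewrite -addr_eq0 E.
  move: E; rewrite ei scale0r add0r => /iC H j; rewrite !inE.
  by case/orP => [/eqP->|/H].
by move/Cmax => /=; rewrite cardsU1 niC add1n ltnn.
Qed.

(** A representation with fewest vectors uses independent ones: otherwise subtract the multiple of a
    dependence at which a first coefficient reaches zero. *)
Lemma caratheodory V (c : I -> F) w :
  (forall i, i \in V -> 0 <= c i) -> w = \sum_(i in V) c i *: a i ->
  exists (B : {set I}) (c' : I -> F), [/\ B \subset V, indep B,
    forall i, i \in B -> 0 <= c' i & w = \sum_(i in B) c' i *: a i].
Proof.
move=> c0 wE.
pose Q (B : {set I}) (c : I -> F) :=
  (forall i, i \in B -> 0 <= c i) /\ w = \sum_(i in B) c i *: a i.
pose P (B : {set I}) := (B \subset V) && `[< exists c, Q B c >].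
have PV : P V by rewrite /P subxx; apply/asboolP; exists c.
have [B /andP[BV /asboolP[c' [c'0 wE']]] Bmin] :=
  @arg_minnP _ V P (fun B : {set I} => #|B|) PV.
exists B, c'; split => // e E i iB; apply/eqP/negPn/negP => nz.
wlog ei : e E nz / 0 < e i.
  move=> H; have : 0 < `|e i| by rewrite normr_gt0.
  case: (ler0P (e i)) => [_ ?|? _]; last by apply: H nz _.
  apply: (H (fun j => - e j)); rewrite ?oppr_eq0 //.
  by under eq_bigr do rewrite scaleNr; rewrite sumrN E oppr0.
have [i1 /andP[i1B ei1] tmin] :=
  @arg_minP _ _ _ i (fun j => (j \in B) && (0 < e j)) (fun j => c' j / e j)
    (introT andP (conj iB ei)).
pose t := c' i1 / e i1.
have t0 : 0 <= t by rewrite divr_ge0 ?c'0 // ltW.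
have /Bmin : P (B :\ i1).
  rewrite /P (subset_trans (subsetDl _ _) BV) /=; apply/asboolP.
  exists (fun j => c' j - t * e j); split => [j /setD1P[_ jB]|].
    rewrite subr_ge0; have [ej|ej] := lerP (e j) 0.
      by rewrite (le_trans _ (c'0 j jB)) // mulr_ge0_le0.
    by rewrite -ler_pdivlMr //; apply: tmin; rewrite jB.
  have : w = \sum_(j in B) (c' j - t * e j) *: a j.
    under eq_bigr do rewrite scalerBl -scalerA.
    by rewrite sumrB -scaler_sumr E scaler0 subr0.
  rewrite (big_setD1 i1) //= divfK ?subrr ?scale0r ?add0r //.
  by rewrite gt_eqF.
by rewrite [#|B|](cardsD1 i1) i1B add1n ltnn.
Qed.

End Independence.
End Cones.

Lemma rat_common_denominator (I : finType) (c : I -> rat) :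
  (forall i, 0 <= c i) ->
  exists (k : nat) (b : I -> nat), (0 < k)%N /\ forall i, c i * k%:R = (b i)%:R.
Proof.
move=> c0.
exists (\prod_i `|denq (c i)|)%N.
exists (fun i => `|numq (c i)| * \prod_(j | j != i) `|denq (c j)|)%N.
split=> [|i]; first by rewrite prodn_gt0 // => i; rewrite absz_gt0 denq_neq0.
rewrite (bigD1 i) //= !natrM mulrA; congr (_ * _).
have dE : (`|denq (c i)|%:R : rat) = (denq (c i))%:~R.
  by rewrite natr_absz ger0_norm ?denq_ge0.
have nE : (`|numq (c i)|%:R : rat) = (numq (c i))%:~R.
  by rewrite natr_absz ger0_norm ?numq_ge0.
by rewrite dE nE -{1}[c i]divq_num_den divfK // intr_eq0 denq_neq0.
Qed.

(* Farkas over the rationals: a rational functional separating z from the a i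
   over rat would separate them over F as well. *)
Lemma integral_cone_multiple (F : realFieldType) n (I : finType)
    (a : I -> 'rV[int]_n) (z : 'rV[int]_n) (c : I -> F) :
  (forall i, 0 <= c i) ->
  map_mx intr z = \sum_i c i *: map_mx intr (a i) ->
  exists (k : nat) (b : I -> nat), (0 < k)%N /\ z *+ k = \sum_i a i *+ b i.
Proof.
move=> c0 zE.
have [[q q0 qE]|[l l0 lz]] :=
  farkas_seq (fun i => map_mx intr (a i) : 'rV[rat]_n) (map_mx intr z) (index_enum_uniq I).
  have [k [b [k0 bE]]] := rat_common_denominator q0.
  exists k, b; split=> //; apply/rowP => j.
  apply: (intr_inj (R := rat)).
  have zj : (z 0 j)%:~R = \sum_i q i * (a i 0 j)%:~R.
    have := congr1 (fun v : 'rV[rat]_n => v 0 j) qE; rewrite mxE summxE => ->.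
    by apply: eq_bigr => i _; rewrite !mxE.
  rewrite mulmxnE rmorphMn /= zj summxE rmorph_sum -sumrMnl; apply: eq_bigr => i _.
  by rewrite mulmxnE rmorphMn /= -[LHS]mulr_natr mulrAC bE mulr_natl.
have : 0 <= ratr (dot l (map_mx intr z)) :> F.
  have cast (v : 'rV[int]_n) : map_mx intr v = map_mx ratr (map_mx intr v) :> 'rV[F]_n.
    by apply/rowP => j; rewrite !mxE ratr_int.
  rewrite -(dot_map (ratr : {rmorphism rat -> F})) -cast zE dot_sumr.
  apply: sumr_ge0 => i _; rewrite dotZr mulr_ge0 // cast.
  by rewrite (dot_map (ratr : {rmorphism rat -> F})) ler0q l0 // mem_index_enum.
by rewrite ler0q leNgt lz.
Qed.

(** * Acyclicity of local families *)

Lemma exists_small_factor (F : realFieldType) (J : finType) (P : pred J) (p q : J -> F) :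
  (forall j, P j -> 0 < p j) ->
  exists2 e : F, 0 < e & forall j, P j -> e * q j <= p j.
Proof.
move=> p0; pose s := 1 + \sum_(j | P j) `|q j| / p j.
have nn j : P j -> 0 <= `|q j| / p j by move=> Pj; rewrite divr_ge0 // ltW ?p0.
have s0 : 0 < s by rewrite ltr_pwDl // sumr_ge0.
exists s^-1 => [|j Pj]; first by rewrite invr_gt0.
rewrite mulrC ler_pdivrMr // -ler_pdivrMl ?p0 // mulrC.
rewrite (le_trans (y := `|q j| / p j)) //.
  by rewrite ler_pM2r ?invr_gt0 ?p0 // ler_norm.
rewrite /s (bigD1 j) //= addrCA lerDl addr_ge0 // sumr_ge0 // => i /andP[Pi _].
exact: nn.
Qed.

Lemma exists_nat_nonroot (F : realFieldType) (p : {poly F}) : p != 0 ->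
  exists k : nat, p.[k.+1%:R] != 0.
Proof.
move=> p0; pose rs := [seq k.+1%:R : F | k <- iota 0 (size p)].
have u : uniq rs.
  rewrite map_inj_uniq ?iota_uniq // => i j /eqP.
  by rewrite eqr_nat eqSS => /eqP.
case: (boolP (all (root p) rs)) => [A|/allPn[x /mapP[k _ ->] nr]].
  by have := max_poly_roots p0 A u; rewrite size_map size_iota ltnn.
by exists k.
Qed.

Section LocalFamily.
Variables (F : realFieldType) (D n : nat) (a : 'I_n -> 'rV[F]_D).
Implicit Types (V H S T : {set 'I_n}) (w x y l : 'rV[F]_D).

(* The sets S at which the multidegree w survives after inverting the
   generators a i, i in S. *)
Definition local_family V w : pred {set 'I_n} :=
  fun S => (S \subset V) && `[< local_cone a V S w >].

Definition spanned V x := exists e : 'I_n -> F, x = \sum_(i in V) e i *: a i.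

Definition relint V x := exists2 c : 'I_n -> F, forall i, i \in V -> 0 < c i
  & x = \sum_(i in V) c i *: a i.

Definition pointed V := exists h, forall i, i \in V -> 0 < dot h (a i).

Definition nonneg_on V l := forall i, i \in V -> 0 <= dot l (a i).

Definition zeros V l := [set i in V | dot l (a i) == 0].

Definition face V H := exists l, [/\ nonneg_on V l, zeros V l = H & H <> V].

(** Faces are recorded by the generators they contain. A facet is a maximal proper face; that it has
    codimension one is derived in [rk_facet]. *)
Definition facet V H :=
  face V H /\ forall H', face V H' -> H \subset H' -> H' = H.

Definition rk V := \dim (\sum_(i in V) <[a i]>)%VS.

Lemma zerosP V l i : reflect (i \in V /\ dot l (a i) = 0) (i \in zeros V l).
Proof. by rewrite inE; apply: (iffP andP) => -[? /eqP]. Qed.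

Lemma zeros_sub V l : zeros V l \subset V.
Proof. by apply/subsetP => i /zerosP[]. Qed.

Lemma dot_spanned V l x : spanned V x -> (forall i, i \in V -> dot l (a i) = 0) ->
  dot l x = 0.
Proof.
move=> [e ->] l0; rewrite dot_sumr big1 // => i iV.
by rewrite dotZr l0 // mulr0.
Qed.

(** [c] is the least ratio of [l] to [l'] over the generators off the zeros of [l'], i.e. the
    largest multiple of [l'] that can be subtracted; a minimiser [j] becomes a new zero. *)
Lemma tilt V l l' : nonneg_on V l -> nonneg_on V l' ->
  zeros V l \subset zeros V l' -> zeros V l' <> V ->
  exists c j, [/\ 0 < c, nonneg_on V (l - c *: l'),
    zeros V l \subset zeros V (l - c *: l'),
    j \notin zeros V l' & j \in zeros V (l - c *: l')].
Proof.
move=> l0 l'0 sub ne.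
have [j0 jV jn] : exists2 j, j \in V & j \notin zeros V l'.
  apply/subsetPn; apply: contra_notN ne => VZ; apply/eqP.
  by rewrite eqEsubset zeros_sub.
pose P j := (j \in V) && (j \notin zeros V l').
have l'P j : P j -> 0 < dot l' (a j).
  by rewrite /P inE => /andP[jV' nj]; rewrite lt_def l'0 // andbT; rewrite jV' in nj.
have lP j : P j -> 0 < dot l (a j).
  move=> /andP[jV' nj]; rewrite lt_def l0 // andbT.
  by apply: contraNneq nj => E; apply/(subsetP sub)/zerosP.
have [j Pj cmin] := @arg_minP _ _ _ j0 P (fun j => dot l (a j) / dot l' (a j))
  (introT andP (conj jV jn)).
pose c := dot l (a j) / dot l' (a j).
have c0 : 0 < c by rewrite divr_gt0 ?lP ?l'P.
have [jV' nj] := andP Pj.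
exists c, j; split=> //.
- move=> i iV; rewrite dotBl dotZl subr_ge0.
  case: (boolP (i \in zeros V l')) => [/zerosP[_ ->]|ni]; first by rewrite mulr0 l0.
  have Pi : P i by rewrite /P iV.
  by rewrite -ler_pdivlMr ?l'P ?cmin.
- apply/subsetP => i iZ; apply/zerosP; have [iV li] := zerosP _ _ _ iZ.
  have [_ l'i] := zerosP _ _ _ (subsetP sub i iZ).
  by rewrite dotBl dotZl li l'i mulr0 subr0.
- by apply/zerosP; rewrite dotBl dotZl divfK ?subrr // gt_eqF ?l'P.
Qed.

(** Tilting [l] by [l'] adds a zero off the facet; by maximality the tilted form vanishes on all of
    V. *)
Lemma facet_unique V H l l' : facet V H -> nonneg_on V l -> nonneg_on V l' ->
  zeros V l = H -> zeros V l' = H ->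
  exists2 c, 0 < c & forall i, i \in V -> dot l (a i) = c * dot l' (a i).
Proof.
move=> [[_ [_ _ HV]] Hmax] l0 l'0 lH l'H.
have [||c [j [c0 nn sub nj jz]]] := tilt l0 l'0; rewrite ?lH ?l'H //.
exists c => //.
case: (EM (zeros V (l - c *: l') = V)) => [E i iV|ne].
  move: iV; rewrite -{1}E => /zerosP[_ /eqP].
  by rewrite dotBl dotZl subr_eq0 => /eqP.
move: nj; rewrite l'H -(Hmax (zeros V (l - c *: l'))) ?jz //; last by rewrite -lH.
by exists (l - c *: l').
Qed.

(** Among the nonnegative forms that vanish on S and separate w, one with most zeros defines a
    facet. Given a larger face with form [l'], either the tilted form still separates and has too
    many zeros, or [l'] itself separates. *)
Lemma facet_sep V S w : S \subset V -> spanned V w -> ~ local_cone a V S w ->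
  exists l, [/\ facet V (zeros V l), nonneg_on V l, S \subset zeros V l & dot l w < 0].
Proof.
move=> SV wV nc.
pose Q H := `[< exists l, [/\ nonneg_on V l, zeros V l = H, S \subset H & dot l w < 0] >].
have [H0 QH0] : exists H, Q H.
  case: (farkas_local a w SV) => // -[l [l0 lS lw]].
  exists (zeros V l); apply/asboolP; exists l; split=> //.
  by apply/subsetP => i iS; apply/zerosP; rewrite lS // (subsetP SV).
have [H /asboolP[l [l0 lH SH lw]] Hmax] :=
  @arg_maxnP _ H0 Q (fun H : {set 'I_n} => #|H|) QH0.
have QP H' : Q H' -> H \subset H' -> H' = H.
  move=> /Hmax /= le sub; apply/esym/eqP; rewrite eqEcard sub /=; exact: le.
exists l; rewrite lH; split=> //; split.
  exists l; split=> // HV; move: lw; rewrite (dot_spanned wV) ?ltxx // => i.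
  by rewrite -HV -lH => /zerosP[].
move=> H' [l' [l'0 l'H H'V]] HH'.
have [||c [j [c0 nn sub nj jz]]] := tilt l0 l'0; rewrite ?lH ?l'H //.
have [lt0|ge0] := ltrP (dot (l - c *: l') w) 0.
  have E : zeros V (l - c *: l') = H.
    apply: QP; last by rewrite -lH.
    apply/asboolP; exists (l - c *: l'); split=> //.
    by apply: subset_trans SH _; rewrite -lH.
  by move: nj jz; rewrite E l'H => /negP nj /(subsetP HH').
apply: QP => //; apply/asboolP; exists l'; split=> //; first exact: subset_trans HH'.
move: ge0; rewrite dotBl dotZl subr_ge0 => /le_lt_trans/(_ lw).
by rewrite pmulr_rlt0.
Qed.

(** The terms c_i l(a_i) off H are nonnegative with sum l(y) = 0, and l(a_i) is nonzero there, so
    these coefficients vanish. *)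
Lemma local_cone_face V H S l y : nonneg_on V l -> zeros V l = H -> dot l y = 0 ->
  S \subset H -> local_cone a V S y -> local_cone a H S y.
Proof.
move=> l0 lH ly SH [c c0 E]; exists c => [i|].
  by rewrite -lH => /zerosP[iV _]; apply: c0.
have HV : H \subset V by rewrite -lH zeros_sub.
rewrite E (big_setID H) /= (setIidPr HV) [X in _ + X]big1 ?addr0 // => i.
have nn j : j \in V :\: H -> 0 <= c j * dot l (a j).
  case/setDP => jV nj; rewrite mulr_ge0 ?l0 ?c0 //.
  by apply: contraNN nj; apply: (subsetP SH).
have : \sum_(j in V :\: H) c j * dot l (a j) == 0.
  apply/eqP; rewrite -[RHS]ly E dot_sumr [RHS](big_setID H) /= (setIidPr HV).
  rewrite [X in _ = X + _]big1 ?add0r => [|j]; last first.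
    by rewrite -lH => /zerosP[_ lj]; rewrite dotZr lj mulr0.
  by apply: eq_bigr => j _; rewrite dotZr.
rewrite psumr_eq0 // => /allP/(_ i (mem_index_enum _))/implyP h iD.
have := h iD; rewrite mulf_eq0 => /orP[/eqP->|li]; first by rewrite scale0r.
case/setDP: iD => iV; rewrite -lH => /negP[]; apply/zerosP; split=> //.
exact/eqP.
Qed.

Lemma local_cone_up V H S y : H \subset V -> S \subset H ->
  local_cone a H S y -> local_cone a V S y.
Proof.
move=> HV SH [c c0 E]; exists (fun i => if i \in H then c i else 0) => [i _ iS|].
  by case: ifP => // /c0; apply.
rewrite E [RHS](big_setID H) /= (setIidPr HV) [X in _ = _ + X]big1 ?addr0.
  by apply: eq_bigr => i ->.
by move=> i /setDP[_ /negbTE->]; rewrite scale0r.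
Qed.

(** * Description of a cone by its facets *)

Section Facets.
Variables (V : {set 'I_n}) (ell : {set 'I_n} -> 'rV[F]_D).
Hypothesis ellP : forall H, facet V H -> nonneg_on V (ell H) /\ zeros V (ell H) = H.

Lemma facet_subset H : facet V H -> H \subset V.
Proof. by case/ellP => _ <-; apply: zeros_sub. Qed.

Lemma facet_zero H i : facet V H -> i \in H -> dot (ell H) (a i) = 0.
Proof. by move=> fH; have [_ {1}<-] := ellP fH => /zerosP[]. Qed.

Lemma facet_neq H : facet V H -> H <> V.
Proof. by case=> -[l []]. Qed.

Lemma facet_exP H : facet V H -> exists2 i, i \in V & i \notin H.
Proof.
move=> fH; apply/subsetPn; apply: contra_notN (facet_neq fH) => VH; apply/eqP.
by rewrite eqEsubset facet_subset.
Qed.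

(** Localising at S keeps only the facets through S. A violated one comes from [facet_sep]; on the
    span of V its form is a positive multiple of the chosen [ell]. *)
Lemma local_coneP S w : S \subset V -> spanned V w ->
  local_cone a V S w <->
  (forall H, facet V H -> S \subset H -> 0 <= dot (ell H) w).
Proof.
move=> SV wV; split=> [[c c0 ->] H fH SH|pos].
  have [l0 lH] := ellP fH; rewrite dot_sumr sumr_ge0 // => i iV; rewrite dotZr.
  case: (boolP (i \in S)) => iS; last by rewrite mulr_ge0 ?c0 ?l0.
  by rewrite (facet_zero fH) ?mulr0 // (subsetP SH).
case: (EM (local_cone a V S w)) => // /(facet_sep SV wV)[l [fH l0 SH lw]].
have [l'0 l'H] := ellP fH.
have [c c0 cE] := facet_unique fH l0 l'0 erefl l'H.
have : dot l w = c * dot (ell (zeros V l)) w.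
  apply/eqP; rewrite -subr_eq0 -dotZl -dotBl; apply/eqP.
  by apply: (dot_spanned wV) => i iV; rewrite dotBl dotZl cE // subrr.
by move=> E; move: lw; rewrite E pmulr_rlt0 // ltNge pos.
Qed.

Lemma relint_facet H b : facet V H -> relint V b -> 0 < dot (ell H) b.
Proof.
move=> fH [c c0 ->]; have [l0 lH] := ellP fH.
have nn i : i \in V -> 0 <= c i * dot (ell H) (a i).
  by move=> iV; rewrite mulr_ge0 ?l0 // ltW ?c0.
have [j jV nj] := facet_exP fH.
rewrite dot_sumr (bigD1 j) //= dotZr ltr_pwDl //; last first.
  by rewrite sumr_ge0 // => i /andP[/nn]; rewrite dotZr.
rewrite mulr_gt0 ?c0 // lt_def l0 // andbT; apply: contraNneq nj => E.
by rewrite -lH; apply/zerosP.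
Qed.

(** For S = H, [local_coneP] leaves H as the only facet to test, so x is in the cone localised at H;
    lying on the hyperplane, it uses no generator off H. *)
Lemma spanned_facet H x : facet V H -> spanned V x -> dot (ell H) x = 0 -> spanned H x.
Proof.
move=> fH xV x0; have [l0 lH] := ellP fH.
have HV := facet_subset fH.
have : local_cone a V H x.
  apply/local_coneP => // H' fH' HH'.
  by rewrite (fH.2 _ fH'.1 HH') x0.
by case/(local_cone_face l0 lH x0 (subxx _)) => c _ E; exists c.
Qed.

Lemma rk_facet H : facet V H -> rk V = (rk H).+1.
Proof.
move=> fH; have [l0 lH] := ellP fH; have [j jV nj] := facet_exP fH.
have HV := facet_subset fH.
have lj : dot (ell H) (a j) != 0.
  by apply: contraNneq nj => E; rewrite -lH; apply/zerosP.
have spanP U x : reflect (spanned U x) (x \in (\sum_(i in U) <[a i]>)%VS).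
  apply: (iffP memv_sumP) => [[v vP ->]|[e ->]].
    have /choice[e eE] i : exists e, i \in U -> v i = e *: a i.
      case: (boolP (i \in U)) => [iU|]; last by exists 0.
      by have /vlineP[k ->] := vP i iU; exists k.
    by exists e; apply: eq_bigr => i iU; rewrite eE.
  by exists (fun i => e i *: a i) => // i _; rewrite memvZ ?memv_line.
have E : (\sum_(i in V) <[a i]> = \sum_(i in H) <[a i]> + <[a j]>)%VS.
  apply/eqP; rewrite eqEsubv; apply/andP; split; last first.
    rewrite subv_add; apply/andP; split; last by rewrite (sumv_sup j).
    by apply/subv_sumP => i /(subsetP HV) iV; rewrite (sumv_sup i).
  apply/subvP => x /spanP xV.
  rewrite -[x](subrK ((dot (ell H) x / dot (ell H) (a j)) *: a j)).
  rewrite memv_add ?memvZ ?memv_line //; apply/spanP; apply: spanned_facet => //.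
    have [e xE] := xV.
    exists (fun i => e i - (if i == j then dot (ell H) x / dot (ell H) (a j) else 0)).
    under [RHS]eq_bigr do rewrite scalerBl.
    rewrite sumrB -xE; congr (_ - _); rewrite [RHS](bigD1 j) //= eqxx.
    rewrite [X in _ = _ + X]big1 ?addr0 // => i /andP[_ /negbTE->].
    by rewrite scale0r.
  by rewrite dotBr dotZr divfK // subrr.
rewrite /rk E dimv_disjoint_sum.
  rewrite dim_vline; have -> : a j != 0 by apply: contraNneq lj => ->; rewrite dot0r.
  by rewrite addn1.
apply/eqP; rewrite -subv0; apply/subvP => x; rewrite memv_cap => /andP[/spanP xH].
case/vlineP => k xE; have : dot (ell H) x = 0.
  by apply: (dot_spanned xH) => i; apply: facet_zero.
rewrite xE dotZr => /eqP; rewrite mulf_eq0 (negbTE lj) orbF => /eqP->.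
by rewrite scale0r mem0v.
Qed.

End Facets.
Lemma local_familyP V w S :
  reflect (S \subset V /\ local_cone a V S w) (local_family V w S).
Proof. by apply: (iffP andP) => -[? /asboolP]. Qed.

(** On the curve sum_i t^i a_i each functional becomes a nonzero polynomial in t, and some positive
    integer t avoids the roots of their product. *)
Lemma generic_relint V (J : eqType) (s : seq J) (phi : J -> 'rV[F]_D) :
  (forall j, j \in s -> exists2 i, i \in V & dot (phi j) (a i) != 0) ->
  exists2 b, relint V b & forall j, j \in s -> dot (phi j) b != 0.
Proof.
move=> nz.
pose p j := \poly_(i < n) (if insub i is Some k then
  if k \in V then dot (phi j) (a k) else 0 else 0).
have pE j i : (p j)`_(i : 'I_n) = if i \in V then dot (phi j) (a i) else 0.
  by rewrite coef_poly ltn_ord valK.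
have [k nr] : exists k : nat, (\prod_(j <- s) p j).[k.+1%:R] != 0.
  apply: exists_nat_nonroot; rewrite prodf_seq_neq0; apply/allP => j js /=.
  have [i iV ne] := nz j js; apply: contraNneq ne => p0.
  by have := pE j i; rewrite p0 coef0 iV => <-.
exists (\sum_(i in V) k.+1%:R ^+ i *: a i).
  by exists (fun i : 'I_n => k.+1%:R ^+ i) => // i _; rewrite exprn_gt0 ?ltr0Sn.
move=> j js; move: nr; rewrite horner_prod prodf_seq_neq0 => /allP/(_ j js) /=.
suff -> : dot (phi j) (\sum_(i in V) k.+1%:R ^+ i *: a i) = (p j).[k.+1%:R] by [].
rewrite (@horner_coef_wide _ n) ?size_poly // dot_sumr big_mkcond /=.
by apply: eq_bigr => i _; rewrite pE dotZr mulrC; case: ifP; rewrite ?mul0r.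
Qed.

(** * Line shelling and the cohomology of local families *)

Section Shelling.
Variable K : nzRingType.

(* The complement of [local_family V w] in the simplex on V is swept out by a
   generic line w + t b, b in the relative interior of the cone: the facet H with
   l_H(w) < 0 is crossed at time tau H > 0, and the sets S whose last crossed
   facet is H form the local family of H at the crossing point. *)
Section Line.
Variables (V : {set 'I_n}) (ell : {set 'I_n} -> 'rV[F]_D) (w b : 'rV[F]_D).
Hypothesis ellP : forall H, facet V H -> nonneg_on V (ell H) /\ zeros V (ell H) = H.
Hypotheses (wV : spanned V w) (bV : relint V b).

Definition crossed := [set H | `[< facet V H >] && (dot (ell H) w < 0)].
Definition tau H := - dot (ell H) w / dot (ell H) b.
Definition crossing H := w + tau H *: b.

Hypothesis tau_inj : {in crossed &, injective tau}.

Lemma crossedP H : reflect (facet V H /\ dot (ell H) w < 0) (H \in crossed).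
Proof. by rewrite inE; apply: (iffP andP) => -[/asboolP]. Qed.

Lemma tau_gt0 H : H \in crossed -> 0 < tau H.
Proof.
by case/crossedP => fH ?; rewrite divr_gt0 ?oppr_gt0 // (relint_facet ellP fH).
Qed.

(** As [b] is interior, the sign of the form of H' at this point tells which of the two facets has
    the earlier time. *)
Lemma dot_crossing H H' : facet V H' ->
  dot (ell H') (crossing H) = (tau H - tau H') * dot (ell H') b.
Proof.
move=> fH'; have E : tau H' * dot (ell H') b = - dot (ell H') w.
  by rewrite divfK // gt_eqF // (relint_facet ellP).
by rewrite dotDr dotZr mulrBl E opprK addrC.
Qed.

Lemma spanned_crossing H : H \in crossed -> spanned H (crossing H).
Proof.
case/crossedP => fH _; apply: (spanned_facet ellP fH); last first.
  by rewrite dot_crossing // subrr mul0r.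
have [e wE] := wV; have [c _ bE] := bV; exists (fun i => e i + tau H * c i).
rewrite /crossing wE bE scaler_sumr -big_split; apply: eq_bigr => i _ /=.
by rewrite scalerDl scalerA.
Qed.

Lemma pieceP H S : H \in crossed ->
  local_family H (crossing H) S <->
  S \subset H /\ forall H', H' \in crossed -> S \subset H' -> tau H' <= tau H.
Proof.
move=> Hc; have [fH lt0] := crossedP _ Hc.
have [l0 lH] := ellP fH; have HV := facet_subset ellP fH.
have lc : dot (ell H) (crossing H) = 0 by rewrite dot_crossing // subrr mul0r.
have cV : spanned V (crossing H).
  have [e E] := spanned_crossing Hc; exists (fun i => if i \in H then e i else 0).
  rewrite E [RHS](big_setID H) /= (setIidPr HV) [X in _ = _ + X]big1 ?addr0.
    by apply: eq_bigr => i ->.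
  by move=> i /setDP[_ /negbTE->]; rewrite scale0r.
split=> [/local_familyP[SH lS]|[SH mS]].
  have SV := subset_trans SH HV.
  split=> // H' H'c SH'; have [fH' _] := crossedP _ H'c.
  have /(local_coneP ellP SV cV)/(_ H' fH' SH') := local_cone_up HV SH lS.
  by rewrite dot_crossing // pmulr_lge0 ?subr_ge0 // (relint_facet ellP).
have SV := subset_trans SH HV.
apply/local_familyP; split=> //; apply: (local_cone_face l0 lH lc SH).
apply/(local_coneP ellP SV cV) => H' fH' SH'.
have [lt|ge] := ltrP (dot (ell H') w) 0.
  rewrite dot_crossing // pmulr_lge0 ?subr_ge0 ?mS //; last by rewrite (relint_facet ellP).
  exact/crossedP.
rewrite dotDr dotZr addr_ge0 // mulr_ge0 ?ltW ?tau_gt0 //.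
exact: (relint_facet ellP).
Qed.

Definition sides (G : {set {set 'I_n}}) : pred {set 'I_n} :=
  fun S => [exists H in G, S \subset H].

Lemma sidesP (G : {set {set 'I_n}}) S : reflect (exists2 H, H \in G & S \subset H) (sides G S).
Proof. by apply: (iffP exists_inP). Qed.

Lemma sides_convex (G : {set {set 'I_n}}) : convex_family (sides G).
Proof.
move=> S T U _ /sidesP[H HG UH] _ TU; apply/sidesP; exists H => //.
exact: subset_trans UH.
Qed.

(** G contains every crossing later than its earliest member H0. Removing H0 loses just the sets
    that lie in H0 and in no other facet of G, and by [pieceP] these form the local family at the
    crossing point. *)
Lemma sides_step (G : {set {set 'I_n}}) H0 : G \subset crossed -> H0 \in G ->
    (forall H, H \in G -> tau H0 <= tau H) ->
    (forall H, H \in crossed -> tau H0 < tau H -> H \in G) ->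
  [/\ forall S, sides G S = sides (G :\ H0) S || local_family H0 (crossing H0) S,
     forall S, sides (G :\ H0) S -> ~~ local_family H0 (crossing H0) S &
     forall S T, local_family H0 (crossing H0) S -> sides G T -> S \subset T ->
       local_family H0 (crossing H0) T].
Proof.
move=> Gc H0G H0min Gup; have H0c := subsetP Gc _ H0G.
have PI S : sides (G :\ H0) S -> ~~ local_family H0 (crossing H0) S.
  case/sidesP => H /setD1P[HH0 HG] SH; apply/negP => /(pieceP _ H0c)[_ mS].
  have Hc := subsetP Gc _ HG; move/eqP: HH0; apply; apply: tau_inj => //.
  by apply/eqP; rewrite eq_le mS //= H0min.
have PU S : sides G S = sides (G :\ H0) S || local_family H0 (crossing H0) S.
  apply/idP/orP => [|[/sidesP[H /setD1P[_ HG] SH]|/local_familyP[SH _]]].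
  - case/sidesP => H HG SH; case: (boolP (sides (G :\ H0) S)) => [|ns]; first by left.
    have inH H' : H' \in G -> S \subset H' -> H' = H0.
      move=> H'G SH'; apply/eqP; apply: contraNT ns => ne; apply/sidesP.
      by exists H' => //; apply/setD1P.
    right; apply/pieceP => //; split; first by rewrite -(inH H).
    move=> H' H'c SH'; rewrite leNgt; apply/negP => lt.
    by have := inH _ (Gup _ H'c lt) SH' => E; rewrite E ltxx in lt.
  - by apply/sidesP; exists H.
  - by apply/sidesP; exists H0.
split=> // S T S2; rewrite PU => /orP[|//] /sidesP[H HG TH] ST.
have : sides (G :\ H0) S by apply/sidesP; exists H => //; apply: subset_trans TH.
by move/PI; rewrite S2.
Qed.

Lemma acyclic_sides k (G : {set {set 'I_n}}) : G \subset crossed ->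
    (forall H H', H \in G -> H' \in crossed -> tau H < tau H' -> H' \in G) ->
    (forall H, H \in G -> acyclic K (local_family H (crossing H)) k) ->
  acyclic K (sides G) k.
Proof.
have [m] := ubnP #|G|; elim: m G => // m IH G Gm Gc Gup acG.
have [->|[H1 H1G]] := set_0Vmem G.
  by apply: acyclic_empty => S; apply/sidesP => -[H]; rewrite inE.
have [H0 H0G H0min] := @arg_minP _ _ _ H1 (fun Q => Q \in G) tau H1G.
have [PU PI Pup] := sides_step Gc H0G H0min (fun H => Gup H0 H H0G).
apply: (acyclic_extension (@sides_convex G) PU PI Pup); last exact: acG.
apply: IH.
- by rewrite -ltnS (leq_trans _ Gm) // (cardsD1 H0 G) H0G.
- exact: subset_trans (subsetDl _ _) Gc.
- move=> H H' /setD1P[_ HG] H'c lt; apply/setD1P; split; last exact: Gup lt.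
  by apply: contraTneq lt => ->; rewrite -leNgt H0min.
- by move=> H /setD1P[_ /acG].
Qed.

Lemma family_split :
  [/\ forall S, (S \subset V) = sides crossed S || local_family V w S,
     forall S, sides crossed S -> ~~ local_family V w S &
     forall S T, local_family V w S -> T \subset V -> S \subset T ->
       local_family V w T].
Proof.
split=> [S|S|S T /local_familyP[SV lS] TV ST].
- apply/idP/orP => [SV|[/sidesP[H /crossedP[fH _] SH]|/local_familyP[]//]].
    case: (boolP (sides crossed S)) => [|ns]; first by left.
    right; apply/local_familyP; split=> //; apply/(local_coneP ellP SV wV) => H fH SH.
    rewrite leNgt; apply: contraNN ns => lt; apply/sidesP; exists H => //.
    exact/crossedP.
  exact: subset_trans SH (facet_subset ellP fH).
- case/sidesP => H /crossedP[fH lt] SH; apply/local_familyP => -[SV].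
  by move/(local_coneP ellP SV wV)/(_ H fH SH); rewrite leNgt lt.
- apply/local_familyP; split=> //; apply/(local_coneP ellP TV wV) => H fH TH.
  by have /(local_coneP ellP SV wV) := lS; apply=> //; apply: subset_trans TH.
Qed.

(** [- crossing H] lies in the cone, so at this time every form is still at most 0: no facet was
    crossed before H. Adding [tau H *: b] to it gives [- w]. *)
Lemma relint_crossing H : H \in crossed -> relint H (- crossing H) ->
  relint V (- w) /\ forall H', H' \in crossed -> tau H <= tau H'.
Proof.
move=> Hc [c c0 E]; have [fH _] := crossedP _ Hc; have HV := facet_subset ellP fH.
have [be be0 bE] := bV; split.
  exists (fun i => (if i \in H then c i else 0) + tau H * be i) => [i iV|].
    apply: ltr_wpDl; first by case: ifP => // /c0/ltW.
    by apply: mulr_gt0; [apply: tau_gt0 | apply: be0].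
  have -> : - w = - crossing H + tau H *: b by rewrite /crossing opprD addrNK.
  under [RHS]eq_bigr do rewrite scalerDl -scalerA.
  rewrite big_split /= -scaler_sumr -bE E; congr (_ + _).
  rewrite [RHS](big_setID H) /= (setIidPr HV) [X in _ = _ + X]big1 ?addr0.
    by apply: eq_bigr => i ->.
  by move=> i /setDP[_ /negbTE->]; rewrite scale0r.
move=> H' H'c; have [fH' _] := crossedP _ H'c; have [l0 _] := ellP fH'.
have : 0 <= dot (ell H') (- crossing H).
  rewrite E dot_sumr sumr_ge0 // => i iH.
  by rewrite dotZr mulr_ge0 ?l0 ?(subsetP HV) // ltW ?c0.
rewrite dotNr dot_crossing // oppr_ge0 pmulr_lle0 ?subr_le0 //.
exact: (relint_facet ellP).
Qed.

(** At the first crossing the other forms are still positive on [- crossing H0], which leaves room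
    to subtract a small multiple of the sum over H0. The rest stays in the cone of H0, and giving
    the multiple back makes all coefficients positive. *)
Lemma relint_first_crossing H0 : relint V (- w) -> H0 \in crossed ->
  (forall H, H \in crossed -> tau H0 <= tau H) -> relint H0 (- crossing H0).
Proof.
move=> wint H0c H0min; have [fH0 _] := crossedP _ H0c; have [l0 lH] := ellP fH0.
have H0V := facet_subset ellP fH0.
have all_crossed H : facet V H -> H \in crossed.
  move=> fH; apply/crossedP; split=> //.
  by have := relint_facet ellP fH wint; rewrite dotNr oppr_gt0.
pose b0 := \sum_(i in H0) a i.
have [H|e e0 eP] := @exists_small_factor _ _ (fun H => (H != H0) && (H \in crossed))
  (fun H => dot (ell H) (- crossing H0)) (fun H => dot (ell H) b0).
  case/andP => ne Hc; have [fH _] := crossedP _ Hc.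
  rewrite dotNr dot_crossing // -mulNr opprB mulr_gt0 ?(relint_facet ellP) //.
  rewrite subr_gt0 lt_def H0min // andbT.
  by apply: contraNneq ne => E; apply/eqP/tau_inj.
have xV : spanned V (- crossing H0 - e *: b0).
  have [f E] := spanned_crossing H0c.
  exists (fun i => if i \in H0 then - f i - e else 0).
  rewrite [RHS](big_setID H0) /= (setIidPr H0V) [X in _ = _ + X]big1 ?addr0.
    rewrite E scaler_sumr -sumrN -sumrB; apply: eq_bigr => i ->.
    by rewrite scalerBl scaleNr.
  by move=> i /setDP[_ /negbTE->]; rewrite scale0r.
have x0 : dot (ell H0) (- crossing H0 - e *: b0) = 0.
  rewrite dotBr dotNr dot_crossing // subrr mul0r oppr0 sub0r dotZr dot_sumr big1.
    by rewrite mulr0 oppr0.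
  by move=> i; apply: (facet_zero ellP fH0).
have : local_cone a V set0 (- crossing H0 - e *: b0).
  apply/(local_coneP ellP (sub0set _) xV) => H fH _.
  case: (eqVneq H H0) => [->|ne]; first by rewrite x0.
  by rewrite dotBr dotZr subr_ge0 eP // ne all_crossed.
case/(local_cone_face l0 lH x0 (sub0set _)) => c c0 E.
exists (fun i => c i + e) => [i iH|]; first by rewrite ltr_wpDl ?c0 ?inE.
under eq_bigr do rewrite scalerDl.
by rewrite big_split /= -E -scaler_sumr subrK.
Qed.

End Line.

(** Induction on the number of generators. The pieces of [sides crossed] are local families of
    facets, and only the first crossed facet, for [- w] interior, gives a piece with cohomology. The
    full simplex on V being acyclic, the local family inherits this cohomology one degree higher, in
    agreement with [rk_facet]. *)
Theorem local_family_acyclic V w : pointed V -> spanned V w ->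
  (~ relint V (- w) -> forall k, acyclic K (local_family V w) k) /\
  (relint V (- w) -> forall k, acyclic K (local_family V w) k <-> k <> rk V).
Proof.
have [m] := ubnP #|V|; elim: m V w => // m IH V w Vm [h h0] wV.
have [V0|[v vV]] := set_0Vmem V.
  have w0 : w = 0 by have [e ->] := wV; rewrite V0 big_set0.
  have rk0 : rk V = 0 by rewrite /rk V0 big_set0 dimv0.
  have famE S : local_family V w S = (S == set0).
    rewrite /local_family V0 subset0; case: eqVneq => // ->; apply/asboolP.
    by exists (fun=> 0); rewrite ?big_set0.
  split=> [[]|_ k]; first by exists (fun=> 0) => [i|]; rewrite V0 ?inE // w0 oppr0 big_set0.
  (* The only cell is the empty set, so the only class is the constant 1 in degree 0 = [rk V]. *)
  split=> [ac k0|kn].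
    have [S|T|b bP] := ac (fun S => (S == set0)%:R).
    - by rewrite famE; case: (eqVneq S set0) => [->|_]; rewrite ?eqxx // cards0 k0 rk0.
    - by rewrite famE => /eqP->; rewrite /codiff big_set0.
    move/(_ set0); rewrite famE /codiff big_set0 eqxx => /(_ isT)/eqP.
    by rewrite eq_sym oner_eq0.
  move=> q qP _; exists (fun=> 0) => [S|S]; first by rewrite eqxx.
  rewrite famE codiff_eq0 // => /eqP->; apply/esym/eqP/negPn/negP => /qP[_].
  by rewrite cards0 => k0; apply: kn; rewrite rk0.
have /choice[ell ellP] : forall H : {set 'I_n}, exists l : 'rV[F]_D,
    facet V H -> nonneg_on V l /\ zeros V l = H.
  by move=> H; case: (EM (facet V H)) => [[[l []]]|]; [exists l | exists 0].
(* Two crossing times agree exactly when b is orthogonal to [phi (H, H')]; a generic b makes them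
   distinct. *)
pose phi (p : {set 'I_n} * {set 'I_n}) :=
  dot (ell p.1) w *: ell p.2 - dot (ell p.2) w *: ell p.1.
pose pairs := [seq p <- enum {: {set 'I_n} * {set 'I_n}} |
  [&& p.1 \in crossed V ell w, p.2 \in crossed V ell w & p.1 != p.2]].
have [|b bV bgen] := @generic_relint V _ pairs phi.
  move=> -[H H']; rewrite mem_filter /= => /andP[/and3P[Hc H'c ne] _].
  have [fH lt] := crossedP _ _ _ _ Hc; have [fH' lt'] := crossedP _ _ _ _ H'c.
  apply/exists_inP; apply: contraNT ne => /exists_inPn eq0.
  have [_ <-] := ellP _ fH; have [_ <-] := ellP _ fH'; apply/eqP/setP => i.
  rewrite !inE; case: (boolP (i \in V)) => //= iV.
  have := eq0 i iV; rewrite negbK dotBl !dotZl subr_eq0 => /eqP E.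
  apply/eqP/eqP => E0; move: E; rewrite E0 mulr0 => /eqP.
    by rewrite mulf_eq0 lt_eqF //= => /eqP.
  by rewrite eq_sym mulf_eq0 lt_eqF //= => /eqP.
pose tau := tau ell w b.
have tau_inj : {in crossed V ell w &, injective tau}.
  move=> H H' Hc H'c E; apply/eqP/negPn/negP => ne.
  have /bgen : (H, H') \in pairs by rewrite mem_filter /= Hc H'c ne mem_enum.
  have [fH _] := crossedP _ _ _ _ Hc; have [fH' _] := crossedP _ _ _ _ H'c.
  have bH := relint_facet ellP fH bV; have bH' := relint_facet ellP fH' bV.
  rewrite dotBl !dotZl subr_eq0 => /negP[]; move/eqP: E.
  by rewrite eqr_div ?(gt_eqF bH) ?(gt_eqF bH') // !mulNr eqr_opp.
have cr := @crossedP V ell w.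
have small H : H \in crossed V ell w -> (#|H| < m)%N.
  case/cr => fH _; rewrite -ltnS (leq_trans _ Vm) // ltnS proper_card //.
  by rewrite properEneq (facet_subset ellP fH) andbT; apply/eqP/facet_neq.
have IHH H (Hc : H \in crossed V ell w) := IH H (crossing ell w b H) (small H Hc).
have ptd H : H \in crossed V ell w -> pointed H.
  by case/cr => fH _; exists h => i /(subsetP (facet_subset ellP fH))/h0.
have sp H := @spanned_crossing V ell w b ellP wV bV H.
have [PU PI Pup] := family_split ellP wV.
have cvx : convex_family (fun S => S \subset V).
  by move=> S T U _ UV _; move/subset_trans; apply.
have acV k : acyclic K (fun S : {set 'I_n} => S \subset V) k.
  apply: (@acyclic_cone _ _ _ v) => S; rewrite subUset sub1set vV /=.
  by rewrite subDset setUC (setUidPl _) // sub1set.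
split=> [nint k|wint k].
  apply: (acyclic_sub cvx PU PI Pup (acV k)) => l _.
  apply: (acyclic_sides ellP wV bV tau_inj) => // H Hc.
  have [H1 _] := IHH H Hc (ptd H Hc) (sp H Hc); apply: H1.
  by move/(relint_crossing ellP bV Hc) => [].
(* Without a crossed facet w would lie in the cone, but h is positive on the generators and hence on
   [- w]. *)
have [H1 H1c] : exists H, H \in crossed V ell w.
  have [|l [fl _ _ _]] := @facet_sep V set0 w (sub0set _) wV; last first.
    exists (zeros V l); apply/cr; split=> //.
    by have := relint_facet ellP fl wint; rewrite dotNr oppr_gt0.
  case=> c c0 E; have [c' c'0 E'] := wint.
  have : 0 <= dot h w.
    by rewrite E dot_sumr sumr_ge0 // => i iV; rewrite dotZr mulr_ge0 ?c0 ?inE // ltW ?h0.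
  have : 0 < dot h (- w).
    rewrite E' dot_sumr (bigD1 v) //= dotZr ltr_pwDl ?mulr_gt0 ?c'0 ?h0 //.
    by rewrite sumr_ge0 // => i /andP[iV _]; rewrite dotZr ltW // mulr_gt0 ?c'0 ?h0.
  by rewrite dotNr oppr_gt0 ltNge => /negP.
have [H0 H0c H0min] := @arg_minP _ _ _ H1 (fun Q => Q \in crossed V ell w) tau H1c.
have [fH0 _] := cr _ H0c.
have int0 := relint_first_crossing ellP wV bV tau_inj wint H0c H0min.
have [_ /(_ int0) ac0] := IHH H0 H0c (ptd H0 H0c) (sp H0 H0c).
have others H j : H \in crossed V ell w :\ H0 ->
    acyclic K (local_family H (crossing ell w b H)) j.
  case/setD1P => ne Hc; have [H2 _] := IHH H Hc (ptd H Hc) (sp H Hc); apply: H2.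
  move/(relint_crossing ellP bV Hc) => [_ /(_ _ H0c) le].
  move/eqP: ne; apply; apply: tau_inj => //; apply/eqP.
  by rewrite eq_le le /=; apply: H0min.
have [QU QI Qup] := sides_step ellP wV bV tau_inj (subxx _) H0c H0min (fun H Hc _ => Hc).
have acO j : acyclic K (sides (crossed V ell w :\ H0)) j.
  apply: (acyclic_sides ellP wV bV tau_inj) => [||H /others//]; first exact: subsetDl.
  move=> H H' /setD1P[ne Hc] H'c lt; apply/setD1P; split=> //.
  by apply: contraTneq lt => ->; rewrite -leNgt; apply: H0min.
have acS j : acyclic K (sides (crossed V ell w)) j <-> j <> rk H0.
  split=> [ac|/ac0 ac].
    by apply/ac0; apply: (acyclic_sub (@sides_convex _) QU QI Qup ac) => ? _.
  exact: (acyclic_extension (@sides_convex _) QU QI Qup (acO j) ac).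
rewrite (rk_facet ellP fH0); split=> [ac kE|ne].
  rewrite kE in ac.
  by have /acS := acyclic_quotient cvx PU PI Pup (acV (rk H0)) ac.
apply: (acyclic_sub cvx PU PI Pup (acV k)) => l lk; apply/acS => lE.
by apply: ne; rewrite -lk lE.
Qed.

End Shelling.
End LocalFamily.

(** * Cech complexes of monomials on projective space *)

Lemma codiff_raddf n (A B : nzRingType) (f : A -> B) (c : {set 'I_n} -> A) T :
  {morph f : x y / x - y} -> f (codiff c T) = codiff (fun S => f (c S)) T.
Proof.
move=> fB; have f0 : f 0 = 0 by rewrite -{1}(subrr 0) fB subrr.
have fN x : f (- x) = - f x by rewrite -(sub0r x) fB f0 sub0r.
have fD x y : f (x + y) = f x + f y by rewrite -{1}(opprK y) fB fN opprK.
rewrite /codiff (big_morph f fD f0); apply: eq_bigr => i _.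
by rewrite -[in LHS]signr_odd -[in RHS]signr_odd !mulr_sign; case: (odd _); rewrite ?fN.
Qed.

Lemma codiffMr n (A : comNzRingType) (c : {set 'I_n} -> A) x T :
  codiff (fun S => c S * x) T = codiff c T * x.
Proof. by rewrite /codiff mulr_suml; apply: eq_bigr => i _; rewrite mulrA. Qed.

Section MonomialSums.
Variables (K : fieldType) (n : nat) (G : zmodType) (mm : 'I_n -> G).
Implicit Types (f g : {mpoly K[n]}) (al be : 'X_{1..n}) (u v : G).

Definition weight al : G := \sum_i mm i *+ al i.

Lemma weightD al be : weight (al + be) = weight al + weight be.
Proof.
by rewrite -big_split; apply: eq_bigr => i _; rewrite mnmDE mulrnDr.
Qed.

(** The coefficient of chi^u in the image of f under x_i -> chi^(mm i); all of them vanish iff f is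
    in the kernel of this map, the toric ideal. *)
Definition coef_sum f u : K := \sum_(al <- msupp f | weight al == u) f@_al.

Lemma coef_sum_wide k f u : (msize f <= k)%N ->
  coef_sum f u = \sum_(al : 'X_{1..n < k} | weight al == u) f@_al.
Proof.
move=> le_fk; pose I : subFinType _ := 'X_{1..n < k}.
rewrite /coef_sum big_mkcond (big_mksub I) //=; first last.
- by move=> al /msize_mdeg_lt /leq_trans; apply.
- by rewrite msupp_uniq.
rewrite [RHS]big_mkcond [LHS]big_rmcond //= => i.
by move/memN_msupp_eq0 ->; case: ifP.
Qed.

Lemma coef_sumB u : {morph coef_sum^~ u : f g / f - g}.
Proof.
move=> f g /=; set k := maxn (msize f) (msize g).
rewrite !(@coef_sum_wide k) ?leq_maxl ?leq_maxr //; last first.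
  by rewrite (leq_trans (msizeD_le _ _)) // msizeN.
by rewrite -sumrB; apply: eq_bigr => al _; rewrite mcoeffB.
Qed.

Lemma coef_sum0 u : coef_sum 0 u = 0.
Proof. by rewrite /coef_sum msupp0 big_nil. Qed.

Lemma coef_sumN u f : coef_sum (- f) u = - coef_sum f u.
Proof. by rewrite -sub0r coef_sumB coef_sum0 sub0r. Qed.

Lemma coef_sumD u : {morph coef_sum^~ u : f g / f + g}.
Proof. by move=> f g /=; rewrite -{1}(opprK g) coef_sumB coef_sumN opprK. Qed.

Lemma coef_sum_sum (I : Type) (s : seq I) (P : pred I) (F : I -> {mpoly K[n]}) u :
  coef_sum (\sum_(i <- s | P i) F i) u = \sum_(i <- s | P i) coef_sum (F i) u.
Proof. exact: (big_morph _ (coef_sumD u) (coef_sum0 u)). Qed.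

Lemma coef_sumZX c al u : coef_sum (c *: 'X_[al]) u = if weight al == u then c else 0.
Proof.
case: (eqVneq c 0) => [->|c0]; first by rewrite scale0r coef_sum0 if_same.
rewrite /coef_sum msuppMCX // big_mkcond big_seq1.
by rewrite mcoeffZ mcoeffX eqxx mulr1.
Qed.

Lemma coef_sumMX f be u : coef_sum (f * 'X_[be]) (u + weight be) = coef_sum f u.
Proof.
rewrite {1}[f]mpolyE mulr_suml coef_sum_sum /coef_sum [RHS]big_mkcond /=.
apply: eq_bigr => al _; rewrite -scalerAl -mpolyXD -/(coef_sum _ _) coef_sumZX.
by rewrite weightD (inj_eq (addIr _)).
Qed.

Lemma coef_sum_supp f u : coef_sum f u != 0 -> exists2 al, al \in msupp f & weight al = u.
Proof.
move=> nz; have [/hasP[al ? /eqP]|/hasPn no] :=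
    boolP (has (fun al => weight al == u) (msupp f)); first by exists al.
case/eqP: nz; rewrite /coef_sum big_seq_cond big1 // => al /andP[/no/negbTE->].
by [].
Qed.

Lemma mpoly_divX f be : (forall al, al \in msupp f -> (be <= al)%MM) ->
  exists2 g, f = g * 'X_[be] & forall al, (al \in msupp g) = (al + be \in msupp f)%MM.
Proof.
move=> le; exists (\sum_(al <- msupp f) f@_al *: 'X_[al - be]) => [|al].
  rewrite mulr_suml [LHS]mpolyE big_seq [RHS]big_seq; apply: eq_bigr => al alf.
  by rewrite -scalerAl -mpolyXD submK ?le.
set g := \sum_(_ <- _) _.
have E : f = g * 'X_[be].
  rewrite mulr_suml [LHS]mpolyE big_seq [RHS]big_seq; apply: eq_bigr => al' alf.
  by rewrite -scalerAl -mpolyXD submK ?le.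
by rewrite E !mcoeff_msupp addmC mcoeffMX.
Qed.

End MonomialSums.

Section LaurentCech.
Variables (K : closedFieldType) (r : nat) (G : zmodType) (mm : 'I_r.+1 -> G).
Implicit Types (f g : {mpoly K[r.+1]}) (al be : 'X_{1..r.+1}) (u v : G)
  (S T : {set 'I_r.+1}) (n : int) (N : nat).

Local Notation weight := (weight mm).
Local Notation coef_sum := (coef_sum mm).
Local Notation frac := {fraction {mpoly K[r.+1]}}.

Definition full_mnm N : 'X_{1..r.+1} := [multinom N | _ < r.+1].

(* The exponents al of the monomials of degree n in the localisation at
   prod_(i in S) x_i, shifted by N in all coordinates. *)
Definition laurent_mnm n N S al : bool :=
  ((mdeg al)%:Z == n + (N * r.+1)%:Z) && [forall j, (j \notin S) ==> (N <= al j)%N].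

Lemma laurent_mnmP n N S al :
  reflect ((mdeg al)%:Z = n + (N * r.+1)%:Z /\ forall j, j \notin S -> (N <= al j)%N)
          (laurent_mnm n N S al).
Proof.
apply: (iffP andP) => -[/eqP ? H]; split=> //; last first.
  by apply/forallP => j; apply/implyP; apply: H.
by move=> j; move/forallP/(_ j)/implyP: H.
Qed.

Definition laurent n N S f := forall al, al \in msupp f -> laurent_mnm n N S al.

(** In unshifted terms: a Laurent monomial of degree n and weight u has poles only along S, of order
    at most N. *)
Definition lift n N S u :=
  exists2 al, laurent_mnm n N S al & weight al = u + weight (full_mnm N).

Lemma mdeg_full N : mdeg (full_mnm N) = (N * r.+1)%N.
Proof.
rewrite mdegE (eq_bigr (fun=> N)) => [|i _]; last by rewrite mnmE.
by rewrite sum_nat_const card_ord mulnC.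
Qed.

Lemma full_mnmD N k : full_mnm (N + k) = (full_mnm N + full_mnm k)%MM.
Proof. by apply/mnmP => i; rewrite mnmDE !mnmE. Qed.

Lemma laurentB n N S f g : laurent n N S f -> laurent n N S g -> laurent n N S (f - g).
Proof.
by move=> Lf Lg al /msuppB_le; rewrite mem_cat => /orP[/Lf|/Lg].
Qed.

Lemma laurent0 n N S : laurent n N S 0.
Proof. by move=> al; rewrite msupp0. Qed.

Lemma laurent_sum n N S (I : eqType) (s : seq I) (P : pred I) F :
  (forall i, i \in s -> P i -> laurent n N S (F i)) -> laurent n N S (\sum_(i <- s | P i) F i).
Proof.
move=> L; rewrite big_seq_cond.
apply: (big_ind (laurent n N S)) => [|f g Lf Lg al|i /andP[]].
- exact: laurent0.
- by move/msuppD_le; rewrite mem_cat => /orP[/Lf|/Lg].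
- exact: L.
Qed.

Lemma laurent_up n N S T f : S \subset T -> laurent n N S f -> laurent n N T f.
Proof.
move=> ST L al /L/laurent_mnmP[dg H]; apply/laurent_mnmP; split=> // j jT.
by apply: H; apply: contraNN jT; apply: (subsetP ST).
Qed.

Lemma laurent_shift n N k S f :
  laurent n N S f -> laurent n (N + k) S (f * 'X_[full_mnm k]).
Proof.
move=> L al; rewrite (perm_mem (msuppMX _ _)) => /mapP[be /L/laurent_mnmP[dg H] ->].
apply/laurent_mnmP; split=> [|j jS].
  by rewrite mdegD mdeg_full PoszD dg mulnDl PoszD; ring.
by rewrite mnmDE mnmE addnC leq_add2l H.
Qed.

Lemma laurent_codiff n N (c : {set 'I_r.+1} -> {mpoly K[r.+1]}) T :
  (forall S, laurent n N S (c S)) -> laurent n N T (codiff c T).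
Proof.
move=> L; apply: laurent_sum => i _ iT; rewrite -signr_odd mulr_sign.
have Li : laurent n N T (c (T :\ i)) by apply: laurent_up (L _); apply: subsetDl.
case: odd => //; rewrite -[- _]sub0r; apply: laurentB => //; exact: laurent0.
Qed.

(* Cohomology of O(n) on P^r: for a fixed exponent al, the complex is a cone
   with apex any coordinate at which the (unshifted) exponent is nonnegative. *)
Lemma laurent_acyclic n N k (g : {set 'I_r.+1} -> {mpoly K[r.+1]}) :
    (k = r.+1 -> - (r%:Z) <= n) ->
    (forall S, laurent n N S (g S)) -> (forall S, #|S| <> k -> g S = 0) ->
    (0 < k)%N -> (forall T, codiff g T = 0) ->
  exists e, [/\ forall S, laurent n N S (e S), forall S, #|S|.+1 <> k -> e S = 0
              & forall S, codiff e S = g S].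
Proof.
move=> hk Lg gk k0 dg.
(* Every exponent in g has degree n + N (r + 1), so a sum over exponents of degree below B loses
   nothing. *)
pose B := (absz (n + (N * r.+1)%:Z)).+1.
pose ap (al : 'X_{1..r.+1}) := [pick j | (N <= al j)%N].
pose ga al := fun S => (g S)@_al.
pose ea al S := if ap al is Some e then cone_op e (ga al) S else 0.
pose e S := \sum_(al : 'X_{1..r.+1 < B}) ea al S *: 'X_[al].
have ga_neq0 al S : ga al S != 0 ->
    [/\ #|S| = k, (mdeg al < B)%N & laurent_mnm n N S al].
  rewrite -mcoeff_msupp => alg; have La := Lg S _ alg; split=> //.
    case: (eqVneq #|S| k) => // /eqP/gk g0; move: alg.
    by rewrite g0 msupp0.
  by have [dga _] := laurent_mnmP _ _ _ _ La; rewrite /B -dga ltnS.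
have ea_neq0 al S : ea al S != 0 -> exists e,
    [/\ ap al = Some e, e \notin S & ga al (e |: S) != 0].
  rewrite /ea; case E: (ap al) => [j|]; last by rewrite eqxx.
  rewrite /cone_op; case: ifPn => [|jS]; first by rewrite eqxx.
  move=> nz; exists j; split=> //; apply: contraNneq nz => ->.
  by rewrite mulr0.
have eE al S : (e S)@_al = ea al S.
  case: (ltnP (mdeg al) B) => [lt|ge]; first exact: (mcoeff_mpoly (fun al => ea al S)).
  have -> : ea al S = 0.
    apply/eqP/negPn/negP => /ea_neq0[j [_ _ /ga_neq0[_]]].
    by rewrite ltnNge ge.
  rewrite raddf_sum big1 // => be _ /=; rewrite mcoeffZ mcoeffX.
  case: eqVneq => [E|]; last by rewrite mulr0.
  by move: ge; rewrite -E leqNgt bmdeg.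
have ea_card al S : ea al S != 0 -> #|S|.+1 = k.
  by case/ea_neq0 => j [_ jS /ga_neq0[]]; rewrite cardsU1 jS.
exists e; split=> [S al|S nk|S].
- rewrite mcoeff_msupp eE => /ea_neq0[j [apj jS /ga_neq0[_ _ La]]].
  have [dga H] := laurent_mnmP _ _ _ _ La; apply/laurent_mnmP; split=> // i iS.
  (* The unshifted exponent at the apex j is nonnegative, so the monomial stays admissible once j
     has left the set. *)
  case: (eqVneq i j) => [->|ij]; last by apply: H; rewrite !inE negb_or ij.
  by move: apj; rewrite /ap; case: pickP => // ? ? [<-].
- apply/mpolyP => al; rewrite eE mcoeff0; apply/eqP/negPn/negP => /ea_card.
  exact: nk.
- apply/mpolyP => al; rewrite (codiff_raddf _ _ (@mcoeffB _ _ al)).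
  under eq_codiff do rewrite eE.
  have dga T : codiff (ga al) T = 0.
    by rewrite -(codiff_raddf _ _ (@mcoeffB _ _ al)) dg mcoeff0.
  rewrite /ea; case E: (ap al) => [j|].
    rewrite -[RHS]/(ga al S) -[RHS](cone_opK j) [X in _ = _ + X]/cone_op.
    by case: ifP => _; rewrite ?dga ?mulr0 addr0.
  rewrite codiff_eq0 //; apply/esym/eqP/negPn/negP => /ga_neq0[Sk _ La].
  (* Without an apex all unshifted exponents are negative: S is everything and n <= - (r + 1),
     against [hk]. *)
  have lt j : (al j < N)%N.
    by move: E; rewrite /ap; case: pickP => // no _; rewrite ltnNge no.
  have [dgal H] := laurent_mnmP _ _ _ _ La.
  have ST : S = setT.
    by apply/setP => j; rewrite inE; apply: contraTT (lt j) => /H; rewrite leqNgt.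
  have kr : k = r.+1 by rewrite -Sk ST cardsT card_ord.
  have : (mdeg al + r.+1 <= N * r.+1)%N.
    rewrite mdegE -mdeg_full mdegE -[X in (_ + X)%N]card_ord -sum1_card -big_split /=.
    by apply: leq_sum => i _; rewrite mnmE addn1.
  have := hk kr; lia.
Qed.

End LaurentCech.

Lemma eventually_forall_seq (J : eqType) (s : seq J) (P : J -> nat -> Prop) :
  (forall j, j \in s -> exists M, forall N, (M <= N)%N -> P j N) ->
  exists M, forall N, (M <= N)%N -> forall j, j \in s -> P j N.
Proof.
elim: s => [|j s IH] H; first by exists 0.
have [M1 H1] := H j (mem_head _ _).
have [|M2 H2] := IH; first by move=> k ks; apply: H; rewrite inE ks orbT.
exists (maxn M1 M2) => N; rewrite geq_max => /andP[l1 l2] k; rewrite inE.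
by case/orP => [/eqP->|]; [apply: H1 | apply: H2].
Qed.

(** * From the ideal sheaf to families of sets, one weight at a time *)

Section IdealCech.
Variables (K : closedFieldType) (r : nat) (G : zmodType) (mm : 'I_r.+1 -> G).
Variable X : ('I_r.+1 -> K) -> Prop.
Implicit Types (f g : {mpoly K[r.+1]}) (al be : 'X_{1..r.+1}) (u v : G)
  (S T : {set 'I_r.+1}) (n : int) (N : nat).

Local Notation weight := (weight mm).
Local Notation coef_sum := (coef_sum mm).
Local Notation frac := {fraction {mpoly K[r.+1]}}.
Local Notation full_mnm := (@full_mnm r).
Local Notation laurent := (@laurent K r).
Local Notation lift := (lift mm).

(** The homogeneous ideal of X is the toric ideal of [mm]; [embedded_vanishesP] supplies this for
    the embedded toric variety. *)
Hypothesis vanishesP : forall e f, f \is e.-homog ->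
  (vanishes_on X f <-> forall u, coef_sum f u = 0).

Definition part_mnm S N : 'X_{1..r.+1} := [multinom (if i \in S then N else 0%N) | i < r.+1].

Definition over_full N f : frac := tofrac f / tofrac 'X_[full_mnm N].

(** Numerators of sections of I(n) over U_S. A denominator independent of S turns cochains of
    fractions into cochains of polynomials. *)
Definition ideal_poly n N S f := laurent n N S f /\ forall u, coef_sum f u = 0.

Lemma part_mnm_prod S N :
  \prod_(i in S) 'X_i ^+ N = 'X_[part_mnm S N] :> {mpoly K[r.+1]}.
Proof.
rewrite mpolyXE_id big_mkcond; apply: eq_bigr => i _; rewrite mnmE.
by case: ifP.
Qed.

Lemma full_part S N : full_mnm N = (part_mnm S N + part_mnm (~: S) N)%MM.
Proof. by apply/mnmP => i; rewrite mnmDE !mnmE inE; case: (i \in S); rewrite ?addn0. Qed.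

Lemma mdeg_part S N : mdeg (part_mnm S N) = (N * #|S|)%N.
Proof.
rewrite mdegE (eq_bigr (fun i => if i \in S then N else 0%N)) => [|i _]; last by rewrite mnmE.
by rewrite -big_mkcond sum_nat_const mulnC.
Qed.

Lemma muln_setC S N : (N * r.+1)%N = (N * #|S| + N * #|~: S|)%N.
Proof. by rewrite -mulnDr cardsC card_ord. Qed.

Lemma tofracX_neq0 al : tofrac 'X_[K, al] != 0 :> frac.
Proof. by rewrite tofrac_eq0 -msize_poly_eq0 msizeX. Qed.

Lemma over_fullD N k f : over_full (N + k) (f * 'X_[full_mnm k]) = over_full N f.
Proof.
rewrite /over_full full_mnmD mpolyXD !tofracM -mulf_div.
by rewrite divff ?mulr1 ?tofracX_neq0.
Qed.

Lemma over_fullB N : {morph over_full N : f g / f - g}.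
Proof. by move=> f g; rewrite /over_full tofracB mulrBl. Qed.

Lemma over_full_inj N : injective (over_full N).
Proof.
move=> f g /(mulIf _) E; apply/eqP; rewrite -tofrac_eq; apply/eqP/E.
by rewrite invr_eq0 tofracX_neq0.
Qed.

Lemma over_full_codiff N (c : {set 'I_r.+1} -> {mpoly K[r.+1]}) T :
  cech_d (fun S => over_full N (c S)) T = over_full N (codiff c T).
Proof. by rewrite (codiff_raddf _ _ (over_fullB N)). Qed.

Lemma ideal_poly_shift n N k S f :
  ideal_poly n N S f -> ideal_poly n (N + k) S (f * 'X_[full_mnm k]).
Proof.
case=> L cs; split=> [|u]; first exact: laurent_shift.
by rewrite -[u](subrK (weight (full_mnm k))) coef_sumMX.
Qed.

Lemma ideal_section_poly n S a : ideal_section X n S a ->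
  exists N f, ideal_poly n N S f /\ a = over_full N f.
Proof.
case=> [N [e [f [vf /[dup] hf /dhomogP df eE ->]]]].
have cs := (vanishesP hf).1 vf.
exists N, (f * 'X_[part_mnm (~: S) N]); split; last first.
  rewrite /over_full (full_part S) mpolyXD !tofracM -mulf_div divff ?mulr1 ?tofracX_neq0 //.
  by rewrite part_mnm_prod.
split=> [al|u]; last first.
  by rewrite -[u](subrK (weight (part_mnm (~: S) N))) coef_sumMX.
rewrite (perm_mem (msuppMX _ _)) => /mapP[be /df dbe ->].
apply/laurent_mnmP; split=> [|j jS].
  rewrite mdegD mdeg_part PoszD [mdeg be]dbe eE (muln_setC S) !PoszD.
  by ring.
by rewrite mnmDE mnmE inE jS leq_addr.
Qed.

(** The degree bound is there because the numerator over prod_(i in S) x_i^N has degree n + N |S|,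
    which must be a natural number. *)
Lemma poly_ideal_section n N S f : 0 <= n + (N * #|S|)%:Z ->
  ideal_poly n N S f -> ideal_section X n S (over_full N f).
Proof.
move=> n0 [L cs].
have [al alf|g fE gsupp] := @mpoly_divX _ _ f (part_mnm (~: S) N).
  have [_ H] := laurent_mnmP _ _ _ _ (L al alf); apply/mnm_lepP => j.
  by rewrite mnmE inE; case: ifP => // /H.
have hg : g \is (absz (n + (N * #|S|)%:Z)).-homog.
  apply/dhomogP => al; rewrite gsupp => /L/laurent_mnmP[].
  rewrite mdegD mdeg_part (muln_setC S) => E _.
  apply/eqP; rewrite -eqz_nat gez0_abs // -(inj_eq (addIr (N * #|~: S|)%:Z)).
  by rewrite -!PoszD E -addrA -PoszD.
exists N, (absz (n + (N * #|S|)%:Z)), g; split=> //.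
- apply/(vanishesP hg) => u; rewrite -(cs (u + weight (part_mnm (~: S) N))) fE.
  by rewrite coef_sumMX.
- by rewrite gez0_abs.
- rewrite /over_full (full_part S) mpolyXD fE !tofracM -mulf_div divff ?mulr1 ?tofracX_neq0 //.
  by rewrite part_mnm_prod.
Qed.

Lemma cochain_poly n p c : cochain X n p c ->
  exists M, forall N, (M <= N)%N -> exists g : {set 'I_r.+1} -> {mpoly K[r.+1]},
    [/\ forall S, ideal_poly n N S (g S), forall S, #|S| <> p.+1 -> g S = 0
      & forall S, #|S| = p.+1 -> c S = over_full N (g S)].
Proof.
move=> cc.
have H S : exists M, forall N, (M <= N)%N -> exists f, ideal_poly n N S f /\
    (#|S| = p.+1 -> c S = over_full N f).
  case: (EM (#|S| = p.+1)) => [cS|nS]; last first.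
    exists 0 => N _; exists 0; split=> //; split=> [|u]; last exact: coef_sum0.
    exact: laurent0.
  have [N0 [f [If cf]]] := ideal_section_poly (cc S cS).
  exists N0 => N le; have [k ->] : exists k, N = (N0 + k)%N.
    by exists (N - N0)%N; rewrite subnKC.
  exists (f * 'X_[full_mnm k]); rewrite over_fullD; split=> //.
  exact: ideal_poly_shift.
have [M HM] := @eventually_forall_seq _ (enum {set 'I_r.+1}) _ (fun S _ => H S).
exists M => N le.
have /choice[g gP] : forall S, exists f, ideal_poly n N S f /\
    (#|S| = p.+1 -> c S = over_full N f).
  by move=> S; apply: (HM N le); rewrite mem_enum.
exists (fun S => if #|S| == p.+1 then g S else 0); split=> S.
- case: ifP => _; first by have [] := gP S.
  by split=> [|u]; [apply: laurent0 | apply: coef_sum0].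
- by move/eqP/negbTE->.
- by move=> cS; rewrite cS eqxx; have [_ ->] := gP S.
Qed.

Section Degree.
Variables (n : int) (Fam : G -> pred {set 'I_r.+1}).
Hypothesis Fam_up : forall u S T, S \subset T -> Fam u S -> Fam u T.

Definition eventually_lifts S u := exists M, forall N, (M <= N)%N -> lift n N S u.

Lemma weight_shift N k : weight (full_mnm (N + k)) = weight (full_mnm N) + weight (full_mnm k).
Proof. by rewrite full_mnmD weightD. Qed.

(** The primitive [b1] in O(n) need not lie in I(n), but its weight sums [q] form a cocycle. A
    primitive [e] of [q], realised by monomials as [e'], repairs it: [b1] minus the coboundary of
    [e'] has weight sums zero. *)
Lemma ideal_H_vanishes_of_acyclic i :
    (0 < i)%N -> (i = r -> - (r%:Z) <= n) ->
    (forall N S u, lift n N S u -> Fam u S) ->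
    (forall u, acyclic K (Fam u) i) ->
    (forall u S, #|S|.+1 = i -> Fam u S -> eventually_lifts S u) ->
  ideal_H_vanishes X n i.
Proof.
move=> i0 nr lift_Fam acF lifts c cc dc.
have [N0 /(_ N0 (leqnn _))[g [Ig gi cg]]] := cochain_poly cc.
have dg T : codiff g T = 0.
  case: (EM (#|T| = i.+2)) => [cT|nT].
    apply: (@over_full_inj N0); rewrite -over_full_codiff.
    rewrite /over_full tofrac0 mul0r -(dc T cT); apply: eq_codiff => j jT.
    by rewrite cg // -[RHS]/(i.+1); apply/eq_add_S; rewrite -cT (cardsD1 j T) jT.
  apply: codiff_eq0 => j jT; apply: gi => E; apply: nT.
  by rewrite (cardsD1 j) jT E.
have [||b1 [Lb1 b1i db1]] := laurent_acyclic _ (fun S => (Ig S).1) gi _ dg => //.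
  by case.
pose q u S := coef_sum (b1 S) (u + weight (full_mnm N0)).
have q_neq0 u S : q u S != 0 -> #|S| = i /\ Fam u S.
  move=> nz; split.
    case: (EM (#|S| = i)) => // ni; case/eqP: nz.
    by rewrite /q b1i ?coef_sum0 // => -[].
  have [al alb wal] := coef_sum_supp nz.
  by apply: (lift_Fam N0); exists al => //; apply: Lb1 alb.
have codiff_q u T : codiff (q u) T = 0.
  rewrite /q -(codiff_raddf _ _ (coef_sumB mm _)) db1.
  by have [_] := Ig T.
have /choice[e eP] : forall u, exists e : {set 'I_r.+1} -> K,
    (forall S, e S != 0 -> Fam u S /\ #|S|.+1 = i) /\
    forall S, codiff e S = q u S.
  move=> u; have [S /q_neq0[]//|//|e e0 de] := acF u (q u).
  exists e; split=> // S; case: (boolP (Fam u S)) => [/de//|nF].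
  rewrite codiff_eq0 => [|j jS].
    by apply/esym/eqP/negPn/negP => /q_neq0[_]; apply/negP.
  apply/eqP; apply: contraNT nF => /e0[F _]; apply: Fam_up F; exact: subsetDl.
(* Finitely many weights occur in [b1], so a single N serves all of them. *)
pose U := undup (flatten [seq [seq weight al - weight (full_mnm N0) | al <- msupp (b1 W)]
  | W <- enum {set 'I_r.+1}]).
have q_U u S : q u S != 0 -> u \in U.
  case/coef_sum_supp => al alb wal; rewrite mem_undup; apply/flattenP.
  exists [seq weight al - weight (full_mnm N0) | al <- msupp (b1 S)].
    by apply: map_f; rewrite mem_enum.
  by apply/mapP; exists al; rewrite // wal addrK.
pose J := [seq (u, W) | u <- U, W <- enum {set 'I_r.+1}].
have [|M HM] := @eventually_forall_seq _ J
  (fun p N => #|p.2|.+1 = i -> Fam p.1 p.2 -> lift n N p.2 p.1).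
  move=> [u S] _ /=; case: (EM (#|S|.+1 = i /\ Fam u S)) => [[ci F]|no].
    by have [M HM] := lifts u S ci F; exists M => N /HM.
  by exists 0 => N _ ci F; case: no.
(* k >= |n| makes n + N i nonnegative, as [poly_ideal_section] requires. *)
pose k := maxn M `|n|%N; pose N := (N0 + k)%N.
have /choice[la laP] : forall p : G * {set 'I_r.+1}, exists al, p.1 \in U ->
    #|p.2|.+1 = i -> Fam p.1 p.2 ->
    laurent_mnm n N p.2 al /\ weight al = p.1 + weight (full_mnm N).
  move=> [u S] /=; case: (EM (lift n N S u)) => [[al ? ?]|no]; first by exists al.
  exists 0%MM => uU ci F; case: no; apply: (HM N _ (u, S)) => //=.
    by rewrite /N /k; lia.
  by apply/allpairsP; exists (u, S); rewrite mem_enum.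
pose e' S := \sum_(u <- U) e u S *: 'X_[la (u, S)].
have Le' S : laurent n N S (e' S).
  apply: laurent_sum => u uU _ al; case: (eqVneq (e u S) 0) => [->|nz].
    by rewrite scale0r msupp0.
  have [F ci] := (eP u).1 S nz; rewrite msuppMCX // inE => /eqP->.
  by have [] := laP (u, S) uU ci F.
have cs_e' S u : coef_sum (e' S) (u + weight (full_mnm N)) =
    if u \in U then e u S else 0.
  rewrite /e' coef_sum_sum.
  have E v : v \in U -> coef_sum (e v S *: 'X_[la (v, S)]) (u + weight (full_mnm N)) =
      if v == u then e v S else 0.
    move=> vU; rewrite coef_sumZX; case: (eqVneq (e v S) 0) => [->|nz].
      by rewrite !if_same.
    have [F ci] := (eP v).1 S nz.
    by have [_ ->] := laP (v, S) vU ci F; rewrite (inj_eq (addIr _)).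
  rewrite (eq_big_seq _ E); case: ifP => uU.
    rewrite (bigD1_seq u) ?undup_uniq //= eqxx big1 ?addr0 // => v /negbTE->.
    by [].
  by rewrite big_seq big1 // => v vU; case: eqVneq uU vU => // -> ->.
pose b2 S := b1 S * 'X_[full_mnm k] - codiff e' S.
have Ib2 S : ideal_poly n N S (b2 S).
  split=> [|v].
    by apply: laurentB; [apply: laurent_shift | apply: laurent_codiff].
  rewrite coef_sumB (codiff_raddf _ _ (coef_sumB mm v)).
  rewrite -[v](subrK (weight (full_mnm N))); set u := v - _.
  rewrite (@eq_codiff _ _ _ (fun T => if u \in U then e u T else 0)); last first.
    by move=> j _; rewrite cs_e'.
  rewrite /N (weight_shift N0 k) addrA coef_sumMX -/(q u S).
  case: (boolP (u \in U)) => uU; first by rewrite (eP u).2 subrr.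
  by rewrite codiff_eq0 // subr0; apply/eqP; apply: contraNT uU; apply: q_U.
exists (fun S => if #|S| == i then over_full N (b2 S) else 0) => [S|S].
  rewrite prednK // => Si; rewrite Si eqxx; apply: poly_ideal_section => //.
  by rewrite Si; move: i0; rewrite /N /k; nia.
move=> Si; rewrite cg // -(over_fullD N0 k) -/N -db1 -codiffMr.
have -> : codiff (fun S => b1 S * 'X_[full_mnm k]) S = codiff b2 S.
  by rewrite codiffB codiffK subr0.
rewrite -over_full_codiff; apply: eq_codiff => j jS.
suff -> : #|S :\ j| == i by [].
by rewrite -eqSS -Si (cardsD1 j S) jS.
Qed.

(** The same diagram read backwards: monomials of weight u lift [q] to [b1], whose coboundary lies
    in I(n) and so is that of some [b] in I(n); the difference of [b1] and [b] is a cocycle of O(n),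
    and the weight sums of its primitive bound [q]. That the result is supported where lifts exist
    matters at the empty set, where cone membership alone gives none. *)
Lemma coboundary_of_ideal_H_vanishes i u (q : {set 'I_r.+1} -> K) :
    (0 < i <= r)%N ->
    (forall S, #|S| = i -> Fam u S -> eventually_lifts S u) ->
    (forall S, q S != 0 -> Fam u S /\ #|S| = i) -> (forall T, codiff q T = 0) ->
    ideal_H_vanishes X n i ->
  exists2 e : {set 'I_r.+1} -> K,
    forall S, e S != 0 -> #|S|.+1 = i /\ exists N, lift n N S u
    & forall S, codiff e S = q S.
Proof.
move=> /andP[i0 ir] lifts q0 dq HX.
have [|M HM] := @eventually_forall_seq _ (enum {set 'I_r.+1})
  (fun S N => q S != 0 -> lift n N S u).
  move=> S _; case: (eqVneq (q S) 0) => [_|/q0[F ci]]; first by exists 0.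
  by have [M HM] := lifts S ci F; exists M => N /HM.
pose N1 := (maxn M `|n|)%N.
have /choice[la laP] : forall S, exists al, q S != 0 ->
    laurent_mnm n N1 S al /\ weight al = u + weight (full_mnm N1).
  move=> S; case: (EM (lift n N1 S u)) => [[al ? ?]|no]; first by exists al.
  by exists 0%MM => nz; case: no; apply: HM nz; rewrite ?leq_maxl ?mem_enum.
pose b1 S := q S *: 'X_[la S].
have Lb1 S : laurent n N1 S (b1 S).
  move=> al; rewrite /b1; case: (eqVneq (q S) 0) => [->|nz].
    by rewrite scale0r msupp0.
  by rewrite msuppMCX // inE => /eqP->; have [] := laP S nz.
have cs_b1 S v : coef_sum (b1 S) v = if v == u + weight (full_mnm N1) then q S else 0.
  rewrite coef_sumZX; case: (eqVneq (q S) 0) => [->|nz]; first by rewrite !if_same.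
  by have [_ ->] := laP S nz; rewrite eq_sym.
have cc : cochain X n i (fun T => over_full N1 (codiff b1 T)).
  move=> T Ti; apply: poly_ideal_section; first by rewrite Ti /N1; nia.
  split=> [|v]; first exact: laurent_codiff.
  rewrite (codiff_raddf _ _ (coef_sumB mm v)).
  rewrite (@eq_codiff _ _ _ (fun W => if v == u + weight (full_mnm N1) then q W else 0));
    last by move=> j _; rewrite cs_b1.
  by case: (v == _); rewrite ?dq // codiff_eq0.
have [T _|b bc dbE] := HX _ cc.
  by rewrite over_full_codiff codiffK /over_full tofrac0 mul0r.
have [M2 HM2] := cochain_poly bc.
pose k := M2; pose N := (N1 + k)%N.
have [|g [Ig gi bg]] := HM2 N; first by rewrite /N leq_addl.
rewrite prednK // in gi bg.
pose h S := b1 S * 'X_[full_mnm k] - g S.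
have b1i S : #|S| <> i -> b1 S = 0.
  move=> ni; rewrite /b1; case: (eqVneq (q S) 0) => [->|/q0[]//].
  by rewrite scale0r.
have dh T : codiff h T = 0.
  case: (EM (#|T| = i.+1)) => [Ti|nT]; last first.
    apply: codiff_eq0 => j jT; have ni : #|T :\ j| <> i.
      by move=> E; apply: nT; rewrite (cardsD1 j) jT E.
    by rewrite /h b1i // gi // mul0r subr0.
  rewrite codiffB codiffMr; apply/eqP; rewrite subr_eq0; apply/eqP.
  apply: (@over_full_inj N); rewrite over_fullD dbE // -over_full_codiff.
  apply: eq_codiff => j jT; rewrite bg //.
  by apply/eq_add_S; rewrite -Ti (cardsD1 j T) jT.
have Lh S : laurent n N S (h S).
  by apply: laurentB; [apply: laurent_shift | have [] := Ig S].
have hi S : #|S| <> i -> h S = 0.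
  by move=> ni; rewrite /h b1i // gi // mul0r subr0.
have [|e [Le ei de]] := laurent_acyclic _ Lh hi i0 dh.
  by move=> E; move: ir; rewrite E ltnn.
exists (fun S => coef_sum (e S) (u + weight (full_mnm N))) => [S nz|S].
  have [al alS wal] := coef_sum_supp nz; split.
    case: (EM (#|S|.+1 = i)) => // /ei E; move: alS.
    by rewrite E msupp0.
  by exists N; exists al => //; apply: Le alS.
rewrite -(codiff_raddf _ _ (coef_sumB mm _)) de coef_sumB.
have [_ ->] := Ig S; rewrite subr0 /N (weight_shift N1 k) addrA coef_sumMX cs_b1 eqxx.
by [].
Qed.

End Degree.
End IdealCech.

(** * Very ample divisors and lattice cones *)

Lemma pairingE (R : realType) d (x y : 'rV[R]_d) : pairing x y = dot x y.
Proof. by []. Qed.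

Lemma pairing_lat (R : realType) d (u v : 'rV[int]_d) :
  pairing (lat R u) (lat R v) = (dot u v)%:~R.
Proof. exact: (dot_map (intr : {rmorphism int -> R})). Qed.

Lemma sum_by_weight (K : fieldType) n (G : zmodType) (mm : 'I_n -> G)
    (f : {mpoly K[n]}) (F : G -> K) :
  \sum_(al <- msupp f) f@_al * F (weight mm al) =
  \sum_(u <- undup [seq weight mm al | al <- msupp f]) coef_sum mm f u * F u.
Proof.
under [RHS]eq_bigr do rewrite /coef_sum mulr_suml big_mkcond.
rewrite exchange_big; apply: eq_big_seq => al alf /=.
rewrite (bigD1_seq (weight mm al)) ?undup_uniq //=; last first.
  by rewrite mem_undup map_f.
by rewrite eqxx big1 ?addr0 // => u; rewrite eq_sym => /negbTE->.
Qed.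

(** * Characters of the torus *)

Section Torus.
Variables (R : realType) (d : nat) (K : closedFieldType).
Implicit Types (u v : 'rV[int]_d) (t : 'rV[int]_d -> K).

Local Notation torus := (@torus_point R d K).

Lemma torus_pointP t : torus t <-> t 0 = 1 /\ forall u v, t (u + v) = t u * t v.
Proof.
have triv u : in_dual (fun x : 'rV[R]_d => x = 0) u.
  by move=> x ->; rewrite pairingE dot0r.
split=> -[t0 tD]; split=> // u v; by apply: tD; apply: triv.
Qed.

Lemma torus_point_neq0 t u : torus t -> t u != 0.
Proof.
case/torus_pointP => t0 tD; apply/eqP => tu.
have := tD u (- u); rewrite subrr t0 tu mul0r => /eqP.
by rewrite oner_eq0.
Qed.

Lemma torus_point_mul t t' : torus t -> torus t' -> torus (fun u => t u * t' u).
Proof.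
case/torus_pointP => t0 tD /torus_pointP[t'0 t'D]; apply/torus_pointP.
by split=> [|u v]; rewrite ?t0 ?t'0 ?mulr1 // tD t'D mulrACA.
Qed.

Lemma torus_point1 : torus (fun=> 1).
Proof. by apply/torus_pointP; split=> // *; rewrite mulr1. Qed.

Lemma torus_point_separates u v : u != v -> exists2 t, torus t & t u != t v.
Proof.
move=> ne; have [i ui] : exists i, u 0 i != v 0 i.
  apply/existsP; apply: contraNT ne => /existsPn E; apply/eqP/rowP => i.
  by apply/eqP; rewrite -[_ == _]negbK E.
pose k := absz (u 0 i - v 0 i)%R.
have k0 : (0 < k)%N by rewrite absz_gt0 subr_eq0.
(* A root x of (X^k - 1) X + 1 satisfies both x <> 0 and x^k <> 1, in any characteristic. *)
have [x xr] : exists x, root (('X^k - 1) * 'X + 1 : {poly K}) x.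
  apply/closed_rootP; rewrite size_polyDl; last first.
    by rewrite size_poly1 size_mulX ?size_XnsubC // -size_poly_eq0 size_XnsubC.
  by rewrite size_mulX ?size_XnsubC // -size_poly_eq0 size_XnsubC.
have E : (x ^+ k - 1) * x = -1.
  move: xr; rewrite rootE !hornerE => /eqP E.
  by apply/eqP; rewrite -subr_eq0 opprK E.
have x0 : x != 0.
  by apply: contra_eqN E => /eqP->; rewrite mulr0 eq_sym oppr_eq0 oner_eq0.
have xk : x ^+ k != 1.
  by apply: contra_eqN E => /eqP->; rewrite subrr mul0r eq_sym oppr_eq0 oner_eq0.
exists (fun w => x ^ (w 0 i)).
  apply/torus_pointP; split=> [|w w']; first by rewrite mxE expr0z.
  by rewrite mxE expfzDr.
apply: contraNneq xk => xx.
have xz : x ^ (u 0 i - v 0 i) = 1.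
  by rewrite expfzDr // xx -expfzDr // subrr expr0z.
rewrite /k; case: (lerP 0 (u 0 i - v 0 i)) => [ge|lt].
  by rewrite exprnP gez0_abs // xz.
by rewrite exprnP ltz0_abs // -invr_expz xz invr1.
Qed.

(** Dedekind's argument: translate a relation by a point [t0] that separates v from u0 and subtract
    [t0 u0] times the relation, which eliminates u0. *)
Lemma torus_characters_independent (s : seq 'rV[int]_d) (c : 'rV[int]_d -> K) :
  uniq s -> (forall t, torus t -> \sum_(u <- s) c u * t u = 0) ->
  forall u, u \in s -> c u = 0.
Proof.
elim: s c => // u0 s IH c /= /andP[u0s us] H.
have cs v : v \in s -> c v = 0.
  move=> vs; have ne : v != u0 by apply: contraNneq u0s => <-.
  have [t0 T0 tne] := torus_point_separates ne.
  have := IH (fun u => c u * (t0 u - t0 u0)) us _ v vs => E.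
  have : c v * (t0 v - t0 u0) = 0.
    apply: E => t T; have := H _ (torus_point_mul T0 T) => H1.
    have := H t T => H2.
    have : \sum_(u <- u0 :: s) c u * (t0 u * t u) - t0 u0 * \sum_(u <- u0 :: s) c u * t u = 0.
      by rewrite H1 H2 mulr0 subrr.
    rewrite !big_cons mulrDr mulr_sumr opprD addrACA => E2.
    rewrite -[RHS]E2 [X in _ = X + _](_ : _ = 0); last by ring.
    by rewrite add0r -sumrB; apply: eq_bigr => u _; ring.
  by move/eqP; rewrite mulf_eq0 subr_eq0 (negbTE tne) orbF => /eqP.
move=> u; rewrite inE => /orP[/eqP->|/cs//].
have := H _ torus_point1; rewrite big_cons mulr1 big_seq big1 ?addr0 // => v /cs->.
by rewrite mul0r.
Qed.

End Torus.

(** * Charts, fixed points and the ideal of X *)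

Section Toric.
Variables (R : realType) (K : closedFieldType) (d r : nat).
Variables (Sigma : complete_fan R d) (D : cartier_divisor Sigma).
Variable m : r.+1.-tuple 'rV[int]_d.
Hypothesis m_basis : section_basis D m.
Hypothesis D_very_ample : very_ample K D m.
Implicit Types (u v : 'rV[int]_d) (s : {set 'I_(nrays Sigma)}) (i : 'I_(nrays Sigma)).

Local Notation mm := (tnth m).
Local Notation mu := (local_data D).
Local Notation rho := (@ray R d Sigma).

Lemma mu_ray s i : s \in maxcones Sigma -> i \in s -> dot (mu s) (rho i) = - coeff D i.
Proof.
move=> sM iS; have := local_dataP D sM iS; rewrite pairing_lat => /eqP.
by rewrite -mulrNz eqr_int => /eqP.
Qed.

Lemma polytope_lat u :
  polytope_of D (lat R u) <-> forall i, 0 <= dot u (rho i) + coeff D i.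
Proof.
split=> H i; have := H i; rewrite pairing_lat -mulrNz ler_int.
  by rewrite addrC -lerBlDl sub0r.
by rewrite addrC -lerBlDl sub0r.
Qed.

Lemma mm_slack j i : 0 <= dot (mm j) (rho i) + coeff D i.
Proof. by move: i; apply/polytope_lat/(m_basis.2 (mm j))/mem_tnth. Qed.

Lemma mmP u : (forall i, 0 <= dot u (rho i) + coeff D i) -> exists j, mm j = u.
Proof. by move/polytope_lat/(m_basis.2 u)/tnthP => [j ->]; exists j. Qed.

Lemma mm_inj : injective mm.
Proof. by apply/tuple_uniqP; case: m_basis. Qed.

Lemma in_dualP s u :
  in_dual (@cone R d Sigma s) u <-> forall i, i \in s -> 0 <= dot u (rho i).
Proof.
split=> [H i iS|H x [c c0 ->]].
  have := H (lat R (rho i)); rewrite pairing_lat ler0z; apply.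
  exists (fun j => (j == i)%:R) => [j|]; first by rewrite ler0n.
  rewrite (bigD1 i) //= eqxx scale1r big1 ?addr0 // => j /andP[_ /negbTE->].
  by rewrite scale0r.
rewrite pairingE dot_sumr sumr_ge0 // => i iS.
by rewrite dotZr mulr_ge0 //= -pairingE pairing_lat ler0z H.
Qed.

Lemma mm_dual s j : s \in maxcones Sigma -> in_dual (@cone R d Sigma s) (mm j - mu s).
Proof.
move=> sM; apply/in_dualP => i iS; rewrite dotBl mu_ray // opprK.
exact: mm_slack.
Qed.

Lemma dual_pointed s u : s \in maxcones Sigma -> in_dual (@cone R d Sigma s) u ->
  in_dual (@cone R d Sigma s) (- u) -> u = 0.
Proof.
move=> sM /in_dualP H1 /in_dualP H2.
have E : lat R u = 0.
  apply: (@maxcone_full _ _ Sigma s) => // i iS; rewrite pairing_lat.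
  apply/eqP; rewrite intr_eq0 eq_le H1 // andbT.
  by have := H2 i iS; rewrite dotNl oppr_ge0.
apply/rowP => k; have /rowP/(_ k)/eqP := E; rewrite !mxE intr_eq0.
by move/eqP.
Qed.

(** The torus-fixed point of each maximal chart. It is multiplicative because the dual cone is
    pointed: a sum of two of its elements vanishes only if both do. *)
Definition fixed_point u : K := (u == 0)%:R.

Lemma fixed_pointP s : s \in maxcones Sigma -> chart_point (@cone R d Sigma s) fixed_point.
Proof.
move=> sM; split=> [|u v ud vd]; first by rewrite /fixed_point eqxx.
rewrite /fixed_point; case: (eqVneq u 0) => [->|u0]; first by rewrite add0r mul1r.
rewrite mul0r; case: eqP => // /eqP; rewrite addr_eq0 => /eqP uv.
case/eqP: u0; apply: (dual_pointed sM) => //.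
by rewrite uv opprK.
Qed.

(** At the fixed point every section chi^(m_j) vanishes except chi^(mu s), so base point freeness
    forces mu s to be among the m_j. *)
Lemma mu_mm s : s \in maxcones Sigma -> exists j, mm j = mu s.
Proof.
move=> sM; have [bpf _ _] := D_very_ample.
have [j] := bpf s _ sM (fixed_pointP sM); rewrite /phi /fixed_point.
case: (eqVneq (mm j - mu s) 0) => [/eqP|_]; rewrite ?eqxx // subr_eq0 => /eqP E _.
by exists j.
Qed.

Lemma chart_point_prod (C : 'rV[R]_d -> Prop) (g : 'rV[int]_d -> K) n
    (w : 'I_n -> 'rV[int]_d) (al : 'I_n -> nat) :
  chart_point C g -> (forall j, in_dual C (w j)) ->
  \prod_j g (w j) ^+ al j = g (\sum_j w j *+ al j).
Proof.
case=> g0 gD wd.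
have dual0 : in_dual C 0.
  by move=> x _; rewrite pairingE /lat map_mx0 dot0l.
have dualD u v : in_dual C u -> in_dual C v -> in_dual C (u + v).
  move=> ud vd x Cx; rewrite pairingE /lat map_mxD dotDl.
  by rewrite addr_ge0 // -pairingE; [apply: ud | apply: vd].
have dualM u k : in_dual C u -> in_dual C (u *+ k).
  by move=> ud; elim: k => // k IH; rewrite mulrS; apply: dualD.
suff [] : in_dual C (\sum_j w j *+ al j) /\
    \prod_j g (w j) ^+ al j = g (\sum_j w j *+ al j) by [].
apply: (big_ind2 (fun u (x : K) => in_dual C u /\ x = g u)) => // [u x v y|j _].
  by move=> [ud ->] [vd ->]; split; [apply: dualD | rewrite gD].
split; first exact: dualM.
elim: (al j) => [|k IH]; first by rewrite mulr0n g0.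
by rewrite exprS mulrS gD ?IH //; apply: dualM.
Qed.

Lemma meval_chart s (g : 'rV[int]_d -> K) (c : K) e (f : {mpoly K[r.+1]}) :
  s \in maxcones Sigma -> chart_point (@cone R d Sigma s) g -> f \is e.-homog ->
  f.@[fun j => c * phi D m s g j] =
  \sum_(al <- msupp f) f@_al * (c ^+ e * g (weight mm al - mu s *+ e)).
Proof.
move=> sM gC /dhomogP hf; rewrite mevalE; apply: eq_big_seq => al alf; congr (_ * _).
under eq_bigr do rewrite exprMn.
rewrite big_split /= prodrXr -mdegE (hf _ alf); congr (_ * _).
rewrite (chart_point_prod _ gC) => [|j]; last exact: mm_dual.
congr (g _); under eq_bigr do rewrite mulrnBl.
rewrite sumrB; congr (_ - _); rewrite sumrMnr -mdegE.
by rewrite (hf _ alf).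
Qed.

Lemma meval_torus t (f : {mpoly K[r.+1]}) : @torus_point R d K t ->
  f.@[fun j => t (mm j)] = \sum_(al <- msupp f) f@_al * t (weight mm al).
Proof.
move=> tT; rewrite mevalE; apply: eq_big_seq => al alf; congr (_ * _).
by apply: (chart_point_prod _ tT) => j x ->; rewrite pairingE dot0r.
Qed.

Lemma exists_maxcone : exists s, s \in maxcones Sigma.
Proof. by have [s sM _] := fan_complete Sigma 0; exists s. Qed.

Lemma torus_chart_point s t : @torus_point R d K t -> chart_point (@cone R d Sigma s) t.
Proof. by case/torus_pointP => t0 tD; split=> // u v _ _; apply: tD. Qed.

Lemma coef_sum_supp_weights (f : {mpoly K[r.+1]}) u :
  u \notin undup [seq weight mm al | al <- msupp f] -> coef_sum mm f u = 0.
Proof.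
rewrite mem_undup; apply: contraNeq => /coef_sum_supp[al alf <-].
exact: map_f.
Qed.

(** On a chart the value of f depends only on its weight sums; conversely the torus points alone
    detect each of them, by independence of characters. *)
Lemma embedded_vanishesP e (f : {mpoly K[r.+1]}) : f \is e.-homog ->
  vanishes_on (embedded_variety (K := K) D m) f <-> forall u, coef_sum mm f u = 0.
Proof.
move=> hf; split=> [vf u|cs x [s [g [c [sM gC _ xE]]]]].
  case: (boolP (u \in undup [seq weight mm al | al <- msupp f])); last first.
    exact: coef_sum_supp_weights.
  apply: (torus_characters_independent (R := R) (undup_uniq _)) => t tT.
  rewrite -sum_by_weight -(meval_torus _ tT); apply: vf.
  (* The factor [t (mu s)] undoes the trivialisation, leaving coordinates t(m_j). *)
  have [s sM] := exists_maxcone; exists s, t, (t (mu s)); split=> //.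
  - exact: (torus_chart_point _ tT).
  - exact: (torus_point_neq0 _ tT).
  - move=> j; rewrite /phi; have [_ tD] := (@torus_pointP R d K t).1 tT.
    by rewrite -tD addrC subrK.
rewrite (meval_eq _ xE) (meval_chart _ sM gC hf).
rewrite (sum_by_weight mm f (fun w => c ^+ e * g (w - mu s *+ e))).
by apply: big1 => u _; rewrite cs mul0r.
Qed.

(* The fixed point of the chart U_s only sees the monomials of weight e mu_s, so a
   fraction F / G representing chi^u there has a monomial of weight u + e mu_s. *)
Lemma dual_generated s u : s \in maxcones Sigma -> in_dual (@cone R d Sigma s) u ->
  exists be : 'I_r.+1 -> nat, u = \sum_j (mm j - mu s) *+ be j.
Proof.
move=> sM us; have [_ _ stalk] := D_very_ample.
have [e [F [G [hF hG Gnz FG]]]] := stalk s _ u sM (fixed_pointP sM) us.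
have csG : coef_sum mm G (mu s *+ e) != 0.
  move: Gnz; rewrite (_ : G.@[_] = G.@[fun j => 1 * phi D m s fixed_point j]); last first.
    by apply: meval_eq => j; rewrite mul1r.
  rewrite (meval_chart _ sM (fixed_pointP sM) hG) /coef_sum [in X in _ -> X]big_mkcond.
  congr (_ != 0); apply: eq_bigr => al _; rewrite expr1n mul1r /fixed_point subr_eq0.
  by case: eqP; rewrite ?mulr1 ?mulr0.
(* Both sides of chi^u G = F are combinations of characters from W, so their coefficients can be
   compared. *)
pose W := undup ([seq u + w | w <- undup [seq weight mm al | al <- msupp G]] ++
  undup [seq weight mm al | al <- msupp F]).
have E w0 : w0 \in W -> coef_sum mm G (w0 - u) - coef_sum mm F w0 = 0.
  apply: (torus_characters_independent (R := R) (c := fun w =>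
    coef_sum mm G (w - u) - coef_sum mm F w) (undup_uniq _)) => t tT.
  have [t0 tD] := (@torus_pointP R d K t).1 tT.
  have wide (s1 s2 : seq 'rV[int]_d) (h : 'rV[int]_d -> K) : uniq s1 -> uniq s2 ->
      {subset s1 <= s2} -> (forall w, w \notin s1 -> h w = 0) ->
      \sum_(w <- s1) h w = \sum_(w <- s2) h w.
    move=> u1 u2 sub h0; rewrite [RHS](bigID (fun w => w \in s1)) /=.
    rewrite [X in _ + X]big1 ?addr0; last first.
      by move=> w /h0.
    rewrite -[RHS]big_filter; apply: perm_big; apply: uniq_perm; rewrite ?filter_uniq //.
    by move=> w; rewrite mem_filter; case: (boolP (w \in s1)) => //= /sub.
  have := FG t tT; rewrite !(meval_torus _ tT) !sum_by_weight mulr_sumr => {}FG.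
  under eq_bigr do rewrite mulrBl; rewrite sumrB; apply/eqP; rewrite subr_eq0; apply/eqP.
  rewrite -(wide (undup [seq weight mm al | al <- msupp F]) W
    (fun w => coef_sum mm F w * t w) (undup_uniq _) (undup_uniq _)); first last.
  - by move=> w /coef_sum_supp_weights ->; rewrite mul0r.
  - by move=> w ws; rewrite mem_undup mem_cat ws orbT.
  rewrite -[RHS]FG.
  rewrite -(wide [seq u + w | w <- undup [seq weight mm al | al <- msupp G]] W
    (fun w => coef_sum mm G (w - u) * t w)); first last.
  - move=> w nw; rewrite coef_sum_supp_weights ?mul0r //; apply: contraNN nw => h.
    by apply/mapP; exists (w - u); rewrite // addrC subrK.
  - by move=> w ws; rewrite mem_undup mem_cat ws.
  - exact: undup_uniq.
  - by rewrite map_inj_uniq ?undup_uniq //; apply: addrI.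
  rewrite big_map; apply: eq_bigr => w _.
  by rewrite [u + w - u]addrC addKr tD mulrCA.
have : coef_sum mm F (u + mu s *+ e) != 0.
  case: (boolP (u + mu s *+ e \in W)) => [/E/eqP|nW].
    by rewrite subr_eq0 [u + _]addrC addrK => /eqP<-.
  case/eqP: csG; apply: coef_sum_supp_weights; apply: contraNN nW => h.
  by rewrite mem_undup mem_cat map_f.
case/coef_sum_supp => al alF wal; exists al.
have /(_ al alF) dal := dhomog_mf hF.
under eq_bigr do rewrite mulrnBl.
by rewrite sumrB -/(weight mm al) wal sumrMnr -mdegE dal addrK.
Qed.

End Toric.

Definition hvec (F : nzRingType) d (x : 'rV[F]_d) (y : F) : 'rV[F]_(d + 1) :=
  row_mx x (const_mx y).

Lemma dot_hvec (F : comNzRingType) d (x x' : 'rV[F]_d) (y y' : F) :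
  dot (hvec x y) (hvec x' y') = dot x x' + y * y'.
Proof. by rewrite dot_row_mx {2}/dot big_ord1 !mxE. Qed.

Lemma hvecP (F : nzRingType) d (l : 'rV[F]_(d + 1)) : exists x y, l = hvec x y.
Proof.
exists (lsubmx l), (l 0 (rshift d 0)); rewrite /hvec -[LHS]hsubmxK; congr row_mx.
by apply/rowP => k; rewrite !mxE (ord1 k).
Qed.

Lemma hvecD (F : nzRingType) d (x x' : 'rV[F]_d) y y' :
  hvec x y + hvec x' y' = hvec (x + x') (y + y').
Proof.
rewrite /hvec add_row_mx; congr row_mx.
by apply/rowP => k; rewrite !mxE.
Qed.

Lemma hvecZ (F : nzRingType) d (x : 'rV[F]_d) y c :
  c *: hvec x y = hvec (c *: x) (c * y).
Proof.
rewrite /hvec scale_row_mx; congr row_mx.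
by apply/rowP => k; rewrite !mxE.
Qed.

Lemma hvecN (F : nzRingType) d (x : 'rV[F]_d) y : - hvec x y = hvec (- x) (- y).
Proof. by rewrite -scaleN1r hvecZ scaleN1r mulN1r. Qed.

Lemma hvec0 (F : nzRingType) d : hvec (0 : 'rV[F]_d) 0 = 0.
Proof.
by rewrite /hvec (_ : const_mx 0 = 0) ?row_mx0 //; apply/rowP => k; rewrite !mxE.
Qed.

Lemma hvecMn (F : nzRingType) d (x : 'rV[F]_d) y k : hvec x y *+ k = hvec (x *+ k) (y *+ k).
Proof. by elim: k => [|k IH]; rewrite ?hvec0 // !mulrS IH hvecD. Qed.

Lemma hvec_inj (F : nzRingType) d (x x' : 'rV[F]_d) y y' :
  hvec x y = hvec x' y' -> x = x' /\ y = y'.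
Proof.
case/eq_row_mx => -> /rowP/(_ 0); rewrite !mxE => ->.
by [].
Qed.

Lemma hvec_sum (F : nzRingType) d (I : Type) (s : seq I) (P : pred I)
    (x : I -> 'rV[F]_d) (y : I -> F) :
  \sum_(i <- s | P i) hvec (x i) (y i) =
  hvec (\sum_(i <- s | P i) x i) (\sum_(i <- s | P i) y i).
Proof.
by elim/big_rec3: _ => [|i ? ? ? _ ->]; rewrite ?hvec0 // hvecD.
Qed.

Lemma map_hvec (F F' : nzRingType) (f : {rmorphism F -> F'}) d (x : 'rV[F]_d) y :
  map_mx f (hvec x y) = hvec (map_mx f x) (f y).
Proof. by rewrite /hvec map_row_mx map_const_mx. Qed.

(** * The real cone over P *)

Section Geometry.
Variables (R : realType) (K : closedFieldType) (d r : nat).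
Variables (Sigma : complete_fan R d) (D : cartier_divisor Sigma).
Variable m : r.+1.-tuple 'rV[int]_d.
Hypothesis m_basis : section_basis D m.
Hypothesis D_very_ample : very_ample K D m.
Implicit Types (u v : 'rV[int]_d) (s : {set 'I_(nrays Sigma)}) (i : 'I_(nrays Sigma))
  (V S : {set 'I_r.+1}).

Local Notation mm := (tnth m).
Local Notation mu := (local_data D).
Local Notation rho := (@ray R d Sigma).

(* The cone over the polytope P, cut out by the inequalities 0 <= height i u n. *)
Definition height i u (n : int) : int := dot u (rho i) + n * coeff D i.

Definition slack j i : int := height i (mm j) 1.

Definition gen j : 'rV[R]_(d + 1) := hvec (lat R (mm j)) 1.

Lemma heightD i u v n k : height i (u + v) (n + k) = height i u n + height i v k.
Proof. by rewrite /height dotDl mulrDl addrACA. Qed.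

Lemma heightN i u n : height i (- u) (- n) = - height i u n.
Proof. by rewrite /height dotNl mulNr opprD. Qed.

Lemma height0 i : height i 0 0 = 0.
Proof. by rewrite /height dot0l mul0r addr0. Qed.

Lemma height_sum i (I : Type) (t : seq I) (P : pred I) (x : I -> 'rV[int]_d) (y : I -> int) :
  height i (\sum_(j <- t | P j) x j) (\sum_(j <- t | P j) y j) =
  \sum_(j <- t | P j) height i (x j) (y j).
Proof.
by elim/big_rec3: _ => [|j ? ? ? _ <-]; rewrite ?height0 // heightD.
Qed.

Lemma heightM i u n k : height i (u *+ k) (n *+ k) = height i u n *+ k.
Proof. by rewrite /height mulrnDl mulrnAl dotC dotMnr dotC. Qed.

Definition facet_form i : 'rV[R]_(d + 1) := hvec (lat R (rho i)) (coeff D i)%:~R.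

Lemma dot_facet_form i u (n : int) :
  dot (facet_form i) (hvec (lat R u) n%:~R) = (height i u n)%:~R.
Proof.
by rewrite dot_hvec dotC -pairingE pairing_lat rmorphD /= intrM mulrC.
Qed.

Lemma slack_ge0 j i : 0 <= slack j i.
Proof. by rewrite /slack /height mul1r mm_slack. Qed.

Lemma dot_facet_gen i j : dot (facet_form i) (gen j) = (slack j i)%:~R.
Proof. by rewrite -dot_facet_form. Qed.

Lemma mu_height s i : s \in maxcones Sigma -> i \in s -> height i (mu s) 1 = 0.
Proof. by move=> sM iS; rewrite /height mu_ray // mul1r addNr. Qed.

Lemma ray_neq0 i : rho i != 0.
Proof.
apply/eqP => E; have := @ray_primitive _ _ Sigma i 2 0.
by rewrite scaler0 => /(_ E).
Qed.

(** For l = (x, y), completeness of the fan puts x in some cone s, so l is a nonnegative combination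
    of the facet forms of s up to a multiple of the last coordinate. As those forms vanish at (mu s,
    1), [k] is the value of l there. *)
Lemma functional_decomposition (l : 'rV[R]_(d + 1)) :
  exists s (c : 'I_(nrays Sigma) -> R) (k : R), [/\ s \in maxcones Sigma,
    forall i, 0 <= c i &
    forall x y, dot l (hvec x y) =
      \sum_(i in s) c i * dot (facet_form i) (hvec x y) + k * y].
Proof.
have [x [y ->]] := hvecP l; have [s sM [c c0 xE]] := fan_complete Sigma x.
exists s, c, (y - \sum_(i in s) c i * (coeff D i)%:~R); split=> // x' y'.
rewrite dot_hvec xE [dot _ x']dotC dot_sumr mulrBl mulr_suml.
rewrite [RHS]addrCA [LHS]addrC -sumrB; congr (_ + _).
by apply: eq_bigr => i _; rewrite dot_hvec dotZr [dot x' _]dotC; ring.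
Qed.

Definition vertex_set V := forall s, s \in maxcones Sigma -> exists2 j, j \in V & mm j = mu s.

Lemma vertex_setT : vertex_set setT.
Proof. by move=> s sM; have [j E] := mu_mm D_very_ample sM; exists j; rewrite ?inE. Qed.

(** Decompose a Farkas functional l over some s. Its value at the vertex of s gives k >= 0. If S is
    nonempty, vanishing on S forces k = 0 and leaves only facets through S; if S is empty, the term
    k y needs y >= 0. *)
Lemma local_cone_rays V S x y : vertex_set V -> S \subset V -> S != set0 \/ 0 <= y ->
    (forall i, (forall j, j \in S -> slack j i = 0) -> 0 <= dot (facet_form i) (hvec x y)) ->
  local_cone gen V S (hvec x y).
Proof.
move=> vV SV Sy H; have [//|[l [l0 lS lw]]] := farkas_local gen (hvec x y) SV.
have [s [c [k [sM c0 lE]]]] := functional_decomposition l.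
have genE j : dot l (gen j) = \sum_(i in s) c i * (slack j i)%:~R + k.
  by rewrite lE mulr1; congr (_ + _); apply: eq_bigr => i _; rewrite -dot_facet_gen.
have cs0 j i : 0 <= c i * (slack j i)%:~R by rewrite mulr_ge0 ?ler0z ?slack_ge0.
have k0 : 0 <= k.
  have [j jV jE] := vV s sM; have := l0 j jV.
  rewrite genE big1 ?add0r // => i iS.
  by rewrite /slack jE mu_height // mulr0.
have tight j : j \in S -> k = 0 /\ forall i, i \in s -> c i * (slack j i)%:~R = 0.
  move=> jS; have := lS j jS; rewrite genE => /eqP.
  have sum0 : 0 <= \sum_(i in s) c i * (slack j i)%:~R by rewrite sumr_ge0.
  rewrite paddr_eq0 // => /andP[]; rewrite psumr_eq0 // => /allP E /eqP->; split=> // i iS.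
  by have := E i (mem_index_enum _); rewrite iS => /eqP.
have : 0 <= dot l (hvec x y).
  rewrite lE addr_ge0 //; last first.
    case: Sy => [/set0Pn[j /tight[-> _]]|y0]; first by rewrite mul0r.
    exact: mulr_ge0.
  apply: sumr_ge0 => i iS; have [ci|ci] := eqVneq (c i) 0; first by rewrite ci mul0r.
  rewrite mulr_ge0 // H // => j jS; have [_ /(_ i iS)/eqP] := tight j jS.
  by rewrite mulf_eq0 (negbTE ci) /= intr_eq0 => /eqP.
by rewrite leNgt lw.
Qed.

(** Rational Farkas with target (0, 1): a relation sum c_i rho_i = 0 with sum c_i = 1 would put a
    line in the cone s, and a separating functional becomes v after clearing denominators. *)
Lemma dual_interior s : s \in maxcones Sigma ->
  exists v, forall i, i \in s -> 0 < dot v (rho i).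
Proof.
move=> sM.
pose g i := hvec (map_mx intr (rho i)) 1 : 'rV[rat]_(d + 1).
have [[c c0 E]|[l l0]] := farkas_seq g (hvec 0 1) (enum_uniq s).
  exfalso.
  move: E; under eq_bigr do rewrite /g hvecZ mulr1.
  rewrite hvec_sum big_enum => /hvec_inj[E0 /esym E1].
  rewrite big_enum /= in E1.
  have [i iS ci] : exists2 i, i \in s & c i != 0.
    apply/exists_inP; apply: contra_eqT E1 => /exists_inPn nz.
    rewrite big1 => [|i /nz]; first by rewrite eq_sym oner_eq0.
    by rewrite negbK => /eqP.
  pose x : 'rV[R]_d := ratr (c i) *: lat R (rho i).
  have x0 : x = 0.
    apply: (@maxcone_pointed _ _ Sigma s) => //.
      exists (fun j => (j == i)%:R * ratr (c j)) => [j|].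
        by rewrite mulr_ge0 ?ler0n ?ler0q.
      rewrite (bigD1 i) //= eqxx mul1r big1 ?addr0 // => j /andP[_ /negbTE->].
      by rewrite mul0r scale0r.
    exists (fun j => (j != i)%:R * ratr (c j)) => [j|].
      by rewrite mulr_ge0 ?ler0n ?ler0q.
    have {}E0 : \sum_(j in s) ratr (c j) *: lat R (rho j) = 0.
      apply/rowP => k; rewrite summxE mxE.
      have /rowP/(_ k) := E0; rewrite mxE summxE => /(congr1 (@ratr R)).
      rewrite rmorph0 rmorph_sum /= => E0k; rewrite [RHS]E0k; apply: eq_bigr => j _.
      by rewrite !mxE rmorphM /= ratr_int.
    move: E0; rewrite (bigD1 i) //= -/x => /eqP; rewrite addr_eq0 => /eqP->.
    rewrite opprK [RHS](bigD1 i) //= eqxx mul0r scale0r add0r.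
    by apply: eq_bigr => j /andP[_ ->]; rewrite mul1r.
  move/eqP: x0; rewrite scaler_eq0 fmorph_eq0 (negbTE ci) /= => /eqP E.
  case/eqP: (ray_neq0 i); apply/rowP => k; have /rowP/(_ k)/eqP := E.
  by rewrite !mxE intr_eq0 => /eqP.
have [x [y lE]] := hvecP l; rewrite lE dot_hvec dot0r add0r mulr1 => y0.
have xpos i : i \in s -> 0 < dot x (map_mx intr (rho i)).
  move=> iS; have := l0 i; rewrite mem_enum => /(_ iS).
  by rewrite lE dot_hvec mulr1 => h; apply: lt_le_trans (_ : 0 < - y) _; lra.
have [k [b [k0 bE]]] := rat_common_denominator (fun j => normr_ge0 (x 0 j)).
exists (\row_j (sgz (x 0 j) * (b j)%:Z)) => i /xpos xi.
rewrite -(ltr0z rat) -(dot_map (intr : {rmorphism int -> rat})).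
rewrite (_ : map_mx intr _ = k%:R *: x); last first.
  apply/rowP => j; rewrite !mxE rmorphM /= -pmulrn -bE mulrA -sgrEz -numEsg.
  exact: mulrC.
by rewrite dotZl mulr_gt0 // ltr0n.
Qed.

(** A form killing all (m_j, 1) kills all m_j - mu s, hence the lattice points of the dual of s;
    every lattice vector is a difference of two such points, since [v0] is interior. *)
Lemma gen_nondegenerate (l : 'rV[R]_(d + 1)) : (forall j, dot l (gen j) = 0) -> l = 0.
Proof.
have [x [y ->]] := hvecP l => H.
have E j : dot x (lat R (mm j)) = - y.
  by apply/eqP; rewrite -addr_eq0 -(H j) dot_hvec mulr1.
have [s sM] := exists_maxcone Sigma; have [v0 v0P] := dual_interior sM.
have ortho v : in_dual (@cone R d Sigma s) v -> dot x (lat R v) = 0.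
  case/(dual_generated m_basis D_very_ample sM) => be ->.
  rewrite /lat raddf_sum dot_sumr big1 // => j _.
  rewrite raddfMn dotMnr raddfB dotBr.
  by have [j' <-] := mu_mm D_very_ample sM; rewrite !E subrr mul0rn.
have v0d : in_dual (@cone R d Sigma s) v0 by apply/in_dualP => i /v0P/ltW.
have x0 : x = 0.
  apply/rowP => k; rewrite mxE -dot_delta.
  pose e : 'rV[int]_d := delta_mx 0 k.
  pose N := (\sum_i absz (dot e (rho i)))%N.
  have : in_dual (@cone R d Sigma s) (e + v0 *+ N).
    apply/in_dualP => i iS; rewrite dotC dotDr dotMnr ![dot (rho i) _]dotC -mulr_natr.
    have : (absz (dot e (rho i)) <= N)%N by rewrite /N (bigD1 i) //= leq_addr.
    by have := v0P i iS; nia.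
  move/ortho; rewrite /lat raddfD raddfMn dotDr dotMnr (ortho _ v0d) mul0rn addr0 => xe.
  by rewrite -[RHS]xe; congr dot; apply/rowP => q; rewrite !mxE; case: andP.
have := E ord0; rewrite x0 dot0l => /esym/eqP; rewrite oppr_eq0 => /eqP->.
exact: hvec0.
Qed.

Lemma gen_spanned z : spanned gen setT z.
Proof.
case: (farkas_local gen z (subxx setT)) => [[c _ E]|[l [_ l0 lz]]]; first by exists c.
have E : l = 0 by apply: gen_nondegenerate => j; apply: l0; rewrite inE.
by move: lz; rewrite E dot0l ltxx.
Qed.

Lemma gen_pointed V : pointed gen V.
Proof.
by exists (hvec 0 1) => j _; rewrite dot_hvec dot0l mul1r add0r ltr01.
Qed.

Lemma gen_rk : rk gen setT = d.+1.
Proof.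
rewrite /rk (_ : (\sum_(j in setT) <[gen j]>)%VS = fullv).
  by rewrite dimvf /dim /= mul1n addn1.
apply/eqP; rewrite eqEsubv subvf /=; apply/subvP => z _.
have [c ->] := gen_spanned z; apply/memv_sumP.
by exists (fun j => c j *: gen j) => // j _; rewrite memvZ ?memv_line.
Qed.

End Geometry.

Lemma mulrn_scale n (z : 'rV[int]_n) k : z *+ k = k%:Z *: z.
Proof. by rewrite -scaler_nat natz. Qed.

Lemma Posz_mulrn (k n : nat) : k%:Z *+ n = (k * n)%N%:Z.
Proof. by rewrite -mulr_natr natz. Qed.

Lemma Posz_sum (I : Type) (t : seq I) (P : pred I) (f : I -> nat) :
  (\sum_(i <- t | P i) f i)%N%:Z = \sum_(i <- t | P i) (f i)%:Z.
Proof. by rewrite -natz natr_sum; apply: eq_bigr => i _; rewrite natz. Qed.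

(** * Saturation of the localised semigroup *)

Section LatticeCone.
Variables (R : realType) (K : closedFieldType) (d r : nat).
Variables (Sigma : complete_fan R d) (D : cartier_divisor Sigma).
Variable m : r.+1.-tuple 'rV[int]_d.
Hypothesis m_basis : section_basis D m.
Hypothesis D_very_ample : very_ample K D m.
Implicit Types (u v : 'rV[int]_d) (s : {set 'I_(nrays Sigma)}) (i : 'I_(nrays Sigma))
  (V S : {set 'I_r.+1}) (z : 'rV[int]_(d + 1)).

Local Notation mm := (tnth m).
Local Notation mu := (local_data D).
Local Notation rho := (@ray R d Sigma).
Local Notation gen := (@gen R d r m).
Local Notation height := (height D).
Local Notation slack := (slack D m).
Local Notation facet_form := (facet_form D).

Definition zgen j : 'rV[int]_(d + 1) := hvec (mm j) 1.

(** The integral counterpart of [local_cone]: [lift] without a bound on the pole order. *)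
Definition lattice_cone S z := exists2 be : 'I_r.+1 -> int,
  forall j, j \notin S -> 0 <= be j & z = \sum_j be j *: zgen j.

Lemma lattice_cone0 S : lattice_cone S 0.
Proof.
by exists (fun=> 0) => [//|]; rewrite big1 // => j _; rewrite scale0r.
Qed.

Lemma lattice_coneD S z z' :
  lattice_cone S z -> lattice_cone S z' -> lattice_cone S (z + z').
Proof.
move=> [b b0 ->] [b' b'0 ->]; exists (fun j => b j + b' j) => [j jS|].
  by rewrite addr_ge0 ?b0 ?b'0.
by rewrite -big_split; apply: eq_bigr => j _; rewrite scalerDl.
Qed.

Lemma lattice_cone_sum S (I : eqType) (t : seq I) (P : pred I) (x : I -> 'rV[int]_(d + 1)) :
  (forall k, k \in t -> P k -> lattice_cone S (x k)) ->
  lattice_cone S (\sum_(k <- t | P k) x k).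
Proof.
move=> H; rewrite big_seq_cond; apply: (big_ind (lattice_cone S)).
- exact: lattice_cone0.
- exact: lattice_coneD.
- by move=> k /andP[]; apply: H.
Qed.

Lemma lattice_coneM S z k : lattice_cone S z -> lattice_cone S (z *+ k).
Proof.
move=> H; elim: k => [|k IH]; first exact: lattice_cone0.
by rewrite mulrS; apply: lattice_coneD.
Qed.

Lemma lattice_cone_gen S j : lattice_cone S (zgen j).
Proof.
exists (fun k => (k == j)%:R) => [k _|]; first by rewrite ler0n.
rewrite (bigD1 j) //= eqxx scale1r big1 ?addr0 // => k /negbTE->.
by rewrite scale0r.
Qed.

Lemma lattice_cone_opp S j : j \in S -> lattice_cone S (- zgen j).
Proof.
move=> jS; exists (fun k => - (k == j)%:R) => [k kS|].
  by case: eqVneq kS => [->|_ _]; rewrite ?jS // oppr0.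
rewrite (bigD1 j) //= eqxx scaleN1r big1 ?addr0 // => k /negbTE->.
by rewrite oppr0 scale0r.
Qed.

Lemma lift_lattice_cone n N S u : lift mm n N S u -> lattice_cone S (hvec u n).
Proof.
case=> al /laurent_mnmP[dal H] wal; exists (fun j => (al j)%:Z - N%:Z) => [j /H|].
  by rewrite subr_ge0 lez_nat.
under eq_bigr do rewrite hvecZ mulr1.
rewrite hvec_sum; congr hvec; last first.
  by rewrite sumrB sumr_const card_ord Posz_mulrn -Posz_sum -mdegE dal addrK.
apply: (addIr (weight mm (full_mnm r N))); rewrite -wal /weight -big_split /=.
by apply: eq_bigr => j _; rewrite mnmE !mulrn_scale -scalerDl subrK.
Qed.

Lemma lattice_cone_lift n S u : lattice_cone S (hvec u n) ->
  exists M, forall N, (M <= N)%N -> lift mm n N S u.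
Proof.
case=> be be0; under eq_bigr do rewrite hvecZ mulr1.
rewrite hvec_sum => /hvec_inj[uE nE].
exists (\sum_j absz (be j))%N => N le.
have ge0 j : 0 <= be j + N%:Z.
  have : (absz (be j) <= N)%N by apply: leq_trans le; rewrite (bigD1 j) //= leq_addr.
  by lia.
exists [multinom absz (be j + N%:Z)%R | j < r.+1].
  apply/laurent_mnmP; split=> [|j /be0 b0]; last by rewrite mnmE; lia.
  rewrite mdegE Posz_sum nE; under eq_bigr do rewrite mnmE gez0_abs ?ge0 //.
  by rewrite big_split /= sumr_const card_ord Posz_mulrn.
rewrite uE /weight -big_split /=; apply: eq_bigr => j _.
by rewrite !mnmE !mulrn_scale gez0_abs ?ge0 // scalerDl.
Qed.

Lemma gen_zgen j : gen j = map_mx intr (zgen j).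
Proof. by rewrite map_hvec. Qed.

Lemma map_lat u (n : int) : hvec (lat R u) n%:~R = map_mx intr (hvec u n).
Proof. by rewrite map_hvec. Qed.

Lemma lattice_cone_local S u n : lattice_cone S (hvec u n) ->
  local_cone gen setT S (hvec (lat R u) n%:~R).
Proof.
case=> be be0 E; exists (fun j => (be j)%:~R) => [j _ /be0|]; first by rewrite ler0z.
rewrite map_lat E raddf_sum; apply: eq_big => j; rewrite ?inE // => _.
by rewrite gen_zgen -map_mxZ.
Qed.

Lemma local_cone_height V S x y i : local_cone gen V S (hvec x y) ->
  (forall j, j \in S -> slack j i = 0) -> 0 <= dot (facet_form i) (hvec x y).
Proof.
move=> [c c0 ->] tight; rewrite dot_sumr sumr_ge0 // => j jV.
rewrite dotZr dot_facet_gen; case: (boolP (j \in S)) => [/tight->|jS].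
  by rewrite mulr0.
by rewrite mulr_ge0 ?c0 // ler0z; apply: slack_ge0 m_basis _ _.
Qed.

(* In the chart of the vertex mu s, u - n mu s lies in the dual of s. *)
Lemma vertex_decomposition s u n : s \in maxcones Sigma ->
  (forall i, i \in s -> 0 <= height i u n) ->
  exists (be : 'I_r.+1 -> nat), hvec u n =
    \sum_j zgen j *+ be j + (n - (\sum_j be j)%:Z) *: hvec (mu s) 1.
Proof.
move=> sM H; have : in_dual (@cone R d Sigma s) (u - n *: mu s).
  apply/in_dualP => i iS; rewrite dotBl dotZl (mu_ray D sM iS) mulrN opprK.
  exact: H.
case/(dual_generated m_basis D_very_ample sM) => be E; exists be.
rewrite (eq_bigr (fun j => hvec ((be j)%:Z *: mm j) (be j)%:Z)) => [|j _]; last first.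
  by rewrite mulrn_scale hvecZ mulr1.
rewrite hvec_sum hvecZ hvecD mulr1; congr hvec; last first.
  by rewrite -Posz_sum addrC subrK.
rewrite -[LHS](subrK (n *: mu s)) E.
have -> : \sum_j (mm j - mu s) *+ be j =
    \sum_j (be j)%:Z *: mm j - (\sum_j be j)%N%:Z *: mu s.
  rewrite (eq_bigr (fun j => (be j)%:Z *: mm j - mu s *+ be j)) => [|j _].
    by rewrite sumrB sumrMnr mulrn_scale.
  by rewrite -mulrn_scale mulrnBl.
by rewrite scalerBl addrAC addrA.
Qed.

(** The facets through S ([tight]) share a vertex mu s, and [sig], the sum over S, is positive on
    all others. So u plus a multiple of [sig] lies in the cone and decomposes in the chart of mu s,
    with an integer coefficient at the vertex. Its sign is harmless once minus the vertex is also in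
    the localised semigroup, which is [neg0]. *)
Lemma lattice_cone_of_local S u n : S != set0 ->
  local_cone gen setT S (hvec (lat R u) n%:~R) -> lattice_cone S (hvec u n).
Proof.
move=> S0 lc.
pose tight i := [forall j in S, slack j i == 0].
have tightP i : reflect (forall j, j \in S -> slack j i = 0) (tight i).
  by apply: (iffP forall_inP) => H j /H => [/eqP|->].
have hS i : tight i -> 0 <= height i u n.
  by move/tightP => ti; have := local_cone_height lc ti; rewrite dot_facet_form ler0z.
(* If s contains the sum of the tight rays, mu s minimises that sum on P; its value is at most that
   of m_j0, j0 in S, where all tight heights are 0. *)
have [s sM smu] : exists2 s, s \in maxcones Sigma & forall i, tight i -> height i (mu s) 1 = 0.
  have [s sM [c c0 xE]] := fan_complete Sigma (\sum_(i | tight i) lat R (rho i)).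
  exists s => // i ti; have [j0 jS] := set0Pn _ S0.
  have E (v : 'rV[int]_d) : dot (lat R v) (\sum_(i | tight i) lat R (rho i)) =
      (\sum_(i | tight i) dot v (rho i))%:~R.
    by rewrite dot_sumr rmorph_sum; apply: eq_bigr => k _; rewrite -pairingE pairing_lat.
  have le : \sum_(i | tight i) dot (mu s) (rho i) <= \sum_(i | tight i) dot (mm j0) (rho i).
    rewrite -subr_ge0 -(ler0z R) rmorphB /= -!E xE -dotBl dot_sumr.
    rewrite sumr_ge0 // => k ks; rewrite dotZr mulr_ge0 //.
    rewrite dotBl -!pairingE !pairing_lat -rmorphB ler0z /= (mu_ray D sM ks) opprK.
    exact: mm_slack.
  have ge k : 0 <= height k (mu s) 1.
    have [j <-] := mu_mm D_very_ample sM; exact: (slack_ge0 m_basis).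
  have : \sum_(k | tight k) height k (mu s) 1 == 0.
    rewrite eq_le sumr_ge0 ?andbT //.
    have E0 : \sum_(k | tight k) height k (mm j0) 1 = 0.
      by rewrite big1 // => k /tightP/(_ _ jS).
    by rewrite -[leRHS]E0 /height !big_split /= lerD2r.
  by rewrite psumr_eq0 // => /allP/(_ i (mem_index_enum _)); rewrite ti => /eqP.
have [j0 j0E] := mu_mm D_very_ample sM.
have j0z : zgen j0 = hvec (mu s) 1 by rewrite /zgen j0E.
pose sig := \sum_(j in S) zgen j.
have sigE : sig = hvec (\sum_(j in S) mm j) (#|S|%:Z).
  by rewrite /sig hvec_sum sumr_const natz.
have sig_pos i : ~~ tight i -> 0 < height i (\sum_(j in S) mm j) #|S|%:Z.
  rewrite -natz -sumr_const height_sum => nt; rewrite lt_def sumr_ge0 ?andbT; last first.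
    by move=> j _; apply: (slack_ge0 m_basis).
  apply: contra nt; rewrite psumr_eq0 => [/allP E|j _]; last exact: (slack_ge0 m_basis).
  by apply/forall_inP => j jS; have := E j (mem_index_enum _); rewrite jS.
have sig_ge0 i : 0 <= height i (\sum_(j in S) mm j) #|S|%:Z.
  by rewrite -natz -sumr_const height_sum sumr_ge0 // => j _; apply: (slack_ge0 m_basis).
(* Off the tight facets [sig] has integer height at least 1, so N above all absolute heights
   suffices. *)
have absorb (v : 'rV[int]_d) (k : int) : (forall i, tight i -> 0 <= height i v k) ->
    exists N : nat, (0 < N)%N /\ forall i,
      0 <= height i (v + (\sum_(j in S) mm j) *+ N) (k + #|S|%:Z *+ N).
  move=> H; exists (\sum_i absz (height i v k)).+1; split=> // i.
  rewrite heightD heightM; case: (boolP (tight i)) => [/H h|/sig_pos].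
    by rewrite addr_ge0 // mulrn_wge0.
  have : (absz (height i v k) <= \sum_i absz (height i v k))%N.
    by rewrite (bigD1 i) //= leq_addr.
  by rewrite -mulr_natr natz; nia.
have negS : lattice_cone S (- sig).
  by rewrite -sumrN; apply: lattice_cone_sum => j _; apply: lattice_cone_opp.
have neg0 : lattice_cone S (- zgen j0).
  have [|N [N0 HN]] := absorb (- mm j0) (-1).
    by move=> i ti; rewrite heightN j0E smu // oppr0.
  have : local_cone gen setT set0
     (hvec (lat R (- mm j0 + (\sum_(j in S) mm j) *+ N)) (-1 + #|S|%:Z *+ N)%:~R).
    apply: (local_cone_rays m_basis (vertex_setT D_very_ample)); rewrite ?sub0set //.
      right; rewrite ler0z -mulr_natr natz.
      have : (0 < #|S|)%N by rewrite card_gt0.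
      by nia.
    by move=> i _; rewrite dot_facet_form ler0z.
  case=> c c0; rewrite map_lat => E.
  have [j||k [b [k0 kE]]] := @integral_cone_multiple R _ _ zgen
      (hvec (- mm j0 + (\sum_(j in S) mm j) *+ N) (-1 + #|S|%:Z *+ N)) c.
  - by apply: c0; rewrite ?inE.
  - rewrite E; apply: eq_big => [j|j _]; first by rewrite inE.
    by rewrite gen_zgen.
  (* For w = - zgen j0 + N sig some k w is a nonnegative integral combination, and - zgen j0 = k w -
     N k sig + (k - 1) zgen j0. *)
  have -> : - zgen j0 = \sum_j zgen j *+ b j + (- sig) *+ (N * k) + zgen j0 *+ k.-1.
    rewrite -kE; have -> : hvec (- mm j0 + (\sum_(j in S) mm j) *+ N) (-1 + #|S|%:Z *+ N)
        = - zgen j0 + sig *+ N.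
      by rewrite sigE /zgen hvecN hvecMn hvecD.
    case: k k0 kE => // k _ _; rewrite mulrnDl -mulrnA [(- sig) *+ _]mulNrn addrK /=.
    by rewrite mulrS mulNrn subrK.
  apply: lattice_coneD; last exact/lattice_coneM/lattice_cone_gen.
  apply: lattice_coneD; last exact: lattice_coneM.
  by apply: lattice_cone_sum => j _ _; apply/lattice_coneM/lattice_cone_gen.
have [//|N [N0 HN]] := absorb u n.
have [be E] := @vertex_decomposition s _ _ sM (fun i _ => HN i).
have -> : hvec u n = \sum_j zgen j *+ be j +
  (n + #|S|%:Z *+ N - (\sum_j be j)%N%:Z) *: zgen j0 + (- sig) *+ N.
  by rewrite j0z -E sigE mulNrn hvecMn hvecN hvecD !addrK.
apply: lattice_coneD; last exact: lattice_coneM.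
apply: lattice_coneD.
  by apply: lattice_cone_sum => j _ _; apply/lattice_coneM/lattice_cone_gen.
case: (_ - _) => k; rewrite ?NegzE ?scaleNr -?scalerN -mulrn_scale; apply: lattice_coneM => //.
exact: lattice_cone_gen.
Qed.

End LatticeCone.

(** * Normality and interior points of multiples of P *)

Section Normality.
Variables (R : realType) (K : closedFieldType) (d r : nat).
Variables (Sigma : complete_fan R d) (D : cartier_divisor Sigma).
Variable m : r.+1.-tuple 'rV[int]_d.
Hypothesis m_basis : section_basis D m.
Hypothesis D_very_ample : very_ample K D m.
Implicit Types (u v : 'rV[int]_d) (s : {set 'I_(nrays Sigma)}) (i : 'I_(nrays Sigma))
  (V S T : {set 'I_r.+1}) (z : 'rV[int]_(d + 1)).

Local Notation mm := (tnth m).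
Local Notation mu := (local_data D).
Local Notation rho := (@ray R d Sigma).
Local Notation gen := (@gen R d r m).
Local Notation height := (height D).
Local Notation slack := (slack D m).
Local Notation facet_form := (facet_form D).
Local Notation P := (polytope_of D).
Local Notation lattice_cone := (lattice_cone m).
Local Notation zgen := (zgen m).

Definition in_cone u (n : int) := forall i, 0 <= height i u n.

Definition in_interior u (n : int) := forall i, 0 < height i u n.

Lemma dilate_polytope k x : (0 < k)%N ->
  dilate k P x <-> forall i, 0 <= dot x (lat R (rho i)) + k%:R * (coeff D i)%:~R.
Proof.
move=> k0; have kR : 0 < k%:R :> R by rewrite ltr0n.
split=> [[y Py ->] i|H].
  rewrite dotZl -mulrDr pmulr_rge0 //; have := Py i.
  by rewrite pairingE addrC -lerBlDl sub0r.
exists (k%:R^-1 *: x); last by rewrite scalerA divff ?gt_eqF // scale1r.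
move=> i; rewrite pairingE dotZl -(ler_pM2l kR) mulrA divff ?gt_eqF // mul1r.
by rewrite mulrN -subr_ge0 opprK H.
Qed.

Lemma height_real i u (k : nat) :
  (height i u k)%:~R = dot (lat R u) (lat R (rho i)) + k%:R * (coeff D i)%:~R :> R.
Proof. by rewrite -dot_facet_form dot_hvec dotC mulrC. Qed.

Lemma dilate_lat k u : (0 < k)%N -> dilate k P (lat R u) <-> in_cone u k.
Proof.
move=> k0; rewrite dilate_polytope //.
by split=> H i; have := H i; rewrite -height_real ler0z.
Qed.

(** Positive integer heights are at least 1, which leaves room for a cube whose size depends on the
    rays only. Conversely a small move along - rho_i inside the neighbourhood strictly lowers height
    i. *)
Lemma interior_dilate k u : (0 < k)%N ->
  interior (dilate k P) (lat R u) <-> in_interior u k.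
Proof.
move=> k0; pose a i := \sum_j `|(rho i 0 j)%:~R : R|.
have a0 i : 0 <= a i by rewrite sumr_ge0.
split=> [[e e0 H] i|H].
  pose t := e / (1 + a i).
  have t0 : 0 < t by rewrite divr_gt0 // ltr_wpDr.
  have : dilate k P (lat R u - t *: lat R (rho i)).
    apply: H => j; rewrite !mxE addrAC subrr sub0r normrN normrM gtr0_norm //.
    rewrite /t mulrAC ltr_pdivrMr ?ltr_wpDr // ltr_pM2l // ltr_pwDl //.
    by rewrite /a (bigD1 j) //= lerDl sumr_ge0.
  move/(dilate_polytope _ k0)/(_ i); rewrite dotBl dotZl addrAC -height_real subr_ge0 => le.
  rewrite -(ltr0z R) (lt_le_trans _ le) // mulr_gt0 // dot_gt0 //.
  apply: contraNneq (ray_neq0 i) => E; apply/eqP/rowP => j.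
  by have /rowP/(_ j)/eqP := E; rewrite !mxE intr_eq0 => /eqP.
pose b := 1 + \sum_i a i.
have b0 : 0 < b by rewrite ltr_pwDl // sumr_ge0.
exists b^-1 => [|y yu]; first by rewrite invr_gt0.
apply/(dilate_polytope _ k0) => i.
rewrite -[y](subrK (lat R u)) dotDl -addrA -height_real.
have : 1 <= (height i u k)%:~R :> R by rewrite ler1z -gtz0_ge1.
suff : `|dot (y - lat R u) (lat R (rho i))| <= 1 by rewrite ler_norml => /andP[]; lra.
apply: le_trans (ler_norm_sum _ _ _) _.
apply: (@le_trans _ _ (b^-1 * a i)).
  rewrite mulr_sumr; apply: ler_sum => j _; rewrite normrM !mxE ler_wpM2r //.
  by have := ltW (yu j); rewrite !mxE.
rewrite ler_pdivrMl // mulr1 /b (bigD1 i) //=.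
by rewrite addrCA lerDl addr_ge0 // sumr_ge0.
Qed.

Lemma has_interior_dilate k : (0 < k)%N ->
  has_interior_lattice_point (dilate k P) <-> exists u, in_interior u k.
Proof. by move=> k0; split=> -[u /(interior_dilate _ k0)]; exists u. Qed.

Lemma has_interior_polytope :
  has_interior_lattice_point P <-> has_interior_lattice_point (dilate 1 P).
Proof.
have E x : P x <-> dilate 1 P x.
  split=> [Px|[y Py ->]]; first by exists x; rewrite // scale1r.
  by rewrite scale1r.
by split=> -[u [e e0 H]]; exists u; exists e => // y /H/E.
Qed.

Lemma mu_cone s : s \in maxcones Sigma -> in_cone (mu s) 1.
Proof.
by move=> sM i; have [j <-] := mu_mm D_very_ample sM; apply: slack_ge0 m_basis _ _.
Qed.

Lemma in_interior_up u l k : (l <= k)%N -> in_interior u l -> exists v, in_interior v k.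
Proof.
move=> /subnKC <- iu; have [s sM] := exists_maxcone Sigma.
exists (u + mu s *+ (k - l)) => i.
rewrite PoszD -[(k - l)%N%:Z]natz heightD heightM ltr_wpDr //.
by rewrite mulrn_wge0 // mu_cone.
Qed.

Definition vertices := [set k | [exists s in maxcones Sigma, mm k == mu s]].

Lemma verticesP k :
  reflect (exists2 s, s \in maxcones Sigma & mm k = mu s) (k \in vertices).
Proof.
rewrite inE; apply: (iffP exists_inP) => -[s sM E]; exists s => //; exact/eqP.
Qed.

Lemma vertex_set_vertices : vertex_set D m vertices.
Proof.
move=> s sM; have [k kE] := mu_mm D_very_ample sM; exists k => //.
by apply/verticesP; exists s.
Qed.

(** The condition deg P <= j, uniform in both cases of [is_deg]: if P has an interior lattice point,
    k = 1 excludes every j < d. *)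
Definition hollow_upto j := forall k, (1 <= k <= d - j)%N ->
  ~ has_interior_lattice_point (dilate k P).

Lemma in_cone_local V u n : vertex_set D m V -> 0 <= n -> in_cone u n ->
  local_cone gen V set0 (hvec (lat R u) n%:~R).
Proof.
move=> vV n0 H; apply: (local_cone_rays m_basis vV); rewrite ?sub0set //.
  by right; rewrite ler0z.
by move=> i _; rewrite dot_facet_form ler0z.
Qed.

Lemma slack_not_all0 T i :
  (forall j, exists e : 'I_r.+1 -> R, gen j = \sum_(k in T) e k *: gen k) ->
  (forall j, j \in T -> slack j i = 0) -> False.
Proof.
move=> span T0; have : facet_form i = 0.
  apply: (gen_nondegenerate m_basis D_very_ample) => j; have [e ->] := span j.
  by rewrite dot_sumr big1 // => k kT; rewrite dotZr dot_facet_gen T0 // mulr0.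
rewrite -(hvec0 R d) => /hvec_inj[E _]; case/eqP: (ray_neq0 i); apply/rowP => k.
by have /rowP/(_ k)/eqP := E; rewrite !mxE intr_eq0 => /eqP.
Qed.

Lemma sum_gen_height T i : height i (\sum_(j in T) mm j) #|T|%:Z = \sum_(j in T) slack j i.
Proof. by rewrite -natz -sumr_const height_sum. Qed.

(* Write u as a nonnegative combination sum c_j m_j over affinely independent
   vertices; if all c_j < 1, then sum (1 - c_j) m_j is an interior lattice point
   of a multiple of P of height at most d - j. *)
Lemma cone_step j u : hollow_upto j -> in_cone u j.+1%:Z ->
  exists2 s, s \in maxcones Sigma & in_cone (u - mu s) j.
Proof.
move=> hollow uc; pose V := vertices.
have vV : vertex_set D m V := vertex_set_vertices.
have [c0 c0P E0] := in_cone_local vV (isT : 0 <= j.+1%:Z) uc.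
have [|B [c [BV iB cP E]]] := caratheodory (c := c0) _ E0.
  by move=> k kV; apply: c0P => //; rewrite in_set0.
(* No facet contains a spanning set C; this makes the heights in [zint] strictly positive. *)
have [C [BC CV iC Cspan]] := indep_extend iB BV.
have spanC k : exists e : 'I_r.+1 -> R, gen k = \sum_(k in C) e k *: gen k.
  have : local_cone gen V set0 (gen k).
    have := @in_cone_local V (mm k) 1 vV isT; apply=> i.
    exact: (slack_ge0 m_basis).
  case=> f _ ->; have /choice[g gE] : forall l, exists e : 'I_r.+1 -> R,
      l \in V -> gen l = \sum_(k in C) e k *: gen k.
    move=> l; case: (boolP (l \in V)) => [/Cspan[e eE]|_]; first by exists e.
    by exists (fun=> 0).
  exists (fun k => \sum_(l in V) f l * g l k).
  under [RHS]eq_bigr do rewrite scaler_suml.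
  rewrite exchange_big; apply: eq_bigr => l lV; rewrite {1}(gE l lV) scaler_sumr.
  by apply: eq_bigr => q _; rewrite scalerA.
pose c' k := if k \in B then c k else 0.
have c'0 k : 0 <= c' k by rewrite /c'; case: ifP => // /cP.
have {}E : hvec (lat R u) (j.+1%:Z)%:~R = \sum_(k in C) c' k *: gen k.
  rewrite E [RHS](big_setID B) /= (setIidPr BC) [X in _ = _ + X]big1 ?addr0.
    by apply: eq_bigr => k kB; rewrite /c' kB.
  by move=> k /setDP[_ /negbTE kB]; rewrite /c' kB scale0r.
case: (EM (exists2 k, k \in C & 1 <= c' k)) => [[k kC c1]|small].
  have [s sM kE] := verticesP _ (subsetP CV k kC).
  exists s => // i; rewrite -kE -(ler0z R) -dot_facet_form.
  have -> : hvec (lat R (u - mm k)) j%:Z%:~R = hvec (lat R u) j.+1%:Z%:~R - gen k.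
    rewrite hvecN hvecD /lat raddfB; congr hvec.
    by rewrite -addn1 PoszD rmorphD /= addrK.
  rewrite E dotBr (bigD1 k) //= dotDr addrAC dotZr addr_ge0 //.
    rewrite -{2}[dot _ (gen k)]mul1r -mulrBl mulr_ge0 ?subr_ge0 //.
    by rewrite dot_facet_gen ler0z (slack_ge0 m_basis).
  rewrite dot_sumr sumr_ge0 // => l _; rewrite dotZr mulr_ge0 //.
  by rewrite dot_facet_gen ler0z (slack_ge0 m_basis).
have {}small k : k \in C -> 0 < 1 - c' k.
  by move=> kC; rewrite subr_gt0 ltNge; apply/negP => c1; apply: small; exists k.
have zE : hvec (lat R (\sum_(k in C) mm k - u)) (#|C|%:Z - j.+1%:Z)%:~R =
    \sum_(k in C) (1 - c' k) *: gen k.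
  under [RHS]eq_bigr do rewrite scalerBl scale1r.
  rewrite sumrB -E hvec_sum hvecN hvecD /lat raddfB raddf_sum sumr_const.
  by rewrite rmorphB.
have zint : in_interior (\sum_(k in C) mm k - u) (#|C|%:Z - j.+1%:Z).
  move=> i; rewrite -(ltr0z R) -dot_facet_form zE dot_sumr.
  have nn k : k \in C -> 0 <= dot (facet_form i) ((1 - c' k) *: gen k).
    move=> kC; rewrite dotZr mulr_ge0 ?(ltW (small k kC)) //.
    by rewrite dot_facet_gen ler0z (slack_ge0 m_basis).
  rewrite lt_def sumr_ge0 // andbT psumr_eq0 //; apply/negP => /allP E1.
  apply: (slack_not_all0 (i := i) spanC) => k kC.
  have := E1 k (mem_index_enum _); rewrite kC /= dotZr mulf_eq0 gt_eqF ?small //=.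
  by rewrite dot_facet_gen intr_eq0 => /eqP.
have C0 : (0 < #|C|)%N.
  rewrite card_gt0; apply/negP => /eqP C0; move: E; rewrite C0 big_set0 -(hvec0 R d).
  by case/hvec_inj => _ /eqP; rewrite intr_eq0.
have hC : (j.+1 < #|C|)%N.
  rewrite -ltz_nat -subr_gt0 -(ltr0z R).
  have := congr1 (dot (hvec 0 1)) zE; rewrite dot_hvec dot0l mul1r add0r => ->.
  have [k kC] := card_gt0P C0.
  rewrite dot_sumr (bigD1 k) //= !dotZr !dot_hvec dot0l mul1r add0r mulr1.
  rewrite ltr_pwDl ?small // sumr_ge0 // => l /andP[lC _].
  by rewrite dotZr dot_hvec dot0l mul1r add0r mulr1 ltW ?small.
have Cd : (#|C| <= d + 1)%N := indep_card iC.
(* This height is positive by [hC] and at most d - j, since C has at most d + 1 elements. *)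
case: (hollow (#|C| - j.+1)%N); first by lia.
apply/has_interior_dilate; first by lia.
by exists (\sum_(k in C) mm k - u); rewrite -subzn // ltnW.
Qed.

End Normality.

Lemma exists_least (Q : nat -> Prop) : (exists n, Q n) ->
  exists n, Q n /\ forall k, Q k -> (n <= k)%N.
Proof.
move=> exQ; have exb : exists n, `[< Q n >] by have [n Qn] := exQ; exists n; apply/asboolP.
case: (ex_minnP exb) => n /asboolP Qn min; exists n; split=> // k Qk.
by apply: min; apply/asboolP.
Qed.

(** * Propagation of normality, existence of k_P and deg P *)

Section KNormality.
Variables (R : realType) (K : closedFieldType) (d r : nat).
Variables (Sigma : complete_fan R d) (D : cartier_divisor Sigma).
Variable m : r.+1.-tuple 'rV[int]_d.
Hypothesis m_basis : section_basis D m.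
Hypothesis D_very_ample : very_ample K D m.
Implicit Types (u v : 'rV[int]_d) (s : {set 'I_(nrays Sigma)}) (i : 'I_(nrays Sigma))
  (V S T : {set 'I_r.+1}) (z : 'rV[int]_(d + 1)).

Local Notation mm := (tnth m).
Local Notation mu := (local_data D).
Local Notation rho := (@ray R d Sigma).
Local Notation gen := (@gen R d r m).
Local Notation height := (height D).
Local Notation slack := (slack D m).
Local Notation P := (polytope_of D).
Local Notation lattice_cone := (lattice_cone m).
Local Notation zgen := (zgen m).
Local Notation in_cone := (in_cone D).
Local Notation in_interior := (in_interior D).
Local Notation hollow_upto := (hollow_upto D).

Lemma lattice_cone_mu s : s \in maxcones Sigma -> lattice_cone set0 (hvec (mu s) 1).
Proof.
by move=> sM; have [j <-] := mu_mm D_very_ample sM; apply: lattice_cone_gen.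
Qed.

Lemma k_normalP k : (0 < k)%N ->
  k_normal P k <-> forall u, in_cone u k -> lattice_cone set0 (hvec u k%:Z).
Proof.
move=> k0; split=> H u.
  move/(dilate_lat D _ k0)/H => [t tP ->].
  have -> : k%:Z = \sum_(v <- t) 1.
    by rewrite big_const_seq count_predT size_tuple iter_addr_0 natz.
  rewrite -hvec_sum; apply: lattice_cone_sum => v /tP Pv _.
  have [j <-] := mmP m_basis ((polytope_lat D v).1 Pv).
  exact: lattice_cone_gen.
move/(dilate_lat D _ k0)/H => [be be0]; under eq_bigr do rewrite hvecZ mulr1.
rewrite hvec_sum => /hvec_inj[uE kE].
pose t := flatten [seq nseq (absz (be j)) (mm j) | j <- enum 'I_r.+1].
have bE j : be j = (absz (be j))%:Z by rewrite gez0_abs // be0 ?inE.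
have st : size t == k.
  rewrite size_flatten /shape -map_comp sumnE big_map big_enum /= -eqz_nat Posz_sum kE.
  by apply/eqP/eq_bigr => j _; rewrite size_nseq -bE.
exists (Tuple st) => [v|] /=.
  move=> /flattenP[w /mapP[j _ ->]]; rewrite mem_nseq => /andP[_ /eqP->].
  by apply/polytope_lat => i; apply: mm_slack.
rewrite big_flatten big_map big_enum uE; apply: eq_bigr => j _ /=.
by rewrite big_nseq iter_addr_0 mulrn_scale -bE.
Qed.

Lemma k_normalS j : (0 < j)%N -> hollow_upto j -> k_normal P j -> k_normal P j.+1.
Proof.
move=> j0 hol /(k_normalP j0) nj; apply/k_normalP => // u uc.
have [s sM /nj lc] := cone_step m_basis D_very_ample hol uc.
have -> : hvec u j.+1%:Z = hvec (u - mu s) j%:Z + hvec (mu s) 1.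
  by rewrite hvecD subrK -[j.+1]addn1 PoszD.
by apply: lattice_coneD => //; apply: lattice_cone_mu.
Qed.

Lemma hollow_uptoW j k : (j <= k)%N -> hollow_upto j -> hollow_upto k.
Proof. by move=> jk H l ld; apply: H; lia. Qed.

Lemma k_normal_from j : (0 < j)%N -> hollow_upto j -> k_normal P j ->
  forall l, (j <= l)%N -> k_normal P l.
Proof.
move=> j0 hol nj l /subnKC <-; elim: (l - j)%N => [|p IH]; first by rewrite addn0.
rewrite addnS; apply: k_normalS => //; first by rewrite addn_gt0 j0.
exact: hollow_uptoW (leq_addr _ _) hol.
Qed.

(** [hollow_upto k] is vacuous for k >= d, so [cone_step] splits off vertices down to height d. *)
Lemma cone_decomposition p u : in_cone u (d + p)%N ->
  exists v (nu : {set 'I_(nrays Sigma)} -> nat), [/\ in_cone v d,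
    (\sum_(s in maxcones Sigma) nu s)%N = p &
    u = v + \sum_(s in maxcones Sigma) mu s *+ nu s].
Proof.
elim: p u => [|p IH] u uc.
  exists u, (fun=> 0%N); rewrite addn0 in uc; split=> //; first by rewrite big1.
  by rewrite big1 ?addr0 // => s _; rewrite mulr0n.
rewrite addnS in uc.
have [|s sM /IH[v [nu [vc nup uE]]]] := cone_step m_basis D_very_ample _ uc.
  by move=> k; lia.
exists v, (fun t => (t == s) + nu t)%N; split=> //.
  rewrite big_split /= nup (bigD1 s) //= eqxx big1 ?addn0 ?add1n // => t /andP[_ /negbTE->].
  by [].
under eq_bigr do rewrite mulrnDr.
rewrite big_split /= (bigD1 s) //= eqxx mulr1n big1 => [|t /andP[_ /negbTE->]]; last first.
  by rewrite mulr0n.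
by rewrite addr0 addrCA -uE addrC subrK.
Qed.

Lemma in_cone_bounded n : exists B : nat, forall v, in_cone v n%:Z ->
  forall k, (absz (v 0%R k) <= B)%N.
Proof.
pose b k := (\sum_j absz (mm j 0%R k))%N.
exists (n * \sum_k b k)%N => v vc k.
have := in_cone_local m_basis (vertex_setT D_very_ample) (isT : 0 <= n%:Z) vc.
have sumE (c : 'I_r.+1 -> R) : \sum_(j in setT) c j *: gen j =
    hvec (\sum_(j in setT) c j *: lat R (mm j)) (\sum_(j in setT) c j).
  by rewrite -hvec_sum; apply: eq_bigr => j _; rewrite hvecZ mulr1.
case=> c c0; rewrite sumE => /hvec_inj[vE nE].
have {}c0 j : 0 <= c j by apply: c0; rewrite ?inE.
have cn j : c j <= n%:R.
  by rewrite [n%:R]nE (bigD1 j) ?inE //= lerDl sumr_ge0.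
have : `|(v 0 k)%:~R : R| <= n%:R * (b k)%:R.
  have := congr1 (fun x : 'rV[R]_d => x 0 k) vE; rewrite mxE summxE => ->.
  apply: le_trans (ler_norm_sum _ _ _) _.
  rewrite natr_sum mulr_sumr big_mkcond; apply: ler_sum => j _; rewrite inE.
  by rewrite !mxE normrM (ger0_norm (c0 j)) natr_absz intr_norm ler_wpM2r.
rewrite -intr_norm -natr_absz -natrM ler_nat => /leq_trans; apply.
by rewrite leq_mul2l (bigD1 k) //= leq_addr orbT.
Qed.

Lemma eventually_vertex_multiple s v n : s \in maxcones Sigma -> in_cone v n%:Z ->
  exists M, forall N, (M <= N)%N -> lattice_cone set0 (hvec (v + mu s *+ N) (n + N)%N).
Proof.
move=> sM vc.
have [be E] := vertex_decomposition m_basis D_very_ample sM (fun i _ => vc i).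
exists (\sum_j be j)%N => N le.
have -> : hvec (v + mu s *+ N) (n + N)%N =
    \sum_j zgen j *+ be j + hvec (mu s) 1 *+ (n + N - \sum_j be j).
  have -> : hvec (v + mu s *+ N) (n + N)%N = hvec v n + hvec (mu s) 1 *+ N.
    by rewrite hvecMn hvecD natz PoszD.
  rewrite E -addrA; congr (_ + _); rewrite !mulrn_scale -scalerDl; congr (_ *: _).
  by lia.
apply: lattice_coneD; last exact/lattice_coneM/lattice_cone_mu.
by apply: lattice_cone_sum => j _ _; apply/lattice_coneM/lattice_cone_gen.
Qed.

(** As dP has finitely many lattice points, one M works in [eventually_vertex_multiple] for all of
    them and all cones. Once more than #|maxcones| M vertices are split off, some cone accounts for
    at least M of them. *)
Lemma eventually_k_normal : exists M, (0 < M)%N /\ forall k, (M <= k)%N -> k_normal P k.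
Proof.
have [B HB] := in_cone_bounded d.
pose vec (f : {ffun 'I_d -> 'I_(B + B).+1}) : 'rV[int]_d := \row_k ((f k)%:Z - B%:Z).
have vecP v : in_cone v d -> exists f, v = vec f.
  move=> /HB vB; exists [ffun k => inord (absz (v 0 k + B%:Z)%R)].
  apply/rowP => k; rewrite !mxE ffunE; have := vB k => le.
  by rewrite inordK; lia.
have [|M HM] := @eventually_forall_seq _
  (enum {: {ffun 'I_d -> 'I_(B + B).+1} * {set 'I_(nrays Sigma)}})
  (fun p N => p.2 \in maxcones Sigma -> in_cone (vec p.1) d ->
    lattice_cone set0 (hvec (vec p.1 + mu p.2 *+ N) (d + N)%N)).
  move=> [f s] _ /=; case: (EM (s \in maxcones Sigma /\ in_cone (vec f) d)) => [[sM vc]|no].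
    by have [M HM] := eventually_vertex_multiple sM vc; exists M => N /HM.
  by exists 0%N => N _ sM vc; case: no.
exists (d + (#|maxcones Sigma| * M).+1)%N; split=> [|k]; first by rewrite addnS.
move=> /subnKC <-; set q := (k - _)%N; apply/k_normalP; first by rewrite addnS.
move=> u; rewrite -addnA => /cone_decomposition[v [nu [vc nup uE]]].
have [s sM sN] : exists2 s, s \in maxcones Sigma & (M <= nu s)%N.
  apply/exists_inP; apply: contra_eqT nup => /exists_inPn small.
  rewrite neq_ltn; apply/orP; left; rewrite addSn ltnS.
  apply: leq_trans (leq_addr _ _); rewrite -sum_nat_const; apply: leq_sum => s sM.
  by rewrite ltnW // ltnNge small.
have [f vE] := vecP v vc.
have lc : lattice_cone set0 (hvec (v + mu s *+ nu s) (d + nu s)%N).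
  by rewrite vE; apply: (HM _ sN (f, s)); rewrite ?mem_enum // -vE.
have -> : hvec u (d + ((#|maxcones Sigma| * M).+1 + q))%N =
    hvec (v + mu s *+ nu s) (d + nu s)%N +
    \sum_(t in maxcones Sigma | t != s) hvec (mu t) 1 *+ nu t.
  under eq_bigr do rewrite hvecMn natz.
  rewrite hvec_sum hvecD uE -nup !PoszD Posz_sum; congr hvec.
    by rewrite (bigD1 s) //= addrA.
  by rewrite [in LHS](bigD1 s) //= addrA.
apply: lattice_coneD => //; apply: lattice_cone_sum => t _ /andP[tM _].
exact/lattice_coneM/lattice_cone_mu.
Qed.

Lemma exists_kP : exists k, is_kP P k.
Proof.
have [M [M0 HM]] := eventually_k_normal.
have [|k [H1 H2]] := @exists_least
  (fun j => (0 < j)%N /\ forall l, (j <= l)%N -> k_normal P l).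
  by exists M.
by exists k.
Qed.

Lemma exists_deg : exists e, [/\ is_deg P e, hollow_upto e &
  forall j, hollow_upto j -> (e <= j)%N].
Proof.
have hd : hollow_upto d by move=> k; lia.
have [|e [He emin]] := @exists_least hollow_upto; first by exists d.
exists e; split=> //; split=> [hint|_]; last by split.
have ed := emin d hd.
apply/eqP; rewrite eqn_leq ed /= leqNgt; apply/negP => lt.
by apply: (He 1%N); [lia | apply/has_interior_polytope].
Qed.

Lemma gen_row_full : row_full (\matrix_j gen j).
Proof.
rewrite -col_leq_rank -mxrank_tr -[X in (X <= _)%N]/(d + 1)%N.
suff : row_free (\matrix_j gen j)^T by rewrite /row_free => /eqP->.
apply: inj_row_free => v vM; apply: (gen_nondegenerate m_basis D_very_ample) => j.
have /rowP/(_ j) := vM; rewrite !mxE => E; rewrite -[RHS]E.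
by apply: eq_bigr => k _; rewrite !mxE.
Qed.

(* Radon's trick: an affine dependence among d + 2 of the m_j yields two index
   sets, one of cardinality at most d, that are contained in no facet. *)
Lemma exists_low_interior : (d < r)%N ->
  exists l u, (0 < l <= d)%N /\ in_interior u l%:Z.
Proof.
move=> dr.
have [|C [_ _ iC Cspan']] := @indep_extend _ _ _ gen set0 setT _ (sub0set _).
  by move=> e _ i; rewrite inE.
have Cspan j : exists e : 'I_r.+1 -> R, gen j = \sum_(k in C) e k *: gen k.
  by apply: Cspan'; rewrite inE.
have Cd : (#|C| <= d + 1)%N := indep_card iC.
have [e eC] : exists e, e \notin C.
  apply/existsP; apply: contraTT dr => /existsPn H; rewrite -leqNgt.
  have CT : C = setT by apply/setP => j; rewrite inE; apply/negbNE/H.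
  by move: Cd; rewrite CT cardsT card_ord; lia.
have [be beE] := Cspan e.
have slackE i : (slack e i)%:~R = \sum_(k in C) be k * (slack k i)%:~R :> R.
  rewrite -dot_facet_gen beE dot_sumr; apply: eq_bigr => k _.
  by rewrite dotZr dot_facet_gen.
have sum1 : \sum_(k in C) be k = 1.
  have := congr1 (dot (hvec 0 1)) beE; rewrite dot_hvec dot0l mul1r add0r => ->.
  by rewrite dot_sumr; apply: eq_bigr => k _; rewrite dotZr dot_hvec dot0l mul1r add0r mulr1.
have s0 k i : 0 <= (slack k i)%:~R :> R by rewrite ler0z (slack_ge0 m_basis).
have goal (T : {set 'I_r.+1}) : (0 < #|T| <= d)%N ->
    (forall i, (forall j, j \in T -> slack j i = 0) -> forall j, j \in C -> slack j i = 0) ->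
    exists l u, (0 < l <= d)%N /\ in_interior u l%:Z.
  move=> cT H; exists #|T|, (\sum_(j in T) mm j); split=> // i.
  rewrite sum_gen_height lt_def sumr_ge0 ?andbT => [|j _]; last exact: (slack_ge0 m_basis).
  apply/negP => E; apply: (slack_not_all0 m_basis D_very_ample Cspan (i := i)).
  apply: H => j jT.
  move: E; rewrite psumr_eq0 => [/allP/(_ j (mem_index_enum _))|k _].
    by rewrite jT => /eqP.
  exact: (slack_ge0 m_basis).
have pos_ex : exists2 k, k \in C & 0 < be k.
  apply/exists_inP; apply: contra_eqT sum1 => /exists_inPn H.
  rewrite lt_eqF // (le_lt_trans _ ltr01) // sumr_le0 // => k /H.
  by rewrite -leNgt.
have [k0 k0C k0pos] := pos_ex.
have zeroP (a : R) (n : int) : a * n%:~R = 0 -> a != 0 -> n = 0.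
  by move=> /eqP; rewrite mulf_eq0 => /orP[->//|]; rewrite intr_eq0 => /eqP.
case: (boolP [exists k in C, be k < 0]) => [/exists_inP[k1 k1C k1neg]|/exists_inPn nneg].
  (* On a facet through these indices the slack of e is a sum of nonpositive terms, yet nonnegative,
     so every term vanishes. *)
  apply: (goal [set k in C | 0 <= be k]).
    apply/andP; split; first by apply/card_gt0P; exists k0; rewrite inE k0C ltW.
    have : (#|[set k in C | (0 <= be k)%R]| < #|C|)%N.
      apply: proper_card; apply/properP; split.
        by apply/subsetP => k; rewrite inE => /andP[].
      by exists k1 => //; rewrite inE k1C /= -ltNge.
    by move/leq_trans/(_ Cd); rewrite addn1 ltnS.
  move=> i T0 j jC; case: (lerP 0 (be j)) => [bj|bj]; first by apply: T0; rewrite inE jC.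
  have nonpos k : k \in C -> be k * (slack k i)%:~R <= 0.
    move=> kC; case: (lerP 0 (be k)) => bk; last by rewrite mulr_le0_ge0 // ltW.
    by rewrite T0 ?mulr0 // inE kC.
  apply: (zeroP (be j)); last by rewrite lt_eqF.
  apply/eqP; rewrite eq_le nonpos //=.
  have := s0 e i; rewrite slackE (bigD1 j) //= => h; apply: le_trans h _.
  rewrite gerDl; apply: sumr_le0 => k /andP[kC _]; exact: nonpos.
have {}nneg k : k \in C -> 0 <= be k by move/nneg; rewrite -leNgt.
(* With a single positive coefficient, [sum1] would make m_e equal to m_k0, although e is not in
   C. *)
have [k1 k1C /andP[k1pos k10]] : exists2 k, k \in C & (0 < be k) && (k != k0).
  apply/exists_inP; apply: contraNT eC => /exists_inPn H.
  have z k : k \in C -> k != k0 -> be k = 0.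
    move=> kC kk; have := H k kC; rewrite kk andbT -leNgt => le.
    by apply/eqP; rewrite eq_le le nneg.
  have b1 : be k0 = 1.
    move: sum1; rewrite (bigD1 k0) //= big1 ?addr0 // => k /andP[kC kk].
    exact: z.
  have : gen e = gen k0.
    rewrite beE (bigD1 k0) //= b1 scale1r big1 ?addr0 // => k /andP[kC kk].
    by rewrite z // scale0r.
  case/hvec_inj => E _; suff -> : e = k0 by [].
  apply: (mm_inj m_basis); apply/rowP => q.
  by have /rowP/(_ q)/eqP := E; rewrite !mxE eqr_int => /eqP.
(* On a facet through e the nonnegative terms sum to 0, so indices with positive coefficient lie on
   it too. Two of these are left out, whence the size is at most 1 + (d + 1) - 2. *)
apply: (goal (e |: [set k in C | be k == 0])).
  rewrite cardsU1 inE (negbTE eC) /= add1n /=.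
  have sub : [set k in C | be k == 0] \subset C :\ k0 :\ k1.
    apply/subsetP => k; rewrite !inE => /andP[kC /eqP bk]; rewrite kC andbT.
    apply/andP; split; apply/eqP => kk.
      by move: k1pos; rewrite -kk bk ltxx.
    by move: k0pos; rewrite -kk bk ltxx.
  apply: leq_ltn_trans (subset_leq_card sub) _; move: Cd.
  by rewrite (cardsD1 k0 C) k0C (cardsD1 k1 (C :\ k0)) !inE k10 k1C addn1 !ltnS.
move=> i T0 j jC; have [bj|bj] := eqVneq (be j) 0.
  by apply: T0; rewrite !inE jC bj eqxx orbT.
apply: (zeroP (be j)) => //.
have : \sum_(k in C) be k * (slack k i)%:~R == 0 :> R.
  by rewrite -slackE T0 // setU11.
rewrite psumr_eq0 => [/allP/(_ j (mem_index_enum _))|k kC].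
  by rewrite jC => /eqP.
by rewrite mulr_ge0 ?nneg.
Qed.

End KNormality.

(** * Regularity of the ideal sheaf *)

Section Regularity.
Variables (R : realType) (K : closedFieldType) (d r : nat).
Variables (Sigma : complete_fan R d) (D : cartier_divisor Sigma).
Variable m : r.+1.-tuple 'rV[int]_d.
Hypothesis m_basis : section_basis D m.
Hypothesis D_very_ample : very_ample K D m.
Implicit Types (u v : 'rV[int]_d) (s : {set 'I_(nrays Sigma)})
  (S T : {set 'I_r.+1}) (n : int).

Local Notation mm := (tnth m).
Local Notation mu := (local_data D).
Local Notation rho := (@ray R d Sigma).
Local Notation gen := (@gen R d r m).
Local Notation height := (height D).
Local Notation slack := (slack D m).
Local Notation facet_form := (facet_form D).
Local Notation P := (polytope_of D).
Local Notation X := (embedded_variety (K := K) D m).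
Local Notation lattice_cone := (lattice_cone m).
Local Notation in_cone := (in_cone D).
Local Notation in_interior := (in_interior D).
Local Notation hollow_upto := (hollow_upto D).

Lemma gen_row_free : (r <= d)%N -> indep gen setT.
Proof.
move=> rd e E j _; have full := gen_row_full m_basis D_very_ample.
have free : row_free (\matrix_j gen j).
  rewrite /row_free eqn_leq rank_leq_row /=; move/eqP: full => ->.
  by rewrite addn1 ltnS.
have : \row_j e j = 0.
  apply: (row_free_inj free); rewrite mul0mx mulmx_sum_row -[RHS]E.
  by apply: eq_big => [k|k _]; rewrite ?inE // rowK mxE.
by move/rowP/(_ j); rewrite !mxE.
Qed.

(* If there were only d + 1 lattice points, P would be a unimodular simplex and
   every point of P^r would lie in the image of X. *)
Lemma proper_codim : proper_subvariety X -> (d < r)%N.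
Proof.
move=> [x [j0 xj0] nX]; rewrite ltnNge; apply/negP => rd; apply: nX.
have ind := gen_row_free rd.
pose V := vertices D m.
have vV : vertex_set D m V := vertex_set_vertices D_very_ample.
(* The generators being independent, gen j0 is no combination of the others, while the vertices
   generate the cone. *)
have /verticesP[s sM sE] : j0 \in V.
  have lc : local_cone gen V set0 (gen j0).
    have := @in_cone_local _ _ _ _ _ _ m_basis V (mm j0) 1 vV isT; apply=> i.
    exact: (slack_ge0 m_basis).
  case: (boolP (j0 \in V)) => // nV; exfalso; have [c _ E] := lc.
  have := ind (fun k => (if k \in V then c k else 0) - (k == j0)%:R) _ j0 (in_setT _).
  rewrite (negbTE nV) eqxx sub0r => /(_ _)/eqP; rewrite oppr_eq0 oner_eq0 => H.
  suff /H : \sum_(i in setT) ((if i \in V then c i else 0) - (i == j0)%:R) *: gen i = 0 by [].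
  under eq_bigr do rewrite scalerBl; rewrite sumrB; apply/eqP; rewrite subr_eq0; apply/eqP.
  rewrite [RHS](bigD1 j0) ?inE //= eqxx scale1r [X in _ = _ + X]big1 ?addr0; last first.
    by move=> k /andP[_ /negbTE->]; rewrite scale0r.
  rewrite E [RHS]big_mkcond; apply: eq_big => k; rewrite ?inE // => _.
  by case: ifP; rewrite ?scale0r.
have uniq_coef (b b' : 'I_r.+1 -> nat) :
    \sum_j (mm j - mu s) *+ b j = \sum_j (mm j - mu s) *+ b' j ->
    forall j, j != j0 -> b j = b' j.
  move=> E j jj; pose f k : R := (b k)%:R - (b' k)%:R.
  have := ind (fun k => f k - (if k == j0 then \sum_l f l else 0)) _ j (in_setT _).
  rewrite (negbTE jj) subr0 => H; apply/eqP; rewrite -(eqr_nat R) -subr_eq0; apply/eqP/H.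
  rewrite -[in LHS]/(\sum_(k in setT) (f k - (if k == j0 then \sum_l f l else 0)) *: gen k).
  under eq_bigr do rewrite scalerBl; rewrite sumrB.
  rewrite [X in _ - X](bigD1 j0) ?inE //= eqxx [X in _ - (_ + X)]big1 ?addr0; last first.
    by move=> k /andP[_ /negbTE->]; rewrite scale0r.
  rewrite scaler_suml; rewrite [X in X - _](eq_bigl xpredT) => [|k]; last by rewrite inE.
  rewrite -sumrB; under eq_bigr => k _ do rewrite -scalerBr.
  have gE k : gen k - gen j0 = hvec (lat R (mm k - mu s)) 0.
    by rewrite hvecN hvecD /lat raddfB subrr sE.
  under eq_bigr => k _ do rewrite gE scalerBl !scaler_nat.
  rewrite sumrB; apply/eqP; rewrite subr_eq0; apply/eqP.
  have F (c : 'I_r.+1 -> nat) : \sum_k hvec (lat R (mm k - mu s)) 0 *+ c k =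
      hvec (lat R (\sum_k (mm k - mu s) *+ c k)) 0.
    under eq_bigr do rewrite hvecMn mul0rn.
    rewrite hvec_sum [X in hvec _ X]big1 // /lat raddf_sum; congr hvec.
    by apply: eq_bigr => k _; rewrite raddfMn.
  by rewrite !F E.
have /choice[be beP] : forall u, exists b : 'I_r.+1 -> nat,
    in_dual (@cone R d Sigma s) u -> u = \sum_j (mm j - mu s) *+ b j.
  move=> u; case: (EM (in_dual (@cone R d Sigma s) u)) => [ud|no].
    by have [b bE] := dual_generated m_basis D_very_ample sM ud; exists b.
  by exists (fun=> 0%N).
(* The m_j - mu s generate the dual semigroup freely, so the chart is an affine space and the ratios
   x_j / x_j0 define a point of it. *)
pose g u := \prod_(j | j != j0) (x j / x j0) ^+ be u j.
have gE u b : in_dual (@cone R d Sigma s) u -> u = \sum_j (mm j - mu s) *+ b j ->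
    g u = \prod_(j | j != j0) (x j / x j0) ^+ b j.
  move=> ud uE; apply: eq_bigr => j jj; congr (_ ^+ _).
  by apply: uniq_coef => //; rewrite -uE -beP.
have dual0 : in_dual (@cone R d Sigma s) 0.
  by apply/in_dualP => i _; rewrite dot0l.
have gC : chart_point (@cone R d Sigma s) g.
  split=> [|u v ud vd].
    rewrite (gE 0 (fun=> 0%N)) //; first by rewrite big1.
    by rewrite big1 // => j _; rewrite mulr0n.
  rewrite (gE (u + v) (fun j => be u j + be v j)%N).
  - by rewrite -big_split; apply: eq_bigr => j _; rewrite exprD.
  - move/in_dualP: ud => ud; move/in_dualP: vd => vd; apply/in_dualP => i iS.
    by rewrite dotDl addr_ge0 ?ud ?vd.
  - rewrite {1}(beP u ud) {1}(beP v vd) -big_split; apply: eq_bigr => j _.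
    by rewrite mulrnDr.
exists s, g, (x j0); split=> // j.
rewrite /phi (gE _ (fun k => (k == j) : nat)); first last.
- rewrite (bigD1 j) //= eqxx mulr1n big1 ?addr0 // => k /negbTE->.
  by rewrite mulr0n.
- exact: (mm_dual m_basis).
case: (eqVneq j j0) => [->|jj].
  by rewrite big1 ?mulr1 // => k /negbTE->; rewrite expr0.
rewrite (bigD1 j) //= eqxx expr1 big1 ?mulr1 => [|k /andP[_ /negbTE->]]; last by rewrite expr0.
by rewrite mulrC divfK.
Qed.

Lemma relint_in_interior u n :
  relint gen setT (hvec (lat R u) n%:~R) <-> 0 < n /\ in_interior u n.
Proof.
have gspan j : exists e : 'I_r.+1 -> R, gen j = \sum_(k in setT) e k *: gen k.
  exact: (gen_spanned m_basis D_very_ample).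
split=> [[c c0 E]|[n0 iu]].
  split.
    rewrite -(ltr0z R); have := congr1 (dot (hvec 0 1)) E.
    rewrite dot_hvec dot0l mul1r add0r => ->; rewrite dot_sumr (bigD1 ord0) ?inE //=.
    have h j : dot (hvec 0 1) (c j *: gen j) = c j.
      by rewrite dotZr dot_hvec dot0l mul1r add0r mulr1.
    rewrite h ltr_pwDl ?c0 ?inE // sumr_ge0 // => j _.
    by rewrite h ltW ?c0 ?inE.
  move=> i; rewrite -(ltr0z R) -dot_facet_form E dot_sumr.
  have nn j : j \in setT -> 0 <= dot (facet_form i) (c j *: gen j).
    move=> jT; rewrite dotZr dot_facet_gen mulr_ge0 ?(ltW (c0 j jT)) //.
    by rewrite ler0z (slack_ge0 m_basis).
  rewrite lt_def sumr_ge0 // andbT psumr_eq0 //; apply/negP => /allP E1.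
  apply: (slack_not_all0 m_basis D_very_ample gspan (i := i)) => j jT.
  have := E1 j (mem_index_enum _); rewrite jT /= dotZr mulf_eq0 gt_eqF ?c0 //=.
  by rewrite dot_facet_gen intr_eq0 => /eqP.
pose sig := \sum_(j in [set: 'I_r.+1]) gen j.
have sigE : sig = hvec (\sum_(j in [set: 'I_r.+1]) lat R (mm j)) (#|[set: 'I_r.+1]|%:R).
  by rewrite /sig hvec_sum sumr_const.
(* The index None stands for n itself: e must also keep the last coordinate nonnegative. *)
have [[i|]|e e0 eP] := @exists_small_factor R (option 'I_(nrays Sigma)) xpredT
  (fun o => if o is Some i then (height i u n)%:~R else n%:~R)
  (fun o => if o is Some i then dot (facet_form i) sig else #|[set: 'I_r.+1]|%:R).
- by rewrite ltr0z.
- by rewrite ltr0z.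
have : local_cone gen setT set0 (hvec (lat R u) n%:~R - e *: sig).
  rewrite sigE hvecZ hvecN hvecD; apply: (local_cone_rays m_basis (vertex_setT D_very_ample)).
  - exact: sub0set.
  - by right; rewrite subr_ge0; apply: (eP None).
  - move=> i _; rewrite -hvecD -hvecN -hvecZ -sigE dotBr dotZr dot_facet_form subr_ge0.
    exact: (eP (Some i)).
case=> c c0 E; exists (fun j => c j + e) => [j jT|]; first by rewrite ltr_wpDl ?c0 ?inE.
under eq_bigr do rewrite scalerDl.
by rewrite big_split /= -E -scaler_sumr subrK.
Qed.

Definition family n u : pred {set 'I_r.+1} :=
  local_family gen setT (hvec (lat R u) n%:~R).

Lemma family_up n u S T : S \subset T -> family n u S -> family n u T.
Proof.
move=> ST /local_familyP[_ [c c0 E]]; apply/local_familyP; split; first exact: subsetT.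
by exists c => // j jT nT; apply: c0 => //; apply: contraNN nT; apply: (subsetP ST).
Qed.

Lemma lift_family n N S u : lift mm n N S u -> family n u S.
Proof.
move=> /lift_lattice_cone lc; apply/local_familyP; split; first exact: subsetT.
exact: lattice_cone_local.
Qed.

Lemma family_lifts n S u : S != set0 -> family n u S -> eventually_lifts mm n S u.
Proof.
move=> S0 /local_familyP[_ lc]; apply: lattice_cone_lift.
exact: (lattice_cone_of_local m_basis D_very_ample S0 lc).
Qed.

Lemma family_acyclic n u :
  (~ (n < 0 /\ in_interior (- u) (- n)) -> forall i, acyclic K (family n u) i) /\
  (n < 0 /\ in_interior (- u) (- n) -> forall i, acyclic K (family n u) i <-> i <> d.+1).
Proof.
have [H1 H2] := local_family_acyclic K (gen_pointed R m setT)
  (gen_spanned m_basis D_very_ample (hvec (lat R u) n%:~R)).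
have E : relint gen setT (- hvec (lat R u) n%:~R) <-> n < 0 /\ in_interior (- u) (- n).
  have -> : - hvec (lat R u) n%:~R = hvec (lat R (- u)) (- n)%:~R.
    by rewrite hvecN /lat raddfN rmorphN.
  by rewrite relint_in_interior oppr_gt0.
split=> [no|yes]; first by apply: H1 => /E.
by rewrite -(gen_rk m_basis D_very_ample); apply: H2; apply/E.
Qed.

(** For n = j + 1 - i the exceptional i = d + 1 would need an interior lattice point of (d - j) P.
    The empty set enters for i = 1, n = j, where normality supplies the lifts. *)
Lemma regular_max j : (0 < j)%N -> hollow_upto j -> k_normal P j -> regular X j.+1%:Z.
Proof.
move=> j0 hol nj i i0; apply: (ideal_H_vanishes_of_acyclic
  (embedded_vanishesP m_basis) (Fam := family (j.+1%:Z - i%:Z))) => //.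
- by move=> u S T; apply: family_up.
- by move=> ->; lia.
- by move=> N S u; apply: lift_family.
- move=> u; have [H1 H2] := family_acyclic (j.+1%:Z - i%:Z) u.
  case: (EM (j.+1%:Z - i%:Z < 0 /\ in_interior (- u) (- (j.+1%:Z - i%:Z)))) => [yes|/H1//].
  apply/(H2 yes) => id; have [neg iu] := yes.
  have dj : - (j.+1%:Z - i%:Z) = (d - j)%N by lia.
  apply: (hol (d - j)%N); first by lia.
  apply/has_interior_dilate; first by lia.
  by exists (- u); rewrite -dj.
- move=> u S Si fS; case: (eqVneq S set0) => [S0|S0]; last exact: family_lifts.
  have i1 : i = 1%N by rewrite -Si S0 cards0.
  apply: lattice_cone_lift; rewrite S0 i1; have -> : j.+1%:Z - 1%:Z = j by lia.
  apply: ((k_normalP m_basis j0).1 nj) => k.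
  have [_ lc] := local_familyP _ _ _ _ fS; rewrite S0 i1 in lc.
  have := local_cone_height m_basis lc (i := k); rewrite dot_facet_form ler0z.
  have -> : j.+1%:Z - 1%:Z = j by lia.
  by apply=> l; rewrite inE.
Qed.

(** Vanishing for i = d + 1 gives hollowness and for i = 1 normality. That j is positive comes from
    [exists_low_interior]: for l <= 1 the polytope (d + 1 - l) P has an interior lattice point. *)
Lemma regular_bounds l : (d < r)%N -> regular X l ->
  exists j : nat, [/\ l = j.+1%:Z, (0 < j)%N, hollow_upto j & k_normal P j].
Proof.
move=> dr reg; pose n := l - d.+1%:Z.
have van := embedded_vanishesP m_basis (K := K).
have noint u : n < 0 -> ~ in_interior (- u) (- n).
  move=> n0 iu; have [_ /(_ (conj n0 iu)) H] := family_acyclic n u.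
  suff /H : acyclic K (family n u) d.+1 by [].
  move=> q qP dq.
  have [|||||e e0 de] := @coboundary_of_ideal_H_vanishes _ _ _ _ _ van n (family n) d.+1 u q.
  - by rewrite ltnS.
  - by move=> S Sd; apply: family_lifts; rewrite -card_gt0 Sd.
  - exact: qP.
  - move=> T; case: (boolP (family n u T)) => [/dq//|nT].
    apply: codiff_eq0 => i iT; apply/eqP; apply: contraNT nT => /qP[F _].
    by apply: family_up F; apply: subsetDl.
  - exact: reg.
  by exists e => // S /e0[Sd [N /lift_family]].
have [k [v [kd iv]]] := exists_low_interior m_basis D_very_ample dr.
have l1 : 1 < l.
  rewrite ltNge; apply/negP => l1.
  have [w iw] : exists w, in_interior w (- n).
    have -> : - n = `|n|%N by rewrite /n; lia.
    by apply: (in_interior_up m_basis D_very_ample _ iv); rewrite /n; lia.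
  by apply: (@noint (- w)); rewrite ?opprK // /n; lia.
pose j := (`|l|%N).-1; have lj : l = j.+1%:Z by rewrite /j; lia.
have j0 : (0 < j)%N by rewrite /j; lia.
have hol : hollow_upto j.
  move=> q qd /has_interior_dilate[|w iw]; first by lia.
  have [|w' iw'] := in_interior_up m_basis D_very_ample (k := (d - j)%N) _ iw; first by lia.
  apply: (@noint (- w')); rewrite ?opprK /n lj; first by lia.
  by have -> : - (j.+1%:Z - d.+1%:Z) = (d - j)%N by lia.
exists j; split=> //; apply/(k_normalP m_basis j0) => u uc.
have allF S : family j u S.
  apply: (@family_up _ _ set0); first exact: sub0set.
  apply/local_familyP; split; first exact: sub0set.
  exact: (in_cone_local m_basis (vertex_setT D_very_ample)).
(* q is 1 on singletons. Any primitive is nonzero at the empty set, and a lift of u there writes u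
   as a sum of j of the m's. *)
pose q := codiff (fun S : {set 'I_r.+1} => (S == set0)%:R : K).
have [|S Si _|S nz|T||e e0 de] :=
  @coboundary_of_ideal_H_vanishes _ _ _ _ _ van j (family j) 1%N u q.
- by rewrite (leq_ltn_trans (leq0n d) dr).
- by apply: family_lifts => //; rewrite -card_gt0 Si.
- split; first exact: allF.
  apply: (codiff_card _ nz) => T; case: (eqVneq T set0) => [-> _|_]; first by rewrite cards0.
  by rewrite eqxx.
- exact: codiffK.
- by have := reg 1%N isT; rewrite lj; have -> : j.+1%:Z - 1%:Z = j by lia.
have : codiff e [set ord0] != 0.
  by rewrite de /q /codiff big_set1 setDv eqxx mulr1 signr_eq0.
case/codiff_neq0 => i; rewrite inE => /eqP->; rewrite setDv => /e0[_ [N]].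
exact: lift_lattice_cone.
Qed.

End Regularity.

Theorem proposition4p5 (R : realType) (K : closedFieldType) (d r : nat)
    (Sigma : complete_fan R d) (D : cartier_divisor Sigma)
    (m : r.+1.-tuple 'rV[int]_d)
    (m_basis : section_basis D m)
    (D_very_ample : very_ample K D m)
    (X_proper : proper_subvariety (embedded_variety (K := K) D m)) :
  exists kP degP : nat,
    [/\ is_kP (polytope_of D) kP,
        is_deg (polytope_of D) degP
      & is_reg (embedded_variety (K := K) D m) (Posz (maxn kP degP).+1)].
Proof.
have [kP kPP] := exists_kP m_basis D_very_ample.
have [degP [degPP hollow_deg degP_min]] := exists_deg D.
have [[kP0 normal_kP] kP_min] := kPP.
exists kP, degP; split=> //; split.
  apply: (regular_max m_basis D_very_ample).
  - by rewrite leq_max kP0.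
  - exact: hollow_uptoW (leq_maxr _ _) hollow_deg.
  - exact: normal_kP (leq_maxl _ _).
move=> l /(regular_bounds m_basis D_very_ample (proper_codim m_basis D_very_ample X_proper)).
case=> j [-> j0 hol nj]; rewrite lez_nat ltnS geq_max degP_min // andbT.
(* Regularity gives normality at j alone; hollowness carries it to all larger heights, as k_P
   demands. *)
by apply: kP_min; split=> //; apply: (k_normal_from m_basis D_very_ample).
Qed.
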